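(* $\mathcal{H}$ is a cocommutative $\times_R$-bialgebra, whence the left $\mathcal{H}$-modules $\mathcal{H}\text{-}\mathrm{Mod} = (\mathcal{H}\text{-}\mathrm{Mod}, \otimes_R, R)$ form a symmetric tensor category. An object in $\mathcal{H}\text{-}\mathrm{Mod}$ has its dual, if it is finitely generated projective as an $R$-module.
   Context: Basic setting. $C$ is a field, $C(t)$ the field of rational functions over $C$, and $q\in C\setminus\{0,1\}$ is a root of unity of order $N>1$. $\Bbbk_0$ is the prime field of $C$ and $\Bbbk=\Bbbk_0(q)\subset C$; vector spaces, algebras, Hopf algebras and unadorned $\otimes$ are over $\Bbbk$. $\binom{r}{s}_q$ is the $q$-binomial coefficient (the Gaussian binomial polynomial evaluated at $q$). $\delta_{n,0}$ is the Kronecker delta. $R$ is a commutative ring including $C(t)$, with a ring automorphism $\sigma_q:R\to R$ extending $f(t)\mapsto f(qt)$ on $C(t)$. An iterative $q$-difference operator on $R$ is a sequence $(\delta_R^{(k)})_{k\ge 0}$ of maps $R\to R$ such that (1) $\delta_R^{(0)}=\mathrm{id}_R$; (2) $\delta_R^{(1)}=\frac{1}{(q-1)t}(\sigma_q-\mathrm{id}_R)$; (3) each $\delta_R^{(k)}$ is additive; (4) $\delta_R^{(k)}(xy)=\sum_{i+j=k}\sigma_q^i\circ\delta_R^{(j)}(x)\,\delta_R^{(i)}(y)$; (5) $\delta_R^{(i)}\circ\delta_R^{(j)}=\binom{i+j}{i}_q\delta_R^{(i+j)}$. We fix such an operator on $R$. The Hopf algebra $H$. $G=\langle\sigma\mid\sigma^N=1\rangle$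 is the cyclic group of order $N$. $H=\bigoplus_{i\ge 0}(\Bbbk G)\delta^{(i)}$ is the Hopf algebra over $\Bbbk$ that is free as a left $\Bbbk G$-module on the basis $\delta^{(i)}$, $i\in\mathbb{N}$, contains $\Bbbk G$ ($\sigma$ grouplike) as a Hopf subalgebra, and has $\delta^{(0)}=1$, $\delta^{(i)}\delta^{(j)}=\binom{i+j}{i}_q\delta^{(i+j)}$, $\delta^{(i)}\sigma=q^i\sigma\delta^{(i)}$, $\Delta(\delta^{(k)})=\sum_{i+j=k}\sigma^j\delta^{(i)}\otimes\delta^{(j)}$, $\varepsilon(\delta^{(k)})=\delta_{k,0}$. Put $\delta=\delta^{(1)}$. The ring $R$ is a left $H$-module algebra by $\sigma\rightharpoonup x=\sigma_q(x)$, $\delta^{(k)}\rightharpoonup x=\delta_R^{(k)}(x)$. The algebra $\mathcal{H}$. The smash product $R\#H$ is $R\otimes H$ with product $(x\#h)(y\#g)=\sum x(h_1\rightharpoonup y)\#h_2g$; it is an $R$-coalgebra (with left $R$-module structure) by base extension of the coalgebra $H$ along $\Bbbk\to R$. Write $h$ for $1\#h$. Let $I$ be the two-sided ideal of $R\#H$ generated by $\delta-\frac{1}{(q-1)t}(\sigma-1)$; it is also a coideal. Put $\mathcal{H}=R\#H/I$, with the induced algebra and $R$-coalgebra structures. $\times_R$-bialgebras. An $R$-ring is an algebra given an algebra map from $R$. For an $R$-ring $\mathcal{A}$, let $\mathcal{A}\otimes_R\mathcal{A}$ be the tensor product of the left $R$-module $\mathcal{A}$ with itself, and $\mathcal{A}\times_R\mathcal{A}=\{\sum_i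 a_i\otimes b_i\in\mathcal{A}\otimes_R\mathcal{A}\mid\sum_i a_ix\otimes b_i=\sum_i a_i\otimes b_ix\ \forall x\in R\}$, an $R$-ring under the componentwise product and $x\mapsto x\otimes 1=1\otimes x$. Suppose $\mathcal{A}$ is projective as a left $R$-module and the left $R$-module $\mathcal{A}$ has an $R$-coalgebra structure $\Delta:\mathcal{A}\to\mathcal{A}\otimes_R\mathcal{A}$, $\varepsilon:\mathcal{A}\to R$. It is a $\times_R$-bialgebra if (a) $\Delta(\mathcal{A})\subset\mathcal{A}\times_R\mathcal{A}$; (b) $\Delta:\mathcal{A}\to\mathcal{A}\times_R\mathcal{A}$ is an algebra map; (c) $\varepsilon(1)=1$; (d) $\varepsilon(ab)=\varepsilon(a\varepsilon(b))$ for all $a,b\in\mathcal{A}$. It is cocommutative if it is so as an $R$-coalgebra. For a $\times_R$-bialgebra $\mathcal{A}$, the tensor product of left $\mathcal{A}$-modules $M,N$ is $M\otimes_RN$ with $a\rightharpoonup(m\otimes n)=\sum(a_1\rightharpoonup m)\otimes(a_2\rightharpoonup n)$, the unit object is $R$ with $a\rightharpoonup x=\varepsilon(ax)$, and the associativity and unit constraints and the symmetry are the obvious ones. ''Dual'' means dual object in the tensor category. *)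

(* Defs.v *)
From HB Require Import structures.
From mathcomp Require Import all_boot all_order all_algebra.
From mathcomp Require Import boolp.

Set Implicit Arguments.
Unset Strict Implicit.
Unset Printing Implicit Defensive.

Import GRing.Theory.
Local Open Scope ring_scope.
Local Open Scope quotient_scope.

Section TensorDef.
Variables (R : comPzRingType) (M N : lmodType R).

(* Formal sums of pairs, encoded as sequences, modulo bilinearity.  Signs are
   not needed in the sums, since - (m (x) n) is (- m) (x) n; the class of a
   formal sum is recovered from the quotient [tens] below. *)
Inductive tens_rel : seq (M * N) -> seq (M * N) -> Prop :=
| tens_refl s : tens_rel s s
| tens_sym s s' : tens_rel s s' -> tens_rel s' s
| tens_trans s s' s'' : tens_rel s s' -> tens_rel s' s'' -> tens_rel s s''
| tens_cat s1 s1' s2 s2' :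
    tens_rel s1 s1' -> tens_rel s2 s2' -> tens_rel (s1 ++ s2) (s1' ++ s2')
| tens_catC s1 s2 : tens_rel (s1 ++ s2) (s2 ++ s1)
| tens_0 n : tens_rel [:: (0, n)] [::]
| tens_addl m m' n : tens_rel [:: (m + m', n)] [:: (m, n); (m', n)]
| tens_addr m n n' : tens_rel [:: (m, n + n')] [:: (m, n); (m, n')]
| tens_bal r m n : tens_rel [:: (r *: m, n)] [:: (m, r *: n)].

Definition tens_relb (s s' : seq (M * N)) : bool := `[< tens_rel s s' >].

Lemma tens_relb_refl : reflexive tens_relb.
Proof. by move=> s; apply/asboolP/tens_refl. Qed.
Lemma tens_relb_sym : symmetric tens_relb.
Proof. by move=> s s'; apply/asboolP/asboolP; apply: tens_sym. Qed.
Lemma tens_relb_trans : transitive tens_relb.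
Proof.
by move=> s s' s'' /asboolP h /asboolP h'; apply/asboolP; exact: tens_trans h h'.
Qed.

Canonical tens_equiv :=
  EquivRel tens_relb tens_relb_refl tens_relb_sym tens_relb_trans.

Definition tens : Type := {eq_quot tens_relb}.
HB.instance Definition _ := Choice.on tens.
HB.instance Definition _ := EqQuotient.on tens.

Lemma tens_piP s s' : tens_rel s s' <-> \pi_tens s = \pi_tens s'.
Proof.
split=> [h|h]; first by apply/eqP; rewrite piE; apply/asboolP.
by move/eqP: h; rewrite piE => /asboolP.
Qed.

Lemma tensW (u : tens) : exists s, u = \pi_tens s.
Proof. by exists (repr u); rewrite reprK. Qed.

Lemma tens_repr_rel s : tens_rel (repr (\pi_tens s)) s.
Proof. by apply/tens_piP; rewrite reprK. Qed.

Lemma tens_rel_map (f : M -> M) s s' : {morph f : x y / x + y} ->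
    (forall r x, f (r *: x) = r *: f x) -> tens_rel s s' ->
  tens_rel [seq (f p.1, p.2) | p <- s] [seq (f p.1, p.2) | p <- s'].
Proof.
move=> fD fZ; have f0 : f 0 = 0 by rewrite -(scale0r (0 : M)) fZ !scale0r.
elim=> {s s'} [s|s s' _|s s' s'' _ h _|s1 s1' s2 s2' _ h1 _ h2|s1 s2|n|m m' n|m n n'|r m n] /=.
- exact: tens_refl.
- exact: tens_sym.
- exact: tens_trans.
- by rewrite !map_cat; apply: tens_cat.
- by rewrite !map_cat; apply: tens_catC.
- by rewrite f0; apply: tens_0.
- by rewrite fD; apply: tens_addl.
- exact: tens_addr.
- by rewrite fZ; apply: tens_bal.
Qed.

Definition tens_zero : tens := \pi_tens [::].
Definition tens_add (u v : tens) : tens := \pi_tens (repr u ++ repr v).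
Definition tens_mapl (f : M -> M) (u : tens) : tens :=
  \pi_tens [seq (f p.1, p.2) | p <- repr u].

Lemma tens_addE s s' : tens_add (\pi_tens s) (\pi_tens s') = \pi_tens (s ++ s').
Proof. by apply/tens_piP/tens_cat; apply: tens_repr_rel. Qed.

Lemma tens_maplE (f : M -> M) s : {morph f : x y / x + y} ->
    (forall r x, f (r *: x) = r *: f x) ->
  tens_mapl f (\pi_tens s) = \pi_tens [seq (f p.1, p.2) | p <- s].
Proof. by move=> fD fZ; apply/tens_piP/tens_rel_map/tens_repr_rel. Qed.

Let oppD : {morph (@GRing.opp M) : x y / x + y} := @opprD M.
Let oppZ r (x : M) : - (r *: x) = r *: - x. Proof. by rewrite scalerN. Qed.
Let scaleD (r : R) : {morph ( *:%R r : M -> M) : x y / x + y} := @scalerDr R M r.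
Let scaleZ (r : R) r' (x : M) : r *: (r' *: x) = r' *: (r *: x).
Proof. by rewrite !scalerA mulrC. Qed.

Lemma tens_addA : associative tens_add.
Proof.
move=> u v w; case: (tensW u) => s1 ->; case: (tensW v) => s2 ->; case: (tensW w) => s3 ->.
by rewrite !tens_addE catA.
Qed.
Lemma tens_addC : commutative tens_add.
Proof.
move=> u v; case: (tensW u) => s1 ->; case: (tensW v) => s2 ->; rewrite !tens_addE.
exact/tens_piP/tens_catC.
Qed.
Lemma tens_add0 : left_id tens_zero tens_add.
Proof. by move=> u; case: (tensW u) => s ->; rewrite tens_addE. Qed.
Lemma tens_addN : left_inverse tens_zero (tens_mapl -%R) tens_add.
Proof.
move=> u; case: (tensW u) => s ->; rewrite tens_maplE; do ?[exact: scaleD | exact: scaleZ | exact: oppD | exact: oppZ]; rewrite tens_addE; apply/tens_piP.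
elim: s => [|[m n] s IH] /=; first exact: tens_refl.
rewrite -cat_cons -cat1s -(cat1s (m, n)) !catA; set s' := map _ _ in IH *.
have h : tens_rel ([:: (- m, n)] ++ s' ++ [:: (m, n)] ++ s)
                  (([:: (- m, n)] ++ [:: (m, n)]) ++ (s' ++ s)).
  rewrite -!catA; apply: tens_cat; first exact: tens_refl.
  rewrite !catA; apply: tens_cat; [exact: tens_catC | exact: tens_refl].
rewrite -!catA; apply: tens_trans h _; rewrite -[[::]]cats0; apply: tens_cat IH.
have := tens_addl (- m) m n; rewrite addNr => /tens_sym h.
exact: tens_trans h (tens_0 _).
Qed.

HB.instance Definition _ :=
  GRing.isZmodule.Build tens tens_addA tens_addC tens_add0 tens_addN.

Definition tens_scale (r : R) : tens -> tens := tens_mapl ( *:%R r).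

Lemma tens_scaleA r r' u : tens_scale r (tens_scale r' u) = tens_scale (r * r') u.
Proof.
case: (tensW u) => s ->; rewrite /tens_scale !tens_maplE; do ?[exact: scaleD | exact: scaleZ | exact: oppD | exact: oppZ].
by congr (\pi_tens _); rewrite -map_comp; apply: eq_map => p /=; rewrite scalerA.
Qed.
Lemma tens_scale1 : left_id 1 tens_scale.
Proof.
move=> u; case: (tensW u) => s ->; rewrite /tens_scale !tens_maplE; do ?[exact: scaleD | exact: scaleZ | exact: oppD | exact: oppZ].
congr (\pi_tens _); rewrite -[RHS]map_id; apply: eq_map => -[m n] /=.
by rewrite scale1r.
Qed.
Lemma tens_scaleDr : right_distributive tens_scale +%R.
Proof.
move=> r u v; case: (tensW u) => s ->; case: (tensW v) => s' ->.
rewrite [X in tens_scale _ X]tens_addE /tens_scale !tens_maplE; do ?[exact: scaleD | exact: scaleZ | exact: oppD | exact: oppZ].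
by rewrite [RHS]tens_addE map_cat.
Qed.
Lemma tens_scaleDl u : {morph tens_scale^~ u : a b / a + b}.
Proof.
case: (tensW u) => s ->; move=> a b; rewrite /tens_scale !tens_maplE; do ?[exact: scaleD | exact: scaleZ | exact: oppD | exact: oppZ].
rewrite [RHS]tens_addE; apply/tens_piP.
elim: s => [|[m n] s IH] /=; first exact: tens_refl.
rewrite -!cat_cons -cat1s -[X in X ++ _]cat1s -[(b *: m, n) :: _]cat1s.
set s1 := map _ _ in IH *; set s2 := map _ _ in IH *; set s3 := map _ _ in IH *.
have h : tens_rel (([:: (a *: m, n)] ++ [:: (b *: m, n)]) ++ (s2 ++ s3))
   ((([:: (a *: m, n)] ++ s2) ++ ([:: (b *: m, n)] ++ s3))).
  rewrite -!catA; apply: tens_cat; first exact: tens_refl.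
  rewrite !catA; apply: tens_cat; [exact: tens_catC | exact: tens_refl].
apply: tens_trans h; apply: tens_cat IH.
by rewrite scalerDl; apply: tens_addl.
Qed.

HB.instance Definition _ := GRing.Zmodule_isLmodule.Build R tens
  tens_scaleA tens_scale1 tens_scaleDr tens_scaleDl.

Definition tprod (m : M) (n : N) : tens := \pi_tens [:: (m, n)].
Definition tsum (s : seq (M * N)) : tens := \sum_(p <- s) tprod p.1 p.2.

Lemma tsumE s : tsum s = \pi_tens s.
Proof.
elim: s => [|[m n] s IH]; rewrite /tsum ?big_nil // big_cons.
by rewrite -/(tsum s) IH /tprod [LHS]tens_addE.
Qed.
Lemma tensP u : exists s, u = tsum s.
Proof. by exists (repr u); rewrite tsumE reprK. Qed.

Lemma tprodDl m m' n : tprod (m + m') n = tprod m n + tprod m' n.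
Proof. by rewrite [RHS]tens_addE; apply/tens_piP/tens_addl. Qed.
Lemma tprodDr m n n' : tprod m (n + n') = tprod m n + tprod m n'.
Proof. by rewrite [RHS]tens_addE; apply/tens_piP/tens_addr. Qed.
Lemma tprodZl r m n : tprod (r *: m) n = r *: tprod m n.
Proof. by rewrite /GRing.scale /= /tens_scale tens_maplE; do ?[exact: scaleD | exact: scaleZ | exact: oppD | exact: oppZ]. Qed.
Lemma tprodZr r m n : tprod m (r *: n) = r *: tprod m n.
Proof. by rewrite -tprodZl; apply/tens_piP/tens_sym/tens_bal. Qed.

Lemma tprodNl m n : tprod (- m) n = - tprod m n.
Proof. by rewrite -scaleN1r tprodZl scaleN1r. Qed.
Lemma tprodNr m n : tprod m (- n) = - tprod m n.
Proof. by rewrite -scaleN1r tprodZr scaleN1r. Qed.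

Definition balanced (Z : zmodType) (f : M -> N -> Z) : Prop :=
  [/\ forall m m' n, f (m + m') n = f m n + f m' n,
      forall m n n', f m (n + n') = f m n + f m n'
    & forall r m n, f (r *: m) n = f m (r *: n)].

(* The map out of M (x) N induced by f, evaluated on a chosen decomposition.
   It is independent of the choice, additive, and sends m (x) n to f m n
   whenever f is balanced ([tlift_tsum], [tlift_add], [tliftE]). *)
Definition tlift (Z : zmodType) (f : M -> N -> Z) (u : tens) : Z :=
  \sum_(p <- repr u) f p.1 p.2.

Section Lift.
Variable Z : zmodType.
Implicit Types f g : M -> N -> Z.

Lemma tlift_pi f s : balanced f -> tlift f (\pi_tens s) = \sum_(p <- s) f p.1 p.2.
Proof.
case=> fDl fDr fB; rewrite /tlift.
move: (repr _) (tens_repr_rel s) => s0; elim=> {s s0}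
  [s|s s' _|s s' s'' _ h _|s1 s1' s2 s2' _ h1 _ h2|s1 s2|n|m m' n|m n n'|r m n].
- by [].
- by [].
- by rewrite h.
- by rewrite !big_cat /= h1 h2.
- by rewrite !big_cat /= addrC.
- rewrite big_seq1 big_nil /=; apply: (addrI (f 0 n)).
  by rewrite -fDl addr0 addr0.
- by rewrite !big_cons big_nil !addr0 fDl.
- by rewrite !big_cons big_nil !addr0 fDr.
- by rewrite !big_seq1 fB.
Qed.

Lemma tlift_tsum f s : balanced f -> tlift f (tsum s) = \sum_(p <- s) f p.1 p.2.
Proof. by rewrite tsumE; apply: tlift_pi. Qed.

Lemma tliftE f m n : balanced f -> tlift f (tprod m n) = f m n.
Proof. by move=> /tlift_pi ->; rewrite big_seq1. Qed.

Lemma tlift_add f : balanced f -> {morph tlift f : u v / u + v}.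
Proof.
move=> fB; move=> u v; case: (tensW u) => s ->; case: (tensW v) => s' ->; rewrite [X in tlift _ X]tens_addE.
by rewrite !tlift_pi // big_cat.
Qed.
Lemma tlift0 f : balanced f -> tlift f 0 = 0.
Proof. by move=> h; apply: (addrI (tlift f 0)); rewrite -tlift_add // !addr0. Qed.

Lemma eq_tlift f g : f =2 g -> tlift f =1 tlift g.
Proof. by move=> e u; apply: eq_bigr => p _; rewrite e. Qed.
Lemma tliftDf f g u : tlift (fun m n => f m n + g m n) u = tlift f u + tlift g u.
Proof. exact: big_split. Qed.

Lemma tens_ext (F G : tens -> Z) :
  {morph F : u v / u + v} -> {morph G : u v / u + v} ->
  (forall m n, F (tprod m n) = G (tprod m n)) -> F =1 G.
Proof.
move=> FD GD e u; have [s ->] := tensP u; rewrite /tsum.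
have F0 : F 0 = 0 by apply: (addrI (F 0)); rewrite -FD !addr0.
have G0 : G 0 = 0 by apply: (addrI (G 0)); rewrite -GD !addr0.
by rewrite (big_morph _ FD F0) (big_morph _ GD G0); apply: eq_bigr.
Qed.
End Lift.

Lemma tliftZ (Z : lmodType R) (f : M -> N -> Z) r u :
  balanced f -> (forall m n, f (r *: m) n = r *: f m n) ->
  tlift f (r *: u) = r *: tlift f u.
Proof.
move=> fB fZ; move: u; apply: tens_ext => [u v|u v|m n].
- by rewrite scalerDr tlift_add.
- by rewrite tlift_add // scalerDr.
- by rewrite -tprodZl !tliftE.
Qed.

Lemma tliftf_morph (Y Z : zmodType) (F : {additive Y -> Z}) (f : M -> N -> Y) u :
  F (tlift f u) = tlift (fun m n => F (f m n)) u.
Proof. by rewrite /tlift raddf_sum. Qed.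

Lemma tprod_suml I (s : seq I) (f : I -> M) n :
  tprod (\sum_(j <- s) f j) n = \sum_(j <- s) tprod (f j) n.
Proof.
apply: (big_morph (fun m => tprod m n)) => [m m'|]; first exact: tprodDl.
by rewrite -(scale0r (0 : M)) tprodZl scale0r.
Qed.
Lemma tprod_sumr I (s : seq I) (f : I -> N) m :
  tprod m (\sum_(j <- s) f j) = \sum_(j <- s) tprod m (f j).
Proof.
apply: (big_morph (tprod m)) => [n n'|]; first exact: tprodDr.
by rewrite -(scale0r (0 : N)) tprodZr scale0r.
Qed.

Lemma tprod_bal : balanced tprod.
Proof.
split; [exact: tprodDl | exact: tprodDr |].
by move=> r m n; rewrite tprodZl tprodZr.
Qed.
End TensorDef.

Arguments tprod {R M N}.
Arguments tsum {R M N}.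

Definition tmap (R : comPzRingType) (M N M' N' : lmodType R)
    (f : M -> M') (g : N -> N') (u : tens M N) : tens M' N' :=
  tlift (fun m n => tprod (f m) (g n)) u.

Definition tswap (R : comPzRingType) (M N : lmodType R) (u : tens M N) :
    tens N M :=
  tlift (fun m n => tprod n m) u.

Definition tassoc (R : comPzRingType) (M N P : lmodType R)
    (u : tens (tens M N) P) : tens M (tens N P) :=
  tlift (fun v p => tlift (fun m n => tprod m (tprod n p)) v) u.

(* M viewed as an R-module by restriction of scalars along i. *)
Definition restr (R A : pzRingType) (i : {rmorphism R -> A})
  (M : lmodType A) : Type := M.

Lemma tmap_bal (R : comPzRingType) (M N M' N' : lmodType R)
    (f : {linear M -> M'}) (g : {linear N -> N'}) :
  balanced (fun m n => tprod (f m) (g n)).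
Proof.
split=> [m m' n|m n n'|r m n].
- by rewrite linearD tprodDl.
- by rewrite linearD tprodDr.
- by rewrite !linearZ /= tprodZl tprodZr.
Qed.

Lemma tassoc_bal1 (R : comPzRingType) (M N P : lmodType R) (p : P) :
  balanced (fun (m : M) (n : N) => tprod m (tprod n p)).
Proof.
split=> [m m' n|m n n'|r m n].
- by rewrite tprodDl.
- by rewrite tprodDl tprodDr.
- by rewrite !tprodZl tprodZr.
Qed.

Lemma tassoc_bal (R : comPzRingType) (M N P : lmodType R) :
  balanced (fun v (p : P) => tlift (fun (m : M) (n : N) => tprod m (tprod n p)) v).
Proof.
split=> [u v p|v p p'|r v p].
- exact/tlift_add/tassoc_bal1.
- by rewrite -tliftDf; apply: eq_tlift => m n; rewrite !tprodDr.
- have [s ->] := tensP v; rewrite tliftZ; last 2 first.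
  + exact: tassoc_bal1.
  + by move=> m n; rewrite tprodZl.
  rewrite !tlift_tsum; try exact: tassoc_bal1.
  by rewrite scaler_sumr; apply: eq_bigr => q _; rewrite !tprodZr.
Qed.

Section Restriction.
Variables (R A : pzRingType) (i : {rmorphism R -> A}) (M : lmodType A).

HB.instance Definition _ := GRing.Zmodule.on (restr i M).

Definition restr_scale (r : R) (m : restr i M) : restr i M := (i r *: (m : M)).
Lemma restr_scaleA r r' m :
  restr_scale r (restr_scale r' m) = restr_scale (r * r') m.
Proof. by rewrite /restr_scale scalerA rmorphM. Qed.
Lemma restr_scale1 : left_id 1 restr_scale.
Proof. by move=> m; rewrite /restr_scale rmorph1 scale1r. Qed.
Lemma restr_scaleDr : right_distributive restr_scale +%R.
Proof. by move=> r m m'; rewrite /restr_scale scalerDr. Qed.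
Lemma restr_scaleDl m : {morph restr_scale^~ m : r r' / r + r'}.
Proof. by move=> r r'; rewrite /restr_scale rmorphD scalerDl. Qed.
HB.instance Definition _ := GRing.Zmodule_isLmodule.Build R (restr i M)
  restr_scaleA restr_scale1 restr_scaleDr restr_scaleDl.

Lemma restrZ r (m : restr i M) : r *: m = i r *: (m : M) :> M.
Proof. by []. Qed.

End Restriction.

(* The left R-module underlying the ring A, for i : R -> A. *)
Notation rmod i := (restr i (GRing.regular _)).
Notation rtprod i a b := (tprod (a : rmod i) (b : rmod i)).

Section Coalgebra.
Variables (R : comPzRingType) (A : lmodType R).
Variables (D : A -> tens A A) (e : A -> R).

Definition coassociative : Prop :=
  forall a, tassoc (tmap D idfun (D a)) = tmap idfun D (D a).

Definition counital : Prop := forall a,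
  tlift (fun a1 a2 => e a1 *: a2) (D a) = a /\
  tlift (fun a1 a2 => e a2 *: a1) (D a) = a.

Definition cocommutative : Prop := forall a, tswap (D a) = D a.
End Coalgebra.

Lemma coassoc_lift (R : comPzRingType) (A : lmodType R)
    (D : {linear A -> tens A A}) (Z : zmodType) (F : A -> A -> A -> Z) :
  coassociative D ->
  (forall a, balanced (F a)) -> (forall c, balanced (fun a b => F a b c)) ->
  forall h, tlift (fun a b => tlift (F a) (D b)) (D h) =
            tlift (fun a b => tlift (fun a1 a2 => F a1 a2 b) (D a)) (D h).
Proof.
move=> DA FB FB' h; have := DA h.
pose L (v : tens A (tens A A)) := tlift (fun m w => tlift (F m) w) v.
have LB : balanced (fun m w => tlift (F m) w).
  split=> [m m' n|m n n'|r m n].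
  - rewrite -tliftDf; apply: eq_tlift => a b.
    by have [-> _ _] := FB' b.
  - exact: tlift_add.
  - have [s ->] := tensP n; rewrite /tsum scaler_sumr.
    rewrite !(big_morph _ (tlift_add (FB _)) (tlift0 (FB _))).
    apply: eq_bigr => p _; rewrite -tprodZl !tliftE //.
    by have [_ _ ->] := FB' p.2.
have LD : {morph L : u v / u + v} by apply: tlift_add.
move/(congr1 L); rewrite /tassoc /tmap.
have [s ->] := tensP (D h); rewrite !tlift_tsum.
- rewrite (big_morph _ (tlift_add (tassoc_bal _ _ _)) (tlift0 (tassoc_bal _ _ _))).
  rewrite !(big_morph _ LD (tlift0 LB)) => e; symmetry.
  apply: etrans (etrans e _); apply: eq_bigr => p _; last by rewrite /L tliftE.
  rewrite tliftE; last exact: tassoc_bal.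
  have [t ->] := tensP (D p.1); rewrite !tlift_tsum //; last exact: tassoc_bal1.
  rewrite (big_morph _ LD (tlift0 LB)); apply: eq_bigr => q _.
  by rewrite /L !tliftE.
- split=> [a a' b|a b b'|r a b].
  + by rewrite linearD tlift_add.
  + by rewrite -tliftDf; apply: eq_tlift => c d; have [_ -> _] := FB c.
  + have [s' e] := tensP (D a); rewrite linearZ /= e /tsum scaler_sumr.
    rewrite !(big_morph _ (tlift_add (FB' _)) (tlift0 (FB' _))).
    apply: eq_bigr => p _; rewrite -tprodZr !tliftE //.
    by have [_ _ ->] := FB p.1.
- split=> [a a' b|a b b'|r a b].
  + by rewrite -tliftDf; apply: eq_tlift => c d; have [-> _ _] := FB' d.
  + by rewrite linearD tlift_add.
  + have [s' e] := tensP (D b); rewrite linearZ /= e /tsum scaler_sumr.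
    rewrite !(big_morph _ (tlift_add (FB _)) (tlift0 (FB _))).
    apply: eq_bigr => p _; rewrite -tprodZl !tliftE //.
    by have [_ _ ->] := FB' p.2.
- exact: (tmap_bal idfun D).
- exact: (tmap_bal D idfun).
Qed.

(* Componentwise product of two formal sums of pairs. *)
Definition cwprod (A : pzRingType) (s s' : seq (A * A)) : seq (A * A) :=
  [seq (p.1 * p'.1, p.2 * p'.2) | p <- s, p' <- s'].

(* In [hcomulM], the product of H (x) H is the componentwise one, computed on
   arbitrary decompositions of the two factors. *)
Record hopfAlgebra (k : fieldType) := HopfAlgebra {
  hopf_alg :> algType k;
  hcomul : {linear hopf_alg -> tens hopf_alg hopf_alg};
  hcounit : {linear hopf_alg -> GRing.regular k};
  hantipode : {linear hopf_alg -> hopf_alg};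
  hcomulA : coassociative hcomul;
  hcounitP : counital hcomul hcounit;
  hcomul1 : hcomul 1 = tprod 1 1;
  hcomulM : forall g h s s', hcomul g = tsum s -> hcomul h = tsum s' ->
    hcomul (g * h) = tsum (cwprod s s');
  hcounit1 : hcounit 1 = 1;
  hcounitM : forall g h, hcounit (g * h) = hcounit g * hcounit h;
  hantipodeP : forall h,
    tlift (fun a b => hantipode a * b) (hcomul h) = hcounit h *: 1 /\
    tlift (fun a b => a * hantipode b) (hcomul h) = hcounit h *: 1 }.

Arguments hcomul {k _}.
Arguments hcounit {k _}.
Arguments hantipode {k _}.

(* R is a k-algebra through i. *)
Record moduleAlgebra (k : fieldType) (R : comNzRingType)
    (i : {rmorphism k -> R}) (H : hopfAlgebra k) := ModuleAlgebra {
  hact :> H -> R -> R;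
  hactDl : forall g h x, hact (g + h) x = hact g x + hact h x;
  hactDr : forall h x y, hact h (x + y) = hact h x + hact h y;
  hactZl : forall c h x, hact (c *: h) x = i c * hact h x;
  hactZr : forall c h x, hact h (i c * x) = i c * hact h x;
  hact1 : forall x, hact 1 x = x;
  hactM : forall g h x, hact (g * h) x = hact g (hact h x);
  hact_mul : forall h x y,
    hact h (x * y) = tlift (fun a b => hact a x * hact b y) (hcomul h);
  hact_unit : forall h, hact h 1 = i (hcounit h) }.

Definition smash (k : fieldType) (R : comNzRingType) (i : {rmorphism k -> R})
    (H : hopfAlgebra k) of moduleAlgebra i H : Type := tens (rmod i) H.

Section Smash.
Variables (k : fieldType) (R : comNzRingType) (i : {rmorphism k -> R}).
Variables (H : hopfAlgebra k) (X : moduleAlgebra i H).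

Local Notation smash := (smash X).
HB.instance Definition _ := GRing.Zmodule.on smash.

Definition smash_elt (x : R) (h : H) : smash := tprod (x : rmod i) h.

(* (x # h) (y # g) = \sum x (h_1 . y) # h_2 g *)
Definition smash_mul (u v : smash) : smash :=
  tlift (fun (x : rmod i) h => tlift (fun (y : rmod i) g =>
    tlift (fun h1 h2 => smash_elt (x * X h1 y) (h2 * g)) (hcomul h)) v) u.

Let Z1 (c : k) (x : rmod i) : c *: x = i c * x :> R. Proof. by []. Qed.

Lemma smash_eltZ c x h : smash_elt x (c *: h) = smash_elt (i c * x) h.
Proof. by rewrite /smash_elt tprodZr -tprodZl. Qed.

Let bal1 (x y : R) (g : H) :
  balanced (fun h1 h2 : H => smash_elt (x * X h1 y) (h2 * g)).
Proof.
split=> [a a' b|a b b'|c a b]; rewrite /smash_elt.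
- by rewrite hactDl mulrDr; apply: tprodDl.
- by rewrite mulrDl tprodDr.
- by rewrite hactZl mulrCA -Z1 tprodZl -scalerAl tprodZr.
Qed.

Let bal2 (x : R) (h : H) :
  balanced (fun (y : rmod i) g =>
    tlift (fun h1 h2 => smash_elt (x * X h1 y) (h2 * g)) (hcomul h)).
Proof.
split=> [y y' g|y g g'|c y g].
- rewrite -tliftDf; apply: eq_tlift => a b.
  by rewrite hactDr mulrDr; apply: tprodDl.
- by rewrite -tliftDf; apply: eq_tlift => a b; rewrite mulrDr; apply: tprodDr.
- apply: eq_tlift => a b.
  by rewrite Z1 hactZr mulrCA -Z1 /smash_elt tprodZl -scalerAr tprodZr.
Qed.


Let bal3 (v : smash) : balanced (fun (x : rmod i) (h : H) =>
  tlift (fun (y : rmod i) g =>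
    tlift (fun h1 h2 => smash_elt (x * X h1 y) (h2 * g)) (hcomul h)) v).
Proof.
split=> [a a' b|a b b'|c a b].
- rewrite -tliftDf; apply: eq_tlift => y' g'.
  rewrite -tliftDf; apply: eq_tlift => h1 h2.
  by rewrite mulrDl; apply: tprodDl.
- rewrite -tliftDf; apply: eq_tlift => y' g'.
  by rewrite linearD tlift_add.
- apply: eq_tlift => y' g'.
  rewrite linearZ /= tliftZ //; last first.
    by move=> m n; rewrite hactZl mulrCA -Z1; apply: tprodZl.
  move: (hcomul b) => z; have [s ->] := tensP z.
  rewrite !tlift_tsum // scaler_sumr; apply: eq_bigr => p _.
  by rewrite Z1 -mulrA -Z1; apply: tprodZl.
Qed.

Lemma smash_mulE x h y g : smash_mul (smash_elt x h) (smash_elt y g) =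
  tlift (fun h1 h2 => smash_elt (x * X h1 y) (h2 * g)) (hcomul h).
Proof. by rewrite /smash_mul tliftE // tliftE. Qed.

Lemma smash_mulDl : left_distributive smash_mul +%R.
Proof. by move=> u v w; rewrite /smash_mul tlift_add. Qed.
Lemma smash_mulDr : right_distributive smash_mul +%R.
Proof.
move=> u v w; rewrite /smash_mul -tliftDf; apply: eq_tlift => x h.
by rewrite tlift_add.
Qed.

Lemma smash_ext (F G : smash -> smash) :
  {morph F : u v / u + v} -> {morph G : u v / u + v} ->
  (forall x h, F (smash_elt x h) = G (smash_elt x h)) -> F =1 G.
Proof. by move=> FD GD e; apply: tens_ext. Qed.

Definition smash_one : smash := smash_elt 1 1.

Lemma smash_mul1 : left_id smash_one smash_mul.
Proof.
apply: smash_ext => [u v|//|y g]; first by rewrite smash_mulDr.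
rewrite smash_mulE hcomul1 tliftE //.
by rewrite hact1 !mul1r.
Qed.

Lemma smash_mulr1 : right_id smash_one smash_mul.
Proof.
apply: smash_ext => [u v|//|x h]; first by rewrite smash_mulDl.
rewrite smash_mulE -[in RHS](hcounitP h).1.
have [s ->] := tensP (hcomul h); rewrite !tlift_tsum //; last first.
  split=> [a a' b|a b b'|c a b].
  - by rewrite linearD scalerDl.
  - by rewrite scalerDr.
  - by rewrite linearZ /= scalerA mulrC -scalerA.
rewrite /smash_elt tprod_sumr; apply: eq_bigr => p _.
rewrite mulr1 hact_unit mulrC; change (x * i (hcounit p.1)) with (x * i (hcounit p.1)).
by rewrite -Z1 tprodZl -tprodZr.
Qed.

Lemma smash_mulA : associative smash_mul.
Proof.
move=> u v w; move: u.
apply: smash_ext => [u u'|u u'|x h]; rewrite ?smash_mulDl //.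
move: v; apply: smash_ext => [v v'|v v'|y g].
  by rewrite smash_mulDl smash_mulDr.
  by rewrite smash_mulDr smash_mulDl.
move: w; apply: smash_ext => [w w'|w w'|z f].
  by rewrite !smash_mulDr.
  by rewrite smash_mulDr.
rewrite !smash_mulE.
have [sg eg] := tensP (hcomul g).
pose F r (a b c : H) := smash_elt (x * (X a y * X (b * r.1) z)) (c * (r.2 * f)).
have FB r a : balanced (F r a).
  split=> [b b' c|b c c'|t b c]; rewrite /F.
  - by rewrite mulrDl hactDl !mulrDr; apply: tprodDl.
  - by rewrite mulrDl /smash_elt tprodDr.
  - rewrite -!scalerAl hactZl smash_eltZ; congr smash_elt.
    by rewrite (mulrCA (X a y)) (mulrCA x).
have FB' r c : balanced (fun a b => F r a b c).
  split=> [a a' b|a b b'|t a b]; rewrite /F /smash_elt.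
  - by rewrite hactDl mulrDl mulrDr; apply: tprodDl.
  - by rewrite mulrDl hactDl !mulrDr; apply: tprodDl.
  - rewrite -scalerAl !hactZl; congr (smash_elt (x * _) _).
    by rewrite (mulrCA (X a y)) mulrA.
transitivity (\sum_(r <- sg)
    tlift (fun a b => tlift (fun a1 a2 => F r a1 a2 b) (hcomul a)) (hcomul h)).
  rewrite eg tlift_tsum //.
  rewrite (big_morph (smash_mul (smash_elt x h)) (id1 := 0) (op1 := +%R)); last 2 first.
  - exact: smash_mulDr.
  - by apply: (addrI (smash_mul (smash_elt x h) 0)); rewrite -smash_mulDr !addr0.
  apply: eq_bigr => r _; rewrite smash_mulE; apply: eq_tlift => a b.
  rewrite hact_mul; have [s ->] := tensP (hcomul a).
  rewrite !tlift_tsum //; last first.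
    split=> [c c' d|c d d'|t c d].
    - by rewrite hactDl mulrDl.
    - by rewrite hactDl mulrDr.
    - by rewrite !hactZl mulrCA mulrA.
  rewrite mulr_sumr /smash_elt tprod_suml; apply: eq_bigr => p _.
  by rewrite /F hactM.
have [sh eh] := tensP (hcomul h).
rewrite [in RHS]eh tlift_tsum //.
rewrite (big_morph (smash_mul^~ (smash_elt z f)) (id1 := 0) (op1 := +%R)); last 2 first.
- by move=> a b; rewrite smash_mulDl.
- by apply: (addrI (smash_mul 0 (smash_elt z f))); rewrite -smash_mulDl !addr0.
transitivity (\sum_(p <- sh) \sum_(r <- sg) tlift (F r p.1) (hcomul p.2)); last first.
  apply: eq_bigr => p _; rewrite smash_mulE.
  have [s es] := tensP (hcomul p.2).
  rewrite (hcomulM es eg) es tlift_tsum // [RHS]big_allpairs_dep /=.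
  rewrite [RHS]exchange_big /=; apply: eq_bigr => r _ /=.
  rewrite tlift_tsum //; apply: eq_bigr => r' _ /=.
  by rewrite /F !mulrA.
rewrite [RHS]exchange_big /=; apply: eq_bigr => r _.
rewrite -(coassoc_lift (@hcomulA _ H)) // eh tlift_tsum //.
split=> [a a' b|a b b'|t a b].
- by rewrite -tliftDf; apply: eq_tlift => c d; have [-> _ _] := FB' r d.
- by rewrite linearD tlift_add.
- have [s e] := tensP (hcomul b); rewrite linearZ /= e /tsum scaler_sumr.
  rewrite !(big_morph _ (tlift_add (FB _ _)) (tlift0 (FB _ _))).
  apply: eq_bigr => p _; rewrite -tprodZl !tliftE //.
  by have [_ _ ->] := FB' r p.2.
Qed.

HB.instance Definition _ := GRing.Zmodule_isPzRing.Build smash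
  smash_mulA smash_mul1 smash_mulr1 smash_mulDl smash_mulDr.

Definition smash_incl (x : R) : smash := smash_elt x 1.
Lemma smash_incl_zmod : zmod_morphism smash_incl.
Proof.
by move=> x y; rewrite /smash_incl /smash_elt -tprodNl; apply: tprodDl.
Qed.
Lemma smash_incl_monoid : monoid_morphism smash_incl.
Proof.
split=> // x y; rewrite [RHS]smash_mulE hcomul1 tliftE //.
by rewrite hact1 mulr1.
Qed.
HB.instance Definition _ :=
  GRing.isZmodMorphism.Build R smash smash_incl smash_incl_zmod.
HB.instance Definition _ :=
  GRing.isMonoidMorphism.Build R smash smash_incl smash_incl_monoid.

(* The coalgebra H, base extended along k -> R: x # h is sent to
   \sum (x # h_1) (x)_R (1 # h_2), where R acts on the left of R # H. *)
Definition smash_comul (u : smash) : tens (rmod smash_incl) (rmod smash_incl) :=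
  tlift (fun (x : rmod i) h => tlift (fun h1 h2 =>
    rtprod smash_incl (smash_elt x h1) (smash_elt 1 h2)) (hcomul h)) u.

Definition smash_counit (u : smash) : R :=
  tlift (fun (x : rmod i) h => x * i (hcounit h) : R) u.

Let inclM x y h : x *: (smash_elt y h : rmod smash_incl) = smash_elt (x * y) h.
Proof. by rewrite restrZ [LHS]smash_mulE hcomul1 tliftE // hact1 mul1r. Qed.

Lemma smash_comulE x h : smash_comul (smash_elt x h) =
  tlift (fun h1 h2 =>
    rtprod smash_incl (smash_elt x h1) (smash_elt 1 h2)) (hcomul h).
Proof.
have b1 y : balanced (fun h1 h2 =>
    rtprod smash_incl (smash_elt y h1) (smash_elt 1 h2)).
  split=> [a a' b|a b b'|c a b].
  - by rewrite [smash_elt _ _](tprodDr (y : rmod i)) tprodDl.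
  - by rewrite [smash_elt _ (b + _)](tprodDr (1 : rmod i)) tprodDr.
  - by rewrite !smash_eltZ -!inclM tprodZl tprodZr.
rewrite /smash_comul tliftE //; split=> [y y' g|y g g'|c y g].
- rewrite -tliftDf; apply: eq_tlift => h1 h2; rewrite -tprodDl.
  by congr tprod; apply: (tprodDl (y : rmod i)).
- by rewrite linearD tlift_add.
- have [s e] := tensP (hcomul g); rewrite linearZ /= e.
  rewrite {2}/tsum scaler_sumr (big_morph _ (tlift_add (b1 y)) (tlift0 (b1 y))).
  rewrite tlift_tsum //; apply: eq_bigr => p _.
  rewrite -tprodZl tliftE //; congr tprod.
  by rewrite smash_eltZ.
Qed.

Lemma smash_counitE x h : smash_counit (smash_elt x h) = x * i (hcounit h).
Proof.
rewrite /smash_counit tliftE //; split=> [y y' g|y g g'|c y g].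
- by rewrite mulrDl.
- by rewrite linearD rmorphD mulrDr.
- by rewrite linearZ /= rmorphM mulrCA mulrA.
Qed.
End Smash.

Section RingQuotient.
Variables (S : pzRingType) (e : S).

(* The two-sided ideal generated by e. *)
Definition in_ideal (x : S) : Prop :=
  exists s : seq (S * S), x = \sum_(p <- s) p.1 * e * p.2.

Definition ideal_rel (x y : S) : bool := `[< in_ideal (x - y) >].

Lemma in_ideal0 : in_ideal 0.
Proof. by exists [::]; rewrite big_nil. Qed.
Lemma in_idealD x y : in_ideal x -> in_ideal y -> in_ideal (x + y).
Proof. by move=> [s ->] [s' ->]; exists (s ++ s'); rewrite big_cat. Qed.
Lemma in_idealMl u x : in_ideal x -> in_ideal (u * x).
Proof.
move=> [s ->]; exists [seq (u * p.1, p.2) | p <- s].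
by rewrite mulr_sumr big_map; apply: eq_bigr => p _; rewrite /= !mulrA.
Qed.
Lemma in_idealMr u x : in_ideal x -> in_ideal (x * u).
Proof.
move=> [s ->]; exists [seq (p.1, p.2 * u) | p <- s].
by rewrite mulr_suml big_map; apply: eq_bigr => p _; rewrite /= !mulrA.
Qed.
Lemma in_idealN x : in_ideal x -> in_ideal (- x).
Proof. by move=> h; rewrite -mulN1r; apply: in_idealMl. Qed.

Lemma ideal_rel_refl : reflexive ideal_rel.
Proof. by move=> x; apply/asboolP; rewrite subrr; apply: in_ideal0. Qed.
Lemma ideal_rel_sym : symmetric ideal_rel.
Proof.
by move=> x y; apply/asboolP/asboolP => /in_idealN; rewrite opprB.
Qed.
Lemma ideal_rel_trans : transitive ideal_rel.
Proof.
move=> y x z /asboolP h /asboolP h'; apply/asboolP.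
by have := in_idealD h h'; rewrite addrA subrK.
Qed.

Canonical ideal_equiv :=
  EquivRel ideal_rel ideal_rel_refl ideal_rel_sym ideal_rel_trans.

Definition ring_quot : Type := {eq_quot ideal_rel}.
HB.instance Definition _ := Choice.on ring_quot.
HB.instance Definition _ := EqQuotient.on ring_quot.

Definition quot_proj (x : S) : ring_quot := \pi_ring_quot x.

Lemma quot_projP x y : quot_proj x = quot_proj y <-> in_ideal (x - y).
Proof.
split=> [/eqP|h]; first by rewrite piE => /asboolP.
by apply/eqP; rewrite piE; apply/asboolP.
Qed.

Lemma quot_proj_surj a : exists x, a = quot_proj x.
Proof. by exists (repr a); rewrite /quot_proj reprK. Qed.

Let repr_ideal x : in_ideal (repr (quot_proj x) - x).
Proof. by apply/quot_projP; rewrite /quot_proj reprK. Qed.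

Definition quot_add (a b : ring_quot) := quot_proj (repr a + repr b).
Definition quot_opp (a : ring_quot) := quot_proj (- repr a).
Definition quot_mul (a b : ring_quot) := quot_proj (repr a * repr b).

Lemma quot_addE x y : quot_add (quot_proj x) (quot_proj y) = quot_proj (x + y).
Proof. by apply/quot_projP; rewrite opprD addrACA; apply: in_idealD. Qed.
Lemma quot_oppE x : quot_opp (quot_proj x) = quot_proj (- x).
Proof. by apply/quot_projP; rewrite -opprD; apply: in_idealN. Qed.
Lemma quot_mulE x y : quot_mul (quot_proj x) (quot_proj y) = quot_proj (x * y).
Proof.
apply/quot_projP; set x' := repr _; set y' := repr _.
rewrite (_ : _ - _ = (x' - x) * y' + x * (y' - y)); last first.
  by rewrite mulrBl mulrBr addrA subrK.
by apply: in_idealD; [apply: in_idealMr|apply: in_idealMl]; apply: repr_ideal.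
Qed.

Lemma quot_addA : associative quot_add.
Proof.
move=> a b c; have [x ->] := quot_proj_surj a; have [y ->] := quot_proj_surj b; have [z ->] := quot_proj_surj c.
by rewrite !quot_addE addrA.
Qed.
Lemma quot_addC : commutative quot_add.
Proof. by move=> a b; have [x ->] := quot_proj_surj a; have [y ->] := quot_proj_surj b; rewrite !quot_addE addrC. Qed.
Lemma quot_add0 : left_id (quot_proj 0) quot_add.
Proof. by move=> a; have [x ->] := quot_proj_surj a; rewrite quot_addE add0r. Qed.
Lemma quot_addN : left_inverse (quot_proj 0) quot_opp quot_add.
Proof. by move=> a; have [x ->] := quot_proj_surj a; rewrite quot_oppE quot_addE addNr. Qed.

HB.instance Definition _ :=
  GRing.isZmodule.Build ring_quot quot_addA quot_addC quot_add0 quot_addN.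

Lemma quot_mulA : associative quot_mul.
Proof.
move=> a b c; have [x ->] := quot_proj_surj a; have [y ->] := quot_proj_surj b; have [z ->] := quot_proj_surj c.
by rewrite !quot_mulE mulrA.
Qed.
Lemma quot_mul1 : left_id (quot_proj 1) quot_mul.
Proof. by move=> a; have [x ->] := quot_proj_surj a; rewrite quot_mulE mul1r. Qed.
Lemma quot_mulr1 : right_id (quot_proj 1) quot_mul.
Proof. by move=> a; have [x ->] := quot_proj_surj a; rewrite quot_mulE mulr1. Qed.
Lemma quot_mulDl : left_distributive quot_mul quot_add.
Proof.
move=> a b c; have [x ->] := quot_proj_surj a; have [y ->] := quot_proj_surj b; have [z ->] := quot_proj_surj c.
by rewrite !(quot_addE, quot_mulE) mulrDl.
Qed.
Lemma quot_mulDr : right_distributive quot_mul quot_add.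
Proof.
move=> a b c; have [x ->] := quot_proj_surj a; have [y ->] := quot_proj_surj b; have [z ->] := quot_proj_surj c.
by rewrite !(quot_addE, quot_mulE) mulrDr.
Qed.

HB.instance Definition _ := GRing.Zmodule_isPzRing.Build ring_quot
  quot_mulA quot_mul1 quot_mulr1 quot_mulDl quot_mulDr.

Lemma quot_proj_zmod : zmod_morphism quot_proj.
Proof.
by move=> x y; rewrite -[RHS]/(quot_add _ (quot_opp _)) quot_oppE quot_addE.
Qed.
Lemma quot_proj_monoid : monoid_morphism quot_proj.
Proof. by split=> // x y; rewrite -[RHS]/(quot_mul _ _) quot_mulE. Qed.
HB.instance Definition _ :=
  GRing.isZmodMorphism.Build S ring_quot quot_proj quot_proj_zmod.
HB.instance Definition _ :=
  GRing.isMonoidMorphism.Build S ring_quot quot_proj quot_proj_monoid.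
End RingQuotient.

Section ModuleNotions.
Variables (R : pzRingType) (M : lmodType R).

Definition projective : Prop :=
  forall (X Y : lmodType R) (g : {linear X -> Y}) (f : {linear M -> Y}),
    (forall y, exists x, g x = y) ->
  exists h : {linear M -> X}, forall m, g (h m) = f m.

Definition finitely_generated : Prop :=
  exists n (v : 'I_n -> M), forall m, exists c : 'I_n -> R,
    m = \sum_(j < n) c j *: v j.
End ModuleNotions.

(* z belongs to A x_R A.  For each x, both sides depend on z only, not on the
   decomposition s. *)
Definition takeuchi (R : comPzRingType) (A : pzRingType)
    (i : {rmorphism R -> A}) (z : tens (rmod i) (rmod i)) : Prop :=
  forall s : seq (A * A), z = tsum (s : seq (rmod i * rmod i)) ->
  forall x : R, tsum ([seq (p.1 * i x, p.2) | p <- s] : seq (rmod i * rmod i)) =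
                tsum ([seq (p.1, p.2 * i x) | p <- s] : seq (rmod i * rmod i)).

(* k is the base ring: [xb_alg] says that A is a k-algebra through k -> R -> A.
   As A (x)_R A has no product in general, [xb_comulM] computes the
   componentwise product of A x_R A on arbitrary decompositions. *)
Record xR_bialgebra (k : pzRingType) (R : comPzRingType) (A : pzRingType)
    (j : {rmorphism k -> R}) (i : {rmorphism R -> A})
    (D : {linear rmod i -> tens (rmod i) (rmod i)})
    (e : {linear rmod i -> GRing.regular R}) : Prop := XRBialgebra {
  xb_alg : forall c a, i (j c) * a = a * i (j c);
  xb_projective : projective (rmod i);
  xb_coassoc : coassociative D;
  xb_counital : counital D e;
  xb_takeuchi : forall a, takeuchi (D a);
  xb_comul1 : D 1 = rtprod i 1 1;
  xb_comulM : forall (a b : A) s s', D a = tsum s -> D b = tsum s' ->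
    D (a * b) = tsum (cwprod s s' : seq (rmod i * rmod i));
  xb_counit1 : e 1 = 1;
  xb_counitM : forall a b : A, e (a * b) = e (a * i (e b)) }.

Section TensorOfModules.
Variables (k : pzRingType) (R : comPzRingType) (A : pzRingType).
Variables (j : {rmorphism k -> R}) (i : {rmorphism R -> A}).
Variables (D : {linear rmod i -> tens (rmod i) (rmod i)}).
Variables (e : {linear rmod i -> GRing.regular R}).
Variable B : xR_bialgebra j D e.

(* The tensor product of left A-modules, whose A-module structure
   ([modtens_act]) exists only because A is a x_R-bialgebra. *)
Definition modtens of xR_bialgebra j D e := fun M N : lmodType A =>
  tens (restr i M) (restr i N).

Definition modunit of xR_bialgebra j D e : Type := R.

Section Action.
Variables M N : lmodType A.
HB.instance Definition _ := GRing.Zmodule.on (modtens B M N).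

Definition modtens_elt (m : M) (n : N) : modtens B M N :=
  tprod (m : restr i M) (n : restr i N).

Definition modtens_act (a : A) (z : modtens B M N) : modtens B M N :=
  tlift (fun (m : restr i M) (n : restr i N) =>
    tlift (fun a1 a2 : rmod i =>
      modtens_elt ((a1 : A) *: (m : M)) ((a2 : A) *: (n : N))) (D a)) z.

Let bal1 m n : balanced (fun a1 a2 : rmod i =>
  modtens_elt ((a1 : A) *: (m : M)) ((a2 : A) *: (n : N))).
Proof.
split=> [a a' b|a b b'|r a b].
- by rewrite scalerDl; apply: tprodDl.
- by rewrite scalerDl; apply: tprodDr.
- rewrite !restrZ /modtens_elt -!scalerA.
  pose am : restr i M := (a : A) *: m; pose bn : restr i N := (b : A) *: n.
  exact: etrans (tprodZl r am bn) (esym (tprodZr r am bn)).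
Qed.

Let bal2 a : balanced (fun (m : restr i M) (n : restr i N) =>
    tlift (fun a1 a2 : rmod i =>
      modtens_elt ((a1 : A) *: (m : M)) ((a2 : A) *: (n : N))) (D a)).
Proof.
split=> [m m' n|m n n'|r m n].
- rewrite -tliftDf; apply: eq_tlift => a1 a2.
  by rewrite scalerDr; apply: tprodDl.
- rewrite -tliftDf; apply: eq_tlift => a1 a2.
  by rewrite scalerDr; apply: tprodDr.
- have [s es] := tensP (D a).
  have := xb_takeuchi B es r.
  move/(congr1 (tlift (fun a1 a2 : rmod i =>
      modtens_elt ((a1 : A) *: (m : M)) ((a2 : A) *: (n : N))))).
  rewrite es !tlift_tsum // !big_map /= => h.
  rewrite (eq_bigr _ (fun p _ => congr1 (modtens_elt^~ _) (scalerA _ _ _))).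
  rewrite h; apply: eq_bigr => p _.
  by rewrite restrZ scalerA.
Qed.

Lemma modtens_actE a m n : modtens_act a (modtens_elt m n) =
  tlift (fun a1 a2 : rmod i =>
    modtens_elt ((a1 : A) *: (m : M)) ((a2 : A) *: (n : N))) (D a).
Proof. by rewrite /modtens_act tliftE. Qed.

Let actD a : {morph modtens_act a : u v / u + v} := tlift_add (bal2 a).
Let act0 a : modtens_act a 0 = 0 := tlift0 (bal2 a).

Lemma modtens_actA a b z : modtens_act a (modtens_act b z) = modtens_act (a * b) z.
Proof.
move: z; apply: tens_ext => [u v|u v|m n]; rewrite ?actD //.
rewrite -/(modtens_elt m n) !modtens_actE.
have [s es] := tensP (D a); have [s' es'] := tensP (D b).
rewrite (xb_comulM B es es') es' !tlift_tsum //.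
rewrite (big_morph _ (actD a) (act0 a)) big_allpairs_dep exchange_big /=.
apply: eq_bigr => p _; rewrite modtens_actE es tlift_tsum //.
by apply: eq_bigr => p' _; rewrite !scalerA.
Qed.
Lemma modtens_act1 : left_id 1 modtens_act.
Proof.
apply: tens_ext => [u v|u v|m n]; rewrite ?actD //.
by rewrite -/(modtens_elt m n) modtens_actE (xb_comul1 B) tliftE // !scale1r.
Qed.
Lemma modtens_actDr : right_distributive modtens_act +%R.
Proof. exact: actD. Qed.
Lemma modtens_actDl z : {morph modtens_act^~ z : a b / a + b}.
Proof.
move=> a b; rewrite /modtens_act -tliftDf; apply: eq_tlift => m n.
by rewrite linearD tlift_add.
Qed.

HB.instance Definition _ := GRing.Zmodule_isLmodule.Build A (modtens B M N)
  modtens_actA modtens_act1 modtens_actDr modtens_actDl.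
End Action.

HB.instance Definition _ := GRing.Zmodule.on (modunit B).

Definition modunit_act (a : A) (x : modunit B) : modunit B := e (a * i (x : R)).

Lemma modunit_actA a b x : modunit_act a (modunit_act b x) = modunit_act (a * b) x.
Proof. by rewrite /modunit_act -(xb_counitM B) mulrA. Qed.
Lemma modunit_act1 : left_id 1 modunit_act.
Proof.
move=> x; rewrite /modunit_act mul1r -[i _]mulr1.
rewrite -[X in e X]/(x *: (1 : rmod i)) linearZ /=.
by rewrite (xb_counit1 B) [LHS]mulr1.
Qed.
Lemma modunit_actDr : right_distributive modunit_act +%R.
Proof. by move=> a x y; rewrite /modunit_act rmorphD mulrDr linearD. Qed.
Lemma modunit_actDl x : {morph modunit_act^~ x : a b / a + b}.
Proof. by move=> a b; rewrite /modunit_act mulrDl linearD. Qed.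
HB.instance Definition _ := GRing.Zmodule_isLmodule.Build A (modunit B)
  modunit_actA modunit_act1 modunit_actDr modunit_actDl.
End TensorOfModules.

Record category := Category {
  ob :> Type;
  hom : ob -> ob -> Type;
  idm : forall X, hom X X;
  comp : forall X Y Z, hom Y Z -> hom X Y -> hom X Z;
  comp_idl : forall X Y (f : hom X Y), comp (idm Y) f = f;
  comp_idr : forall X Y (f : hom X Y), comp f (idm X) = f;
  compA : forall X Y Z W (h : hom Z W) (g : hom Y Z) (f : hom X Y),
    comp h (comp g f) = comp (comp h g) f }.

Notation "g \oc f" := (comp g f) (at level 50, left associativity).

(* Tensor product of morphisms, associativity and unit constraints with their
   inverses, and symmetry, for a tensor product T of objects and a unit I. *)
Record tensor_data (C : category) (T : C -> C -> C) (I : C) := TensorData {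
  tmor : forall X X' Y Y', hom X X' -> hom Y Y' -> hom (T X Y) (T X' Y');
  assoc : forall X Y Z, hom (T (T X Y) Z) (T X (T Y Z));
  assocV : forall X Y Z, hom (T X (T Y Z)) (T (T X Y) Z);
  lunit : forall X, hom (T I X) X;
  lunitV : forall X, hom X (T I X);
  runit : forall X, hom (T X I) X;
  runitV : forall X, hom X (T X I);
  braid : forall X Y, hom (T X Y) (T Y X) }.

Record symmetric_tensor_category (C : category) (T : C -> C -> C) (I : C)
    (S : tensor_data T I) : Prop := SymmetricTensorCategory {
  tmor_id : forall X Y, tmor S (idm X) (idm Y) = idm (T X Y);
  tmor_comp : forall X X' X'' Y Y' Y'' (f' : hom X' X'') (f : hom X X')
      (g' : hom Y' Y'') (g : hom Y Y'),
    tmor S (f' \oc f) (g' \oc g) = tmor S f' g' \oc tmor S f g;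
  assoc_nat : forall X X' Y Y' Z Z' (f : hom X X') (g : hom Y Y') (h : hom Z Z'),
    assoc S X' Y' Z' \oc tmor S (tmor S f g) h
    = tmor S f (tmor S g h) \oc assoc S X Y Z;
  lunit_nat : forall X X' (f : hom X X'),
    lunit S X' \oc tmor S (idm I) f = f \oc lunit S X;
  runit_nat : forall X X' (f : hom X X'),
    runit S X' \oc tmor S f (idm I) = f \oc runit S X;
  braid_nat : forall X X' Y Y' (f : hom X X') (g : hom Y Y'),
    braid S X' Y' \oc tmor S f g = tmor S g f \oc braid S X Y;
  assocK : forall X Y Z, assocV S X Y Z \oc assoc S X Y Z = idm _;
  assocVK : forall X Y Z, assoc S X Y Z \oc assocV S X Y Z = idm _;
  lunitK : forall X, lunitV S X \oc lunit S X = idm _;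
  lunitVK : forall X, lunit S X \oc lunitV S X = idm _;
  runitK : forall X, runitV S X \oc runit S X = idm _;
  runitVK : forall X, runit S X \oc runitV S X = idm _;
  braidK : forall X Y, braid S Y X \oc braid S X Y = idm _;
  pentagon : forall X Y Z W,
    assoc S X Y (T Z W) \oc assoc S (T X Y) Z W
    = tmor S (idm X) (assoc S Y Z W) \oc assoc S X (T Y Z) W
      \oc tmor S (assoc S X Y Z) (idm W);
  triangle : forall X Y,
    tmor S (idm X) (lunit S Y) \oc assoc S X I Y = tmor S (runit S X) (idm Y);
  hexagon : forall X Y Z,
    assoc S Y Z X \oc braid S X (T Y Z) \oc assoc S X Y Z
    = tmor S (idm Y) (braid S X Z) \oc assoc S Y X Z
      \oc tmor S (braid S X Y) (idm Z) }.

Definition has_dual (C : category) (T : C -> C -> C) (I : C)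
    (S : tensor_data T I) (X : C) : Prop :=
  exists (Y : C) (ev : hom (T Y X) I) (coev : hom I (T X Y)),
    runit S X \oc tmor S (idm X) ev \oc assoc S X Y X
      \oc tmor S coev (idm X) \oc lunitV S X = idm X /\
    lunit S Y \oc tmor S ev (idm Y) \oc assocV S Y X Y
      \oc tmor S (idm Y) coev \oc runitV S Y = idm Y.

Lemma linear_eq (A : pzRingType) (M N : lmodType A) (f g : {linear M -> N}) :
  f =1 g -> f = g.
Proof.
move: f g => [f cf] [g cg] /= /funext fg; case: g / fg cg => cg.
congr GRing.Linear.Pack.
case: cf => fa [fb]; case: cg => ga [gb]; case: fa => fa; case: ga => ga.
by rewrite (Prop_irrelevance fa ga) (Prop_irrelevance fb gb).
Qed.

Definition linear_comp (A : pzRingType) (M N P : lmodType A)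
    (g : {linear N -> P}) (f : {linear M -> N}) : {linear M -> P} :=
  ssrfun.comp g f.
Definition linear_id (A : pzRingType) (M : lmodType A) : {linear M -> M} := idfun.

Section ModuleCategory.
Variable A : pzRingType.
Lemma linear_comp_idl (M N : lmodType A) (f : {linear M -> N}) :
  linear_comp (linear_id N) f = f.
Proof. exact: linear_eq. Qed.
Lemma linear_comp_idr (M N : lmodType A) (f : {linear M -> N}) :
  linear_comp f (linear_id M) = f.
Proof. exact: linear_eq. Qed.
Lemma linear_compA (M N P Q : lmodType A) (h : {linear P -> Q})
    (g : {linear N -> P}) (f : {linear M -> N}) :
  linear_comp h (linear_comp g f) = linear_comp (linear_comp h g) f.
Proof. exact: linear_eq. Qed.

Definition modcat : category := @Category (lmodType A)
  (fun M N => {linear M -> N}) (@linear_id A) (@linear_comp A)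
  linear_comp_idl linear_comp_idr linear_compA.
End ModuleCategory.

(* The obvious constraints.  Each of these maps is determined by its values on
   pure tensors. *)
Record canonical_tensor_data (k : pzRingType) (R : comPzRingType)
    (A : pzRingType) (j : {rmorphism k -> R}) (i : {rmorphism R -> A})
    (D : {linear rmod i -> tens (rmod i) (rmod i)})
    (e : {linear rmod i -> GRing.regular R}) (B : xR_bialgebra j D e)
    (T : @tensor_data (modcat A) (modtens B) (modunit B)) : Prop :=
  CanonicalTensorData {
  ct_tmor : forall (M M' N N' : lmodType A)
      (f : {linear M -> M'}) (g : {linear N -> N'}) m n,
    (@tmor (modcat A) _ _ T M M' N N' f g
       : {linear modtens B M N -> modtens B M' N'}) (modtens_elt B m n)
    = modtens_elt B (f m) (g n);
  ct_assoc : forall (M N P : lmodType A) (m : M) (n : N) (p : P),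
    (assoc T M N P : {linear modtens B (modtens B M N) P ->
                             modtens B M (modtens B N P)})
      (modtens_elt B (modtens_elt B m n) p)
    = modtens_elt B m (modtens_elt B n p);
  ct_lunit : forall (M : lmodType A) (x : R) (m : M),
    (lunit T M : {linear modtens B (modunit B) M -> M})
      (modtens_elt B (x : modunit B) m) = i x *: m;
  ct_runit : forall (M : lmodType A) (x : R) (m : M),
    (runit T M : {linear modtens B M (modunit B) -> M})
      (modtens_elt B m (x : modunit B)) = i x *: m;
  ct_braid : forall (M N : lmodType A) (m : M) (n : N),
    (braid T M N : {linear modtens B M N -> modtens B N M})
      (modtens_elt B m n) = modtens_elt B n m }.

Section BaseField.
Variables (C : fieldType) (q : C).

(* The intersection of all subfields of C containing q, that is, k_0(q) for the
   prime field k_0 of C. *)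
Definition in_kq : {pred C} := fun x =>
  `[< forall P : {pred C}, divring_closed P -> q \in P -> x \in P >].

Lemma in_kq_divring : divring_closed in_kq.
Proof.
split=> [|x y /asboolP hx /asboolP hy|x y /asboolP hx /asboolP hy];
  apply/asboolP => P PC qP; case: (PC) => [P1 PB PD] //.
- by apply: PB; [apply: hx | apply: hy].
- by apply: PD; [apply: hx | apply: hy].
Qed.
HB.instance Definition _ := GRing.isDivringClosed.Build C in_kq in_kq_divring.

Record kq : Type := Kq { kq_val : C; kq_valP : kq_val \in in_kq }.
HB.instance Definition _ := [isSub for kq_val].
HB.instance Definition _ := [Choice of kq by <:].
HB.instance Definition _ := [SubChoice_isSubIntegralDomain of kq by <:].
HB.instance Definition _ := [SubIntegralDomain_isSubField of kq by <:].

Lemma kq_gen_subproof : q \in in_kq.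
Proof. by apply/asboolP. Qed.
Definition kq_gen : kq := Kq kq_gen_subproof.
Variables (R : comNzRingType) (iota : {rmorphism {fraction {poly C}} -> R}).

Definition kq_incl : {rmorphism kq -> R} :=
  iota \o (@tofrac {poly C}) \o polyC \o (val : kq -> C).
End BaseField.

(* The Gaussian binomial polynomial, evaluated at q, by its Pascal recursion. *)
Fixpoint qbinom (F : pzRingType) (q : F) (n r : nat) : F :=
  match n, r with
  | _, 0 => 1
  | 0, _.+1 => 0
  | n'.+1, r'.+1 => qbinom q n' r' + q ^+ r'.+1 * qbinom q n' r'.+1
  end.

Section QDifference.
Variables (C : fieldType) (q : C) (R : comNzRingType).
Variables (iota : {rmorphism {fraction {poly C}} -> R}).

(* sq (f(t)) = f(qt) for f in C(t). *)
Definition extends_dilation (sq : R -> R) : Prop :=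
  forall f g : {poly C}, g != 0 ->
    sq (iota (tofrac f / tofrac g)) =
    iota (tofrac (f \Po (q *: 'X)) / tofrac (g \Po (q *: 'X))).

Definition qdiff_coef : R := iota ((tofrac ((q - 1) *: 'X))^-1).

Record iterative_qdiff (sq : R -> R) (dR : nat -> R -> R) : Prop :=
  IterativeQdiff {
  iq_0 : forall x, dR 0%N x = x;
  iq_1 : forall x, dR 1%N x = qdiff_coef * (sq x - x);
  iq_add : forall n x y, dR n (x + y) = dR n x + dR n y;
  iq_mul : forall n x y, dR n (x * y) =
    \sum_(l < n.+1) iter l sq (dR (n - l)%N x) * dR l y;
  iq_comp : forall l m x, dR l (dR m x) =
    kq_incl q iota (qbinom (kq_gen q) (l + m) l) * dR (l + m)%N x }.
End QDifference.

(* [qh_span] and [qh_free]: the elements s ^+ a * d b, for 0 <= a < N and b in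
   nat, form a k-basis of H, i.e. s generates a copy of the group algebra of the
   cyclic group of order N, over which H is free on the left with basis d. *)
Record qdiff_hopf (k : fieldType) (q : k) (N : nat) (H : hopfAlgebra k)
    (s : H) (d : nat -> H) : Prop := QdiffHopf {
  qh_order : s ^+ N = 1;
  qh_span : forall h, exists n (c : 'I_N -> 'I_n -> k),
    h = \sum_(a < N) \sum_(b < n) c a b *: (s ^+ a * d b);
  qh_free : forall n (c : 'I_N -> 'I_n -> k),
    \sum_(a < N) \sum_(b < n) c a b *: (s ^+ a * d b) = 0 ->
    forall a b, c a b = 0;
  qh_d0 : d 0%N = 1;
  qh_dd : forall l m, d l * d m = qbinom q (l + m) l *: d (l + m)%N;
  qh_ds : forall l, d l * s = q ^+ l *: (s * d l);
  qh_comul_s : hcomul s = tprod s s;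
  qh_counit_s : hcounit s = 1;
  qh_comul_d : forall n, hcomul (d n) =
    \sum_(l < n.+1) tprod (s ^+ l * d (n - l)%N) (d l);
  qh_counit_d : forall n, hcounit (d n) = (n == 0%N)%:R }.

Section CalH.
Variables (k : fieldType) (R : comNzRingType) (j : {rmorphism k -> R}).
Variables (H : hopfAlgebra k) (X : moduleAlgebra j H).
Variables (c : R) (s d1 : H).

(* R # H modulo the ideal generated by d1 - c (s - 1). *)
Definition calH : pzRingType :=
  ring_quot (smash_elt X 1 d1 - smash_incl X c * (smash_elt X 1 s - 1)).

Definition calH_proj : {rmorphism smash X -> calH} := quot_proj _.

Definition calH_incl : {rmorphism R -> calH} := calH_proj \o smash_incl X.

(* D and e are the coalgebra structure induced from R # H on the quotient. *)
Definition calH_induced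
    (D : {linear rmod calH_incl -> tens (rmod calH_incl) (rmod calH_incl)})
    (e : {linear rmod calH_incl -> GRing.regular R}) : Prop :=
  forall u : smash X,
    D (calH_proj u) =
      @tmap R (rmod (smash_incl X)) (rmod (smash_incl X))
        (rmod calH_incl) (rmod calH_incl) calH_proj calH_proj (smash_comul u) /\
    e (calH_proj u) = smash_counit u.
End CalH.

(* Main.v *)
(* Modulo the ideal, d_1 becomes c (s - 1), so that every d_b with b < N falls into
   the span of the powers of s.  The latter act on R by linearly independent
   automorphisms (already on C(t)), hence identities between such elements, and
   between their tensor products, may be checked by their action on R.  Writing
   d_n = d_b d_(mN) with n = b + mN, the cocommutativity of calH thereby reduces to
   the symmetry of d_n (y z) in y and z, that is, to the commutativity of R; and
   cocommutativity puts the coproduct into the Takeuchi product.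

   calH is free over R on the s^a d_(mN), a < N: the coordinates of H modulo
   d_1 and s - 1 induce functionals that separate these elements.

   The dual of a finitely generated projective M is Hom_R(M, R) with the
   contragredient action through the antipode of H. *)

Require Import Defs.
From HB Require Import structures.
From mathcomp Require Import all_boot all_order all_algebra.
From mathcomp Require Import boolp.

Set Implicit Arguments.
Unset Strict Implicit.
Unset Printing Implicit Defensive.
Import GRing.Theory.
Local Open Scope ring_scope.

(** Nothing makes the action of calH on R faithful, since little is assumed about the operators
    d_(mN). Actions can thus be compared only within the span of the powers of s, and the factors
    d_(mN) are kept aside as right multipliers. This is why the coproduct of d_n is cut into pieces
    with both indices below N. The product rule for d_n (y z) mixes all these pieces; an induction
    on n separates them.

    The order of the construction is forced. Left multiplication on A (x)_R A by the coproduct of h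
    is well defined only if that coproduct lies in the Takeuchi product. So cocommutativity is
    proved first, for the map from H to A (x)_R A, before calH has a coproduct. Then H acts on R and
    on A (x)_R A, both actions respect the relation, and the counit and the coproduct of calH are
    the orbit maps of 1 and of 1 (x) 1. Multiplicativity thereby comes from the module axioms.

    calH receives no antipode. An identity between maps of h in H is tested after convolution with
    the action of h on M, where the antipode terms cancel; this convolution is invertible through
    the antipode of H. *)

Lemma morph_add0 (Y Z : zmodType) (F : Y -> Z) : {morph F : u v / u + v} -> F 0 = 0.
Proof. by move=> FD; apply: (addrI (F 0)); rewrite -FD !addr0. Qed.

Lemma morph_addN (Y Z : zmodType) (F : Y -> Z) : {morph F : u v / u + v} ->
  forall u, F (- u) = - F u.
Proof.
by move=> FD u; apply: (addrI (F u)); rewrite -FD !subrr morph_add0.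
Qed.

(** * Modules over the quotient of the smash product *)

(** An additive map that kills all u * e0 * v kills the ideal, so its value at the chosen
    representative does not depend on the choice. Actions and functionals on calH are defined below
    by evaluation at [repr]. *)
Lemma quot_repr (S : pzRingType) (e0 : S) (Z : zmodType) (F : S -> Z) :
  {morph F : u v / u + v} -> (forall u v, F (u * e0 * v) = 0) ->
  forall x, F (repr (quot_proj e0 x)) = F x.
Proof.
move=> FD F0 x; apply/subr0_eq; rewrite -(morph_addN FD) -FD.
have /quot_projP [s ->] : quot_proj e0 (repr (quot_proj e0 x)) = quot_proj e0 x.
  by rewrite /quot_proj reprK.
rewrite (big_morph _ FD (morph_add0 FD)) big1 // => p _; exact: F0.
Qed.

Section Smash.
Variables (k : fieldType) (R : comNzRingType) (j : {rmorphism k -> R}).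
Variables (H : hopfAlgebra k) (X : moduleAlgebra j H) (c : R) (s d1 : H).

Local Notation A := (calH X c s d1).
Local Notation i := (calH_incl X c s d1).

Definition hproj (h : H) : A := calH_proj X c s d1 (smash_elt X 1 h).

Lemma smash_eltDl x y h : smash_elt X (x + y) h = smash_elt X x h + smash_elt X y h.
Proof. exact: tprodDl. Qed.
Lemma smash_eltDr x g h : smash_elt X x (g + h) = smash_elt X x g + smash_elt X x h.
Proof. exact: tprodDr. Qed.

Lemma balX (x y : R) (g : H) :
  balanced (fun h1 h2 : H => smash_elt X (x * X h1 y) (h2 * g)).
Proof.
split=> [a a' b|a b b'|r a b].
- by rewrite hactDl mulrDr smash_eltDl.
- by rewrite mulrDl smash_eltDr.
- by rewrite hactZl mulrCA -smash_eltZ scalerAl.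
Qed.

Lemma smash_eltM1 x y g :
  smash_elt X x 1 * smash_elt X y g = smash_elt X (x * y) g.
Proof.
by rewrite [LHS]smash_mulE hcomul1 (tliftE _ _ (balX _ _ _)) hact1 mul1r.
Qed.

(** H acts on 1 through the counit, so the counit axiom collapses the coproduct of [h]. *)
Lemma smash_eltMr x h g :
  smash_elt X x h * smash_elt X 1 g = smash_elt X x (h * g).
Proof.
rewrite [LHS]smash_mulE -[in RHS](hcounitP h).1.
have [t ->] := tensP (hcomul h); rewrite !tlift_tsum; last 2 first.
- split=> [a a' b|a b b'|r a b].
  + by rewrite linearD scalerDl.
  + by rewrite scalerDr.
  + by rewrite linearZ /= scalerA mulrC -scalerA.
- exact: balX.
rewrite mulr_suml /smash_elt tprod_sumr; apply: eq_bigr => p _.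
rewrite hact_unit -scalerAl; symmetry; apply: etrans (smash_eltZ _ _ _ _) _.
by rewrite mulrC.
Qed.

Lemma smash_sum (u : smash X) :
  exists t : seq (R * H), u = \sum_(p <- t) smash_elt X p.1 p.2.
Proof. by have [t ->] := tensP u; exists t. Qed.

Lemma calH_proj_elt x h : calH_proj X c s d1 (smash_elt X x h) = i x * hproj h.
Proof.
by rewrite -[RHS](rmorphM (calH_proj X c s d1)) smash_eltM1 mulr1.
Qed.

Lemma calH_sum (a : A) :
  exists t : seq (R * H), a = \sum_(p <- t) i p.1 * hproj p.2.
Proof.
have [u ->] := quot_proj_surj a; have [t ->] := smash_sum u; exists t.
rewrite (raddf_sum (calH_proj X c s d1)); apply: eq_bigr => p _.
exact: calH_proj_elt.
Qed.

Lemma calH_ext (Z : zmodType) (F G : A -> Z) :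
  {morph F : u v / u + v} -> {morph G : u v / u + v} ->
  (forall x h, F (i x * hproj h) = G (i x * hproj h)) -> forall a, F a = G a.
Proof.
move=> FD GD e a; have [t ->] := calH_sum a.
rewrite (big_morph _ FD (morph_add0 FD)) (big_morph _ GD (morph_add0 GD)).
by apply: eq_bigr => p _; apply: e.
Qed.

Lemma hprojD g h : hproj (g + h) = hproj g + hproj h.
Proof. by rewrite /hproj smash_eltDr rmorphD. Qed.
Lemma hproj1 : hproj 1 = 1.
Proof. exact: rmorph1. Qed.
Lemma hprojM g h : hproj (g * h) = hproj g * hproj h.
Proof. by rewrite -[RHS](rmorphM (calH_proj X c s d1)) smash_eltMr. Qed.
Lemma hprojZ a h : hproj (a *: h) = i (j a) * hproj h.
Proof. by rewrite -calH_proj_elt /hproj smash_eltZ mulr1. Qed.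

Lemma hproj_incl h y :
  hproj h * i y = tlift (fun a b => i (X a y) * hproj b) (hcomul h).
Proof.
rewrite -[LHS](rmorphM (calH_proj X c s d1)) [smash_elt X 1 h * _]smash_mulE.
have [t ->] := tensP (hcomul h); rewrite !tlift_tsum; last 2 first.
- split=> [a a' b|a b b'|r a b].
  + by rewrite hactDl rmorphD mulrDl.
  + by rewrite hprojD mulrDr.
  + by rewrite hactZl hprojZ mulrA -rmorphM mulrC.
- exact: balX.
rewrite raddf_sum; apply: eq_bigr => p _.
by rewrite mulr1 mul1r; apply: calH_proj_elt.
Qed.

Lemma hproj_d1 : hproj d1 = i c * (hproj s - 1).
Proof.
have e : calH_proj X c s d1 (smash_elt X 1 d1) =
         calH_proj X c s d1 (smash_incl X c * (smash_elt X 1 s - 1)).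
  apply/quot_projP; exists [:: (1, 1)].
  by rewrite big_seq1 mul1r mulr1.
by rewrite [LHS]e rmorphM rmorphB rmorph1.
Qed.

(* Operators of H on an R-module V that turn V into a module over R # H on which
   the generator of the ideal acts as 0, hence into a module over calH. *)
Record semilinear_ops (V : lmodType R) (rho : H -> V -> V) : Prop := SemilinearOps {
  rhoDl : forall g h v, rho (g + h) v = rho g v + rho h v;
  rhoDr : forall h v w, rho h (v + w) = rho h v + rho h w;
  rhoZ : forall a h v, rho (a *: h) v = j a *: rho h v;
  rho1 : forall v, rho 1 v = v;
  rhoM : forall g h v, rho (g * h) v = rho g (rho h v);
  rho_semi : forall h x v,
    rho h (x *: v) = tlift (fun a b => X a x *: rho b v) (hcomul h);
  rho_rel : forall v, rho d1 v = c *: (rho s v - v) }.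

Section Action.
Variables (V : lmodType R) (rho : H -> V -> V) (P : semilinear_ops rho).

Definition sact (u : smash X) (v : V) : V :=
  tlift (fun (x : rmod j) h => (x : R) *: rho h v) u.

Lemma bal_sact v : balanced (fun (x : rmod j) h => (x : R) *: rho h v).
Proof.
split=> [a a' b|a b b'|r a b].
- exact: scalerDl.
- by rewrite (rhoDl P) scalerDr.
- by rewrite (rhoZ P) scalerA mulrC.
Qed.

Lemma sactE x h v : sact (smash_elt X x h) v = x *: rho h v.
Proof. exact: tliftE (bal_sact v). Qed.

Lemma sactDl v : {morph sact^~ v : u w / u + w}.
Proof. exact: tlift_add (bal_sact v). Qed.

Lemma sactDr u : {morph sact u : v w / v + w}.
Proof.
move=> v w; rewrite /sact -tliftDf; apply: eq_tlift => x h.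
by rewrite (rhoDr P) scalerDr.
Qed.

Lemma bal_semi (x : R) v : balanced (fun a b : H => X a x *: rho b v).
Proof.
split=> [a a' b|a b b'|r a b].
- by rewrite hactDl scalerDl.
- by rewrite (rhoDl P) scalerDr.
- by rewrite hactZl (rhoZ P) scalerA mulrC.
Qed.

Lemma sactM u w v : sact (u * w) v = sact u (sact w v).
Proof.
move: u; apply: tens_ext => [u u'|u u'|x h]; rewrite ?mulrDl ?sactDl //.
rewrite -[tprod _ _]/(smash_elt X x h).
move: w; apply: tens_ext => [w w'|w w'|y g].
- by rewrite mulrDr sactDl.
- by rewrite sactDl sactDr.
rewrite -[tprod _ _]/(smash_elt X y g) !sactE [_ * _]smash_mulE (rho_semi P).
have [t ->] := tensP (hcomul h); rewrite !tlift_tsum; last 2 first.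
- exact: bal_semi.
- exact: balX.
rewrite (big_morph _ (sactDl v) (morph_add0 (sactDl v))) scaler_sumr.
by apply: eq_bigr => p _; rewrite sactE (rhoM P) scalerA.
Qed.

Local Notation e0 := (smash_elt X 1 d1 - smash_incl X c * (smash_elt X 1 s - 1)).

Lemma sact_rel v : sact e0 v = 0.
Proof.
rewrite sactDl (morph_addN (sactDl v)) sactM sactDl (morph_addN (sactDl v)).
rewrite (_ : 1 = smash_elt X 1 1) // !sactE !scale1r (rho_rel P) !(rho1 P).
by rewrite subrr.
Qed.

Definition cact (a : A) (v : V) : V := sact (repr a) v.

Lemma cact_proj u v : cact (calH_proj X c s d1 u) v = sact u v.
Proof.
apply: (quot_repr (F := sact^~ v)) => [|x y]; first exact: sactDl.
by rewrite !sactM sact_rel (morph_add0 (sactDr x)).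
Qed.

Lemma cactE x h v : cact (i x * hproj h) v = x *: rho h v.
Proof. by rewrite -calH_proj_elt cact_proj sactE. Qed.
Lemma cact_incl x v : cact (i x) v = x *: v.
Proof. by rewrite -[i x]mulr1 -hproj1 cactE (rho1 P). Qed.
Lemma cact_hproj h v : cact (hproj h) v = rho h v.
Proof. by rewrite -[hproj h]mul1r -[1]/(i 1) cactE scale1r. Qed.

Lemma cactDl v : {morph cact^~ v : a b / a + b}.
Proof.
move=> a b; have [u ->] := quot_proj_surj a; have [w ->] := quot_proj_surj b.
by rewrite -[quot_proj _ u + _](rmorphD (calH_proj X c s d1)) !cact_proj sactDl.
Qed.
Lemma cactDr a : {morph cact a : v w / v + w}.
Proof. exact: sactDr. Qed.
Lemma cactM a b v : cact (a * b) v = cact a (cact b v).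
Proof.
have [u ->] := quot_proj_surj a; have [w ->] := quot_proj_surj b.
by rewrite -[quot_proj _ u * _](rmorphM (calH_proj X c s d1)) !cact_proj sactM.
Qed.
Lemma cact1 v : cact 1 v = v.
Proof. by rewrite -[1]/(i 1) cact_incl scale1r. Qed.
End Action.

End Smash.

(** * Modules with a basis *)

Lemma sum_delta (K : pzRingType) (V : lmodType K) (I J : finType) (v : I -> J -> V) a b :
  \sum_a' \sum_b' ((a' == a) && (b' == b))%:R *: v a' b' = v a b.
Proof.
rewrite (bigD1 a) //= [X in _ + X]big1 ?addr0 => [|a' /negbTE ->]; last first.
  by rewrite big1 // => b' _; rewrite scale0r.
rewrite (bigD1 b) //= [X in _ + X]big1 ?addr0 => [|b' /negbTE ->]; last first.
  by rewrite andbF scale0r.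
by rewrite !eqxx scale1r.
Qed.

Section Basis.
Variables (K : nzRingType) (V : lmodType K) (N : nat) (v : 'I_N -> nat -> V).

(** The shape of [qh_span] and [qh_free]: finite support is a bound n on the second index. It is
    used for H over k and for calH over R. *)
Definition nat_basis : Prop :=
  (forall m, exists n (c : 'I_N -> 'I_n -> K),
     m = \sum_(a < N) \sum_(b < n) c a b *: v a b) /\
  (forall n (c : 'I_N -> 'I_n -> K),
     \sum_(a < N) \sum_(b < n) c a b *: v a b = 0 -> forall a b, c a b = 0).

Hypothesis vP : nat_basis.
Variables (W : lmodType K) (w : 'I_N -> nat -> W).

Let ev (U : lmodType K) (u : 'I_N -> nat -> U) n (c : 'I_N -> nat -> K) :=
  \sum_(a < N) \sum_(b < n) c a b *: u a b.

Let ev_widen (U : lmodType K) (u : 'I_N -> nat -> U) n m (c : 'I_N -> nat -> K) :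
  (forall a b, (n <= b)%N -> c a b = 0) -> (n <= m)%N -> ev u n c = ev u m c.
Proof.
move=> c0 nm; apply: eq_bigr => a _; rewrite (big_ord_widen m (fun b => c a b *: u a b)) //.
rewrite big_mkcond; apply: eq_bigr => b _; case: ltnP => // /c0 ->.
by rewrite scale0r.
Qed.

(** The linear extension is built as a functional graph, because coordinates are only known to
    exist. Coefficients are padded by 0 beyond n, so that two expansions can be compared at a common
    bound. *)
Let graph (m : V) (x : W) := exists n (c : 'I_N -> nat -> K),
  [/\ forall a b, (n <= b)%N -> c a b = 0, m = ev v n c & x = ev w n c].

Let graph_fun m x y : graph m x -> graph m y -> x = y.
Proof.
move=> [n [c [c0 -> ->]]] [n' [c' [c0' e ->]]].
rewrite (ev_widen w c0 (leq_maxl n n')) (ev_widen w c0' (leq_maxr n n')).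
move: e; rewrite (ev_widen v c0 (leq_maxl n n')) (ev_widen v c0' (leq_maxr n n')).
set l := maxn n n' => e.
have {}e : \sum_(a < N) \sum_(b < l) (c a b - c' a b) *: v a b = 0.
  rewrite -[RHS](subrr (ev v l c')) -[X in X - _]e /ev -sumrB.
  by apply: eq_bigr => a _; rewrite -sumrB; apply: eq_bigr => b _; rewrite scalerBl.
apply: eq_bigr => a _; apply: eq_bigr => b _; congr (_ *: _).
by apply/subr0_eq; apply: (vP.2 l (fun a b => c a b - c' a b) e).
Qed.

Let graph_tot m : exists x, graph m x.
Proof.
have [n [c e]] := vP.1 m.
pose c' a b := if insub b is Some b' then c a b' else 0.
exists (ev w n c'), n, c'; split=> //.
- by move=> a b nb; rewrite /c' insubF // ltnNge nb.
- rewrite e; apply: eq_bigr => a _; apply: eq_bigr => b _.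
  by rewrite /c' valK.
Qed.

Lemma nat_basis_extend : exists f : {linear V -> W}, forall a b, f (v a b) = w a b.
Proof.
pose f m := proj1_sig (cid (graph_tot m)).
have fP m : graph m (f m) by rewrite /f; case: cid.
have fL r m m' : f (r *: m + m') = r *: f m + f m'.
  apply: (graph_fun (fP _)).
  have [n [c [c0 em ->]]] := fP m; have [n' [c' [c0' em' ->]]] := fP m'.
  exists (maxn n n'), (fun a b => r * c a b + c' a b).
  rewrite em em' (ev_widen w c0 (leq_maxl n n')) (ev_widen w c0' (leq_maxr n n')).
  rewrite (ev_widen v c0 (leq_maxl n n')) (ev_widen v c0' (leq_maxr n n')).
  split=> [a b| |]; first by rewrite geq_max => /andP[/c0 -> /c0' ->]; rewrite mulr0 addr0.
  - rewrite /ev scaler_sumr -big_split; apply: eq_bigr => b _.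
    rewrite scaler_sumr -big_split; apply: eq_bigr => b' _.
    by rewrite scalerDl scalerA.
  - rewrite /ev scaler_sumr -big_split; apply: eq_bigr => b _.
    rewrite scaler_sumr -big_split; apply: eq_bigr => b' _.
    by rewrite scalerDl scalerA.
pose fA := GRing.isLinear.Build K V W *:%R f fL.
pose F : {linear V -> W} := HB.pack f fA.
exists F => a b; apply: (graph_fun (fP _)).
exists b.+1, (fun a' b' => ((a' == a) && (b' == b))%:R); split.
- by move=> a' b' lb; case: eqP => //= _; rewrite gtn_eqF.
- by symmetry; apply: (sum_delta (fun a (b' : 'I_b.+1) => v a b') a ord_max).
- by symmetry; apply: (sum_delta (fun a (b' : 'I_b.+1) => w a b') a ord_max).
Qed.
End Basis.

Lemma nat_basis_ext (K : nzRingType) (V W : lmodType K) N (v : 'I_N -> nat -> V)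
    (f g : {linear V -> W}) : nat_basis v ->
  (forall a b, f (v a b) = g (v a b)) -> f =1 g.
Proof.
move=> [vS _] e m; have [n [c ->]] := vS m; rewrite !linear_sum.
by apply: eq_bigr => a _; rewrite !linear_sum; apply: eq_bigr => b _; rewrite !linearZ e.
Qed.

Lemma nat_basis_projective (K : nzRingType) (V : lmodType K) N
  (v : 'I_N -> nat -> V) : nat_basis v -> projective V.
Proof.
move=> vP X Y g f gS.
pose w a b : X := proj1_sig (cid (gS (f (v a b)))).
have wP a b : g (w a b) = f (v a b) by rewrite /w; case: cid.
have [h hP] := nat_basis_extend vP w; exists h => m.
apply: (nat_basis_ext (f := linear_comp g h) vP) => a b /=.
by rewrite hP wP.
Qed.

(** * The Hopf algebra H *)

Section QNumbers.
Variables (k : fieldType) (q : k).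

(** The q-integer [n] = 1 + q + ... + q^(n-1). *)
Definition qnum n := qbinom q n 1.
Lemma qnumS n : qnum n.+1 = 1 + q * qnum n.
Proof. by rewrite /qnum; case: n => [|n]; rewrite /= expr1. Qed.
Lemma qnumE n : (q - 1) * qnum n = q ^+ n - 1.
Proof.
elim: n => [|n IH]; first by rewrite /qnum mulr0 expr0 subrr.
by rewrite qnumS mulrDr mulr1 mulrCA IH exprS mulrBr mulr1 addrC addrA subrK.
Qed.
Lemma qnumSr n : qnum n.+1 = qnum n + q ^+ n.
Proof.
elim: n => [|n IH]; first by rewrite qnumS /qnum mulr0 expr0 addrC.
by rewrite qnumS {1}IH mulrDr addrA -qnumS -exprS.
Qed.

Lemma qbinom_small n m : (n < m)%N -> qbinom q n m = 0.
Proof.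
elim: n m => [|n IH] [|m] //= nm.
by rewrite !IH ?mulr0 ?addr0 // ltnW.
Qed.
Lemma qbinomn n : qbinom q n n = 1.
Proof. by elim: n => //= n ->; rewrite qbinom_small ?mulr0 ?addr0. Qed.
Lemma qbinomSn n : qbinom q n.+1 n = qnum n.+1.
Proof.
elim: n => [|n IH]; first by rewrite qnumS /qnum mulr0 addr0.
by rewrite qnumSr -IH -[LHS]/(qbinom q n.+1 n + q ^+ n.+1 * qbinom q n.+1 n.+1) qbinomn mulr1.
Qed.

Variable N : nat.
Hypotheses (N_gt1 : (1 < N)%N) (q_prim : N.-primitive_root q).

Lemma q_neq1 : q - 1 != 0.
Proof.
rewrite subr_eq0; apply/eqP => q1; have := prim_order_dvd q_prim 1.
by rewrite q1 expr1n eqxx dvdn1 eqn_leq leqNgt N_gt1.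
Qed.
(** Follows from (q - 1) [n] = q^n - 1. Hence d_1 d_n = [n+1] d_(n+1) can be solved for d_(n+1)
    unless N divides n + 1. *)
Lemma qnum_eq0 n : (qnum n == 0) = (N %| n)%N.
Proof.
by rewrite (prim_order_dvd q_prim) -[in RHS]subr_eq0 -qnumE mulf_eq0 (negbTE q_neq1).
Qed.
Lemma qnum_addN n m : qnum (n + m * N) = qnum n.
Proof.
apply: (mulfI q_neq1); rewrite !qnumE exprD mulnC exprM.
by rewrite (prim_expr_order q_prim) expr1n mulr1.
Qed.
End QNumbers.

Section QHopf.
Variables (k : fieldType) (q : k) (N : nat).
Hypotheses (N_gt1 : (1 < N)%N) (q_prim : N.-primitive_root q).
Variables (H : hopfAlgebra k) (s : H) (d : nat -> H) (P : qdiff_hopf q N s d).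

Lemma d1d n : d 1%N * d n = qnum q n.+1 *: d n.+1.
Proof. by rewrite (qh_dd P) add1n. Qed.

Lemma dd1 n : d n * d 1%N = d 1%N * d n.
Proof. by rewrite !(qh_dd P) addn1 add1n qbinomSn. Qed.

(** Multiplication by d_1 raises both sides by the same factor, because [b+1 + mN] = [b+1], and this
    factor is invertible as long as b + 1 < N. *)
Lemma d_split b m : (b < N)%N -> d (b + m * N) = d b * d (m * N)%N.
Proof.
elim: b => [|b IH] bN; first by rewrite (qh_d0 P) mul1r.
have q0 : qnum q b.+1 != 0 by rewrite (qnum_eq0 N_gt1 q_prim) gtnNdvd.
apply: (scalerI q0); rewrite [RHS]scalerAl -d1d -mulrA -IH ?(ltnW bN) //.
by rewrite d1d -addSn (qnum_addN N_gt1 q_prim).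
Qed.

Lemma d_divn n : d n = d (n %% N)%N * d (n %/ N * N)%N.
Proof. by rewrite -d_split ?ltn_pmod ?(ltnW N_gt1) // addnC -divn_eq. Qed.

Lemma dsX n a : d n * s ^+ a = q ^+ (n * a) *: (s ^+ a * d n).
Proof.
elim: a => [|a IH]; first by rewrite muln0 !expr0 scale1r mulr1 mul1r.
rewrite exprSr mulrA IH -scalerAl -[X in _ *: X]mulrA (qh_ds P).
by rewrite -scalerAr scalerA mulrA mulnS addnC exprD.
Qed.

Lemma qh_basis : nat_basis (fun (a : 'I_N) b => s ^+ a * d b).
Proof. by split; [exact: qh_span P | exact: qh_free P]. Qed.

Lemma sX_mod a : s ^+ a = s ^+ (a %% N).
Proof. by rewrite {1}(divn_eq a N) exprD mulnC exprM (qh_order P) expr1n mul1r. Qed.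

Lemma qh_ext (W : lmodType k) (f g : {linear H -> W}) :
  (forall a b, f (s ^+ a * d b) = g (s ^+ a * d b)) -> forall h, f h = g h.
Proof. by move=> e; apply: (nat_basis_ext qh_basis) => a b; apply: e. Qed.

(* l is the coordinate at d (m * N) on H / (d 1, s - 1); the ideal is killed
   because [n] d_n d_p = d_1 d_(n-1) d_p, a multiple of [n + p] d_(n+p). *)
Lemma lambda_exists m : exists l : {linear H -> GRing.regular k},
  [/\ forall a b, l (s ^+ a * d b) = (b == m * N)%N%:R,
      forall g h, l (g * d 1%N * h) = 0 &
      forall g h, l (g * (s - 1) * h) = 0].
Proof.
have [l lE'] := nat_basis_extend qh_basis
  (fun _ b => (b == m * N)%N%:R : GRing.regular k).
have N0 : (0 < N)%N by apply: ltnW.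
have lE a b : l (s ^+ a * d b) = (b == m * N)%N%:R.
  by rewrite sX_mod; apply: (lE' (Ordinal (ltn_pmod a N0))).
have tri (f : H -> H -> k) : (forall g h h', f g (h + h') = f g h + f g h') ->
   (forall g g' h, f (g + g') h = f g h + f g' h) ->
   (forall c g h, f (c *: g) h = c * f g h) ->
   (forall c g h, f g (c *: h) = c * f g h) ->
   (forall a n b m, f (s ^+ a * d n) (s ^+ b * d m) = 0) -> forall g h, f g h = 0.
  move=> fDr fDl fZl fZr f0 g h.
  pose fl h' : {linear H -> GRing.regular k} :=
    HB.pack (f^~ h' : H -> GRing.regular k) (GRing.isLinear.Build k H (GRing.regular k) *:%R (f^~ h')
     (fun c g g' => etrans (fDl _ _ _) (congr1 (+%R^~ _) (fZl _ _ _)))).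
  pose fr g' : {linear H -> GRing.regular k} :=
    HB.pack (f g' : H -> GRing.regular k) (GRing.isLinear.Build k H (GRing.regular k) *:%R (f g')
     (fun c g h => etrans (fDr _ _ _) (congr1 (+%R^~ _) (fZr _ _ _)))).
  apply: (qh_ext (f := fl h) (g := \0)) => a n /=.
  by apply: (qh_ext (f := fr _) (g := \0)) => b p /=; apply: f0.
have lZ (x : k) h : l (x *: h) = x * l h by rewrite linearZ.
have lM a n b p : l (s ^+ a * d n * (s ^+ b * d p)) =
    q ^+ (n * b) * (qbinom q (n + p) n * ((n + p)%N == m * N)%N%:R).
  rewrite -mulrA (mulrA (d n)) dsX -!scalerAl -!scalerAr lZ -(mulrA _ (d n)) (qh_dd P).
  by rewrite -!scalerAr lZ (mulrA (s ^+ a)) -exprD lE.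
have l1 g h : l (g * d 1%N * h) = 0.
  apply: (tri (fun g h => l (g * d 1%N * h))) => {g h}.
  + by move=> *; rewrite mulrDr linearD.
  + by move=> *; rewrite !mulrDl linearD.
  + by move=> *; rewrite -!scalerAl lZ.
  + by move=> *; rewrite -!scalerAr lZ.
  move=> a n b p; rewrite -(mulrA _ (d n)) dd1 -!mulrA.
  rewrite (mulrA (d n)) dsX -!scalerAl -!scalerAr lZ -(mulrA _ (d n)) (qh_dd P).
  rewrite -!scalerAr lZ (mulrA (d 1%N)) dsX -!scalerAl -!scalerAr lZ -mulrA d1d.
  rewrite -!scalerAr !lZ (mulrA (s ^+ a)) -exprD lE.
  case: eqP => [e|]; last by rewrite !mulr0.
  have /eqP -> : qnum q (n + p).+1 == 0 by rewrite (qnum_eq0 N_gt1 q_prim) e dvdn_mull.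
  by rewrite !(mulr0, mul0r).
exists l; split=> // g h.
apply: (tri (fun g h => l (g * (s - 1) * h))) => {g h}.
+ by move=> *; rewrite mulrDr linearD.
+ by move=> *; rewrite !mulrDl linearD.
+ by move=> *; rewrite -!scalerAl lZ.
+ by move=> *; rewrite -!scalerAr lZ.
(* Moving s past d_n yields the factor q^n - 1 = (q - 1) [n]; this [n] is what brings the term back
   to the vanishing on d_1. *)
move=> a n b p; rewrite mulrBr mulr1 mulrBl raddfB /=.
rewrite -[X in l X - _]mulrA (mulrA s) -exprS !lM -mulrBl mulnS exprD.
rewrite -[X in _ - X]mul1r -mulrBl -qnumE -mulrA mulrACA [X in X * _]mulrC.
case: n => [|n]; first by rewrite /qnum /= mul0r mulr0.
rewrite (_ : qnum q n.+1 * _ = 0) ?mulr0 //.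
have := l1 1 (d n * d p); rewrite mul1r mulrA d1d -scalerAl lZ.
by have := lM 0 n.+1 0 p; rewrite muln0 !expr0 !mul1r => ->.
Qed.
End QHopf.

(** * Cocommutativity *)

Lemma sum_divmod (Z : zmodType) M N (f : nat -> Z) :
  \sum_(l < M * N) f l = \sum_(m < M) \sum_(b < N) f (b + m * N)%N.
Proof.
rewrite -(big_mkord predT f) big_nat_mul big_mkord; apply: eq_bigr => m _.
by rewrite -{1}[(m * N)%N]add0n big_addn mulSn addnK big_mkord.
Qed.

Lemma sum_antidiag (Z : zmodType) n K (F : nat -> nat -> Z) : (n < K)%N ->
  \sum_(l < n.+1) F (n - l)%N l =
  \sum_(l' < K) \sum_(l < K) (if (l' + l == n)%N then F l' l else 0).
Proof.
move=> nK; rewrite exchange_big (big_ord_widen K (fun l => F (n - l)%N l)) //=.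
rewrite big_mkcond; apply: eq_bigr => l _; rewrite ltnS; case: leqP => ln.
- have h : (n - l < K)%N by rewrite (leq_ltn_trans (leq_subr _ _)).
  rewrite (bigD1 (Ordinal h)) //= subnK // eqxx big1 ?addr0 // => l' ne.
  case: eqP => // e; case/eqP: ne; apply: val_inj => /=.
  by rewrite -e addnK.
- rewrite big1 // => l' _; case: eqP => // e.
  by move: ln; rewrite -e ltnNge leq_addl.
Qed.

(** Both indices of the antidiagonal are divided by N with remainder. The remainders may add up to
    more than N, so the carry stays in the condition. The bound n.+1 on the quotients is generous;
    the condition discards the excess. *)
Lemma sum_antidiag_divmod (Z : zmodType) n N (F : nat -> nat -> Z) : (0 < N)%N ->
  \sum_(l < n.+1) F (n - l)%N l =
  \sum_(m' < n.+1) \sum_(m < n.+1) \sum_(b' < N) \sum_(b < N)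
    (if (b' + b + (m' + m) * N == n)%N then F (b' + m' * N)%N (b + m * N)%N else 0).
Proof.
move=> N0; rewrite (sum_antidiag _ (K := n.+1 * N)) ?leq_pmulr //.
rewrite (sum_divmod _ _ (fun l' => \sum_(l < n.+1 * N) (if (l' + l == n)%N then F l' l else 0))).
apply: eq_bigr => m' _; rewrite [RHS]exchange_big /=; apply: eq_bigr => b' _.
rewrite (sum_divmod _ _ (fun l => if (b' + m' * N + l == n)%N then F (b' + m' * N)%N l else 0)).
by apply: eq_bigr => m _; apply: eq_bigr => b _; rewrite mulnDl addnACA.
Qed.

Section Cocommutative.
Variables (k : fieldType) (q : k) (N : nat).
Hypotheses (N_gt1 : (1 < N)%N) (q_prim : N.-primitive_root q).
Variables (R : comNzRingType) (j : {rmorphism k -> R}).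
Variables (H : hopfAlgebra k) (X : moduleAlgebra j H).
Variables (s : H) (d : nat -> H) (P : qdiff_hopf q N s d).
Variables (c : R) (Xc : forall x, X (d 1%N) x = c * (X s x - x)).
Variables (t t' : R) (tt' : t * t' = 1) (Xt : X s t = j q * t).

Local Notation A := (calH X c s (d 1%N)).
Local Notation i := (calH_incl X c s (d 1%N)).
Local Notation p := (hproj X c s (d 1%N)).

Lemma balXX y z : balanced (fun a b : H => X a y * X b z).
Proof.
split=> [a a' b|a b b'|r a b].
- by rewrite hactDl mulrDl.
- by rewrite hactDl mulrDr.
- by rewrite !hactZl mulrCA mulrA.
Qed.

Lemma Xs_mul y z : X s (y * z) = X s y * X s z.
Proof. by rewrite hact_mul (qh_comul_s P) (tliftE _ _ (balXX _ _)). Qed.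

Lemma Xs_1 : X s 1 = 1.
Proof. by rewrite hact_unit (qh_counit_s P) rmorph1. Qed.

Lemma XsX_mul a y z : X (s ^+ a) (y * z) = X (s ^+ a) y * X (s ^+ a) z.
Proof.
elim: a y z => [|a IH] y z; first by rewrite !hact1.
by rewrite exprS !hactM IH Xs_mul.
Qed.

Lemma XsX_t a r : X (s ^+ a) (t ^+ r) = j (q ^+ a) ^+ r * t ^+ r.
Proof.
have Xst a' : X (s ^+ a') t = j (q ^+ a') * t.
  elim: a' => [|a' IH]; first by rewrite hact1 rmorph1 mul1r.
  by rewrite exprS hactM IH hactZr Xt mulrA -rmorphM -exprSr.
have XsX1 a' : X (s ^+ a') 1 = 1.
  by elim: a' => [|a' IH]; rewrite ?hact1 // exprS hactM IH Xs_1.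
elim: r => [|r IH]; first by rewrite !expr0 mulr1.
by rewrite !exprS XsX_mul IH Xst mulrACA.
Qed.

(* Evaluation at the powers of t gives \sum_a x_a f(q^a) = 0 for every polynomial
   f over k; a suitable f isolates x_a. *)
Lemma dedekind (x : 'I_N -> R) :
  (forall y, \sum_(a < N) x a * X (s ^+ a) y = 0) -> forall a, x a = 0.
Proof.
move=> x0.
have xr r : \sum_(a < N) x a * j (q ^+ a) ^+ r = 0.
  rewrite -[RHS](mul0r (t' ^+ r)) -[X in _ = X * _](x0 (t ^+ r)) mulr_suml.
  by apply: eq_bigr => a _; rewrite XsX_t -!mulrA -exprMn tt' expr1n mulr1.
have xf (f : {poly k}) : \sum_(a < N) x a * j f.[q ^+ a] = 0.
  transitivity (\sum_(r < size f) j f`_r * \sum_(a < N) x a * j (q ^+ a) ^+ r).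
    under [RHS]eq_bigr => r _ do rewrite mulr_sumr.
    rewrite exchange_big; apply: eq_bigr => a _.
    rewrite horner_coef rmorph_sum mulr_sumr; apply: eq_bigr => r _.
    by rewrite rmorphM mulrCA -[in RHS]rmorphXn.
  by rewrite big1 // => r _; rewrite xr mulr0.
move=> a; pose f := \prod_(b < N | b != a) ('X - (q ^+ b)%:P).
have := xf f; rewrite (bigD1 a) //= [X in _ + X]big1 ?addr0 => [|b ba]; last first.
  by rewrite /f horner_prod (bigD1 b) //= hornerXsubC subrr mul0r rmorph0 mulr0.
have fa : f.[q ^+ a] != 0.
  rewrite horner_prod; apply/prodf_neq0 => b ba; rewrite hornerXsubC subr_eq0.
  by rewrite (eq_prim_root_expr q_prim) !modn_small // eq_sym.
(* R need not be a domain, but f(q^a) is a nonzero element of the field k, so its image in R is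
   invertible. *)
move/(congr1 ( *%R^~ (j (f.[q ^+ a])^-1))).
by rewrite mul0r -mulrA -rmorphM mulfV // rmorph1 mulr1.
Qed.

(* a lies in the R-span of the powers of s and acts on R as f; by [dedekind],
   such an a is determined by f. *)
Definition rep (a : A) (f : R -> R) := exists x : 'I_N -> R,
  a = \sum_(b < N) i (x b) * p (s ^+ b) /\
  forall y, f y = \sum_(b < N) x b * X (s ^+ b) y.

Lemma rep_s n x : rep (i x * p (s ^+ n)) (fun y => x * X (s ^+ n) y).
Proof.
have nN : (n %% N < N)%N by rewrite ltn_pmod // ltnW.
exists (fun b => if b == Ordinal nN then x else 0); split=> [|y].
- rewrite (bigD1 (Ordinal nN)) //= eqxx -(sX_mod P) big1 ?addr0 // => b /negbTE ->.
  by rewrite rmorph0 mul0r.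
- rewrite (bigD1 (Ordinal nN)) //= eqxx -(sX_mod P) big1 ?addr0 // => b /negbTE ->.
  by rewrite mul0r.
Qed.

Lemma rep_ext a f g : rep a f -> f =1 g -> rep a g.
Proof. by move=> [x [e h]] fg; exists x; split=> // y; rewrite -fg. Qed.

Lemma repD a b f g : rep a f -> rep b g -> rep (a + b) (fun y => f y + g y).
Proof.
move=> [x [-> hx]] [x' [-> hx']]; exists (fun b => x b + x' b); split=> [|y].
- by rewrite -big_split; apply: eq_bigr => l _; rewrite rmorphD mulrDl.
- by rewrite hx hx' -big_split; apply: eq_bigr => l _; rewrite mulrDl.
Qed.

Lemma repZ x a f : rep a f -> rep (i x * a) (fun y => x * f y).
Proof.
move=> [x' [-> hx']]; exists (fun b => x * x' b); split=> [|y].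
- by rewrite mulr_sumr; apply: eq_bigr => l _; rewrite rmorphM mulrA.
- by rewrite hx' mulr_sumr; apply: eq_bigr => l _; rewrite mulrA.
Qed.

Lemma rep_sum n (a : 'I_n -> A) f : (forall l, rep (a l) (f l)) ->
  rep (\sum_l a l) (fun y => \sum_l f l y).
Proof.
move=> h; elim: n a f h => [|n IH] a f h.
  rewrite big_ord0; exists (fun=> 0); split=> [|y].
  - by rewrite big1 // => b _; rewrite rmorph0 mul0r.
  - by rewrite big_ord0 big1 // => b _; rewrite mul0r.
rewrite big_ord_recr; apply: rep_ext (repD (IH _ _ (fun l => h (widen_ord (leqnSn n) l))) (h ord_max)) _.
by move=> y; rewrite [in RHS]big_ord_recr.
Qed.

Lemma hproj_s x : p s * i x = i (X s x) * p s.
Proof.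
rewrite hproj_incl (qh_comul_s P) tliftE //.
split=> [a a' b|a b b'|r a b].
- by rewrite hactDl rmorphD mulrDl.
- by rewrite hprojD mulrDr.
- by rewrite hactZl hprojZ mulrA -rmorphM mulrC.
Qed.

(** The rule s x = s(x) s keeps the span of the powers of s stable under left multiplication by s,
    and s acts on R multiplicatively. *)
Lemma rep_sl a f : rep a f -> rep (p s * a) (fun y => X s (f y)).
Proof.
move=> [x [-> hx]]; rewrite mulr_sumr.
have h b : rep (p s * (i (x b) * p (s ^+ b))) (fun y => X s (x b) * X (s ^+ b.+1) y).
  by rewrite mulrA hproj_s -mulrA -hprojM -exprS; apply: rep_s.
apply: rep_ext (rep_sum h) _ => y; rewrite hx.
rewrite (big_morph _ (hactDr X s) (morph_add0 (hactDr X s))).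
by apply: eq_bigr => b _; rewrite Xs_mul exprS hactM.
Qed.

(** The relation of the quotient and [Xc] are the same formula, once in calH and once for operators
    on R. *)
Lemma rep_d1l a f : rep a f -> rep (p (d 1%N) * a) (fun y => X (d 1%N) (f y)).
Proof.
move=> ra; have := repZ c (repD (rep_sl ra) (repZ (-1) ra)).
have -> : p (d 1%N) * a = i c * (p s * a + i (- 1) * a).
  by rewrite hproj_d1 -mulrA mulrBl mul1r rmorphN rmorph1 mulN1r.
move/rep_ext; apply=> y.
by rewrite Xc mulN1r.
Qed.

(** d_(b+1) is d_1 d_b divided by [b+1], which is nonzero for b + 1 < N. *)
Lemma rep_d b : (b < N)%N -> rep (p (d b)) (X (d b)).
Proof.
elim: b => [|b IH] bN.
  rewrite (qh_d0 P) hproj1; have := rep_s 0 1.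
  rewrite rmorph1 mul1r expr0 hproj1 => /rep_ext; apply=> y.
  by rewrite mul1r.
have q0 : qnum q b.+1 != 0 by rewrite (qnum_eq0 N_gt1 q_prim) gtnNdvd.
have -> : d b.+1 = (qnum q b.+1)^-1 *: (d 1%N * d b).
  by rewrite (d1d P) scalerA mulVf // scale1r.
rewrite hprojZ hprojM; apply: rep_ext (repZ _ (rep_d1l (IH (ltnW bN)))) _ => y.
by rewrite hactZl hactM.
Qed.

(** * The tensor square of calH and bilinear operators on R *)

Local Notation AA := (tens (rmod i) (rmod i)).

(** The analogue of [rep] for two variables: a (x) b acts on a pair (y, z) as the product of a y and
    b z in R. *)
Definition rep2 (w : AA) (f : R -> R -> R) := exists x : 'I_N -> 'I_N -> R,
  w = \sum_(a < N) \sum_(b < N) x a b *: rtprod i (p (s ^+ a)) (p (s ^+ b)) /\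
  forall y z, f y z = \sum_(a < N) \sum_(b < N) x a b * (X (s ^+ a) y * X (s ^+ b) z).

Lemma rep20 : rep2 0 (fun _ _ => 0).
Proof.
exists (fun _ _ => 0); split=> [|y z].
- by rewrite big1 // => a _; rewrite big1 // => b _; rewrite scale0r.
- by rewrite big1 // => a _; rewrite big1 // => b _; rewrite mul0r.
Qed.

Lemma rep2D w w' f f' : rep2 w f -> rep2 w' f' ->
  rep2 (w + w') (fun y z => f y z + f' y z).
Proof.
move=> [x [-> e]] [x' [-> e']]; exists (fun a b => x a b + x' a b); split=> [|y z].
- rewrite -big_split; apply: eq_bigr => a _; rewrite -big_split; apply: eq_bigr => b _.
  by rewrite scalerDl.
- rewrite e e' -big_split; apply: eq_bigr => a _; rewrite -big_split.
  by apply: eq_bigr => b _; rewrite mulrDl.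
Qed.

Lemma rep2_ext w f g : rep2 w f -> (forall y z, f y z = g y z) -> rep2 w g.
Proof. by move=> [x [e h]] fg; exists x; split=> // y z; rewrite -fg. Qed.

Lemma rep2_sum n (w : 'I_n -> AA) f : (forall l, rep2 (w l) (f l)) ->
  rep2 (\sum_l w l) (fun y z => \sum_l f l y z).
Proof.
move=> h; elim: n w f h => [|n IH] w f h.
  by rewrite big_ord0; apply: rep2_ext rep20 _ => y z; rewrite big_ord0.
rewrite big_ord_recr; apply: rep2_ext (rep2D (IH _ _ (fun l => h (widen_ord (leqnSn n) l))) (h ord_max)) _.
by move=> y z; rewrite [in RHS]big_ord_recr.
Qed.

Lemma rep2_tprod a f b g : rep a f -> rep b g ->
  rep2 (rtprod i a b) (fun y z => f y * g z).
Proof.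
move=> [x [-> e]] [x' [-> e']]; exists (fun a b => x a * x' b); split=> [|y z].
- rewrite [LHS]tprod_suml; apply: eq_bigr => l _.
  rewrite tprod_sumr; apply: eq_bigr => l' _.
  by rewrite (tprodZl (x l) (p (s ^+ l) : rmod i)) (tprodZr (x' l') _ (p (s ^+ l') : rmod i)) scalerA.
- rewrite e e' mulr_suml; apply: eq_bigr => l _; rewrite mulr_sumr.
  by apply: eq_bigr => l' _; rewrite mulrACA.
Qed.

(** [dedekind] applies once in each variable: for fixed z the coefficients of the operators in y
    vanish, and then those of the operators in z. *)
Lemma rep2_inj w f w' f' : rep2 w f -> rep2 w' f' ->
  (forall y z, f y z = f' y z) -> w = w'.
Proof.
move=> [x [-> e]] [x' [-> e']] ff'.
suff xx' a b : x a b = x' a b.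
  by apply: eq_bigr => a _; apply: eq_bigr => b _; rewrite xx'.
apply/subr0_eq; move: b; apply: dedekind => z; move: a; apply: dedekind => y.
transitivity (f y z - f' y z); last by rewrite ff' subrr.
rewrite e e' -sumrB; apply: eq_bigr => a _; rewrite -sumrB mulr_suml.
by apply: eq_bigr => b _; rewrite -mulrBl -mulrA [X in _ * X]mulrC.
Qed.

Lemma bal_tmul (u v : A) :
  balanced (fun a b : rmod i => rtprod i ((a : A) * u) ((b : A) * v)).
Proof.
split=> [a a' b|a b b'|r a b].
- by rewrite mulrDl; apply: tprodDl.
- by rewrite mulrDl; apply: tprodDr.
- rewrite !restrZ -!mulrA.
  by rewrite (tprodZl r ((a : A) * u : rmod i)) (tprodZr r _ ((b : A) * v : rmod i)).
Qed.

(** Right multiplication by u (x) v. It exists on the whole tensor square, because the balancing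
    involves only left multiplication by R. *)
Definition tmul (u v : A) (z : AA) : AA :=
  tlift (fun a b : rmod i => rtprod i ((a : A) * u) ((b : A) * v)) z.

Lemma tmulE u v a b : tmul u v (rtprod i a b) = rtprod i (a * u) (b * v).
Proof. exact: tliftE (bal_tmul u v). Qed.

Lemma tmulD u v : {morph tmul u v : z w / z + w}.
Proof. exact: tlift_add (bal_tmul u v). Qed.

Lemma bal_tswap : balanced (fun a b : rmod i => tprod b a).
Proof.
split=> [a a' b|a b b'|r a b]; [exact: tprodDr|exact: tprodDl|].
by rewrite tprodZl tprodZr.
Qed.

Lemma tswapE a b : tswap (rtprod i a b) = rtprod i b a.
Proof. exact: tliftE bal_tswap. Qed.
Lemma tswapD : {morph (@tswap _ (rmod i) (rmod i)) : z w / z + w}.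
Proof. exact: tlift_add bal_tswap. Qed.

Lemma tswap_tmul u v z : tswap (tmul u v z) = tmul v u (tswap z).
Proof.
move: z; apply: tens_ext => [z w|z w|a b].
- by rewrite tmulD tswapD.
- by rewrite tswapD tmulD.
- by rewrite tmulE !tswapE tmulE.
Qed.

(* The part of the coproduct of d (n - m * N) on the pairs (d b', d b) with
   b', b < N; the coproduct of d n is built from these parts. *)
Definition carryless n m : AA := \sum_(b' < N) \sum_(b < N)
  if (b' + b + m * N == n)%N
  then rtprod i (p (s ^+ b * d b')) (p (d b)) else 0.
Definition carryless_form n m y z : R := \sum_(b' < N) \sum_(b < N)
  if (b' + b + m * N == n)%N then X (s ^+ b * d b') y * X (d b) z else 0.

Lemma rep_sXd b' b : (b' < N)%N -> rep (p (s ^+ b * d b')) (X (s ^+ b * d b')).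
Proof.
move=> b'N; elim: b => [|b IH]; first by rewrite mul1r; apply: rep_d.
rewrite exprS -mulrA hprojM; apply: rep_ext (rep_sl IH) _ => y.
by rewrite [RHS]hactM.
Qed.

Lemma rep2_carryless n m : rep2 (carryless n m) (carryless_form n m).
Proof.
apply: rep2_sum => b'; apply: rep2_sum => b; case: ifP => _.
- by apply: rep2_tprod; [apply: rep_sXd | apply: rep_d].
- exact: rep20.
Qed.

(** The Leibniz rule with both indices split by [d_split]. The power s^(b + mN) in the left leg
    reduces to s^b since s^N = 1, so that d_(m'N) and d_(mN) only change the arguments of the
    form. *)
Lemma X_d_mul n y z : X (d n) (y * z) =
  \sum_(m' < n.+1) \sum_(m < n.+1)
    carryless_form n (m' + m) (X (d (m' * N)%N) y) (X (d (m * N)%N) z).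
Proof.
rewrite hact_mul (qh_comul_d P).
rewrite (big_morph _ (tlift_add (balXX y z)) (tlift0 (balXX y z))).
under eq_bigr => l _ do rewrite (tliftE _ _ (balXX y z)).
rewrite (sum_antidiag_divmod _ (fun l' l => X (s ^+ l * d l') y * X (d l) z) (ltnW N_gt1)).
apply: eq_bigr => m' _; apply: eq_bigr => m _; apply: eq_bigr => b' _.
apply: eq_bigr => b _; case: ifP => // _.
rewrite -!hactM !(d_split N_gt1 q_prim P) // mulrA.
by rewrite exprD [(m * N)%N]mulnC exprM (qh_order P) expr1n mulr1.
Qed.

(** The condition depends on n and m only through n - mN; terms of positive level m are thus
    instances at a smaller n. *)
Lemma carryless_form_sub n m y z : carryless_form n m y z = if (m * N <= n)%N then carryless_form (n - m * N)%N 0 y z else 0.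
Proof.
case: leqP => mn.
  apply: eq_bigr => b' _; apply: eq_bigr => b _; congr (if _ then _ else _).
  by rewrite mul0n addn0 -[in RHS](eqn_add2r (m * N)) subnK.
rewrite /carryless_form big1 // => b' _; rewrite big1 // => b _.
by case: eqP => // e; move: mn; rewrite -e ltnNge leq_addl.
Qed.

(* X (d n) (y * z) is symmetric in y and z, and so are, by induction, all terms of
   its expansion [X_d_mul] except for the leading one. *)
Lemma carryless_form_sym n m y z : carryless_form n m y z = carryless_form n m z y.
Proof.
rewrite (carryless_form_sub n m y z) (carryless_form_sub n m z y); case: ifP => // _; move: (n - _)%N => {m} n'.
elim/ltn_ind: n' y z => {n} n IH y z.
have h m y' z' : (0 < m)%N -> carryless_form n m y' z' = carryless_form n m z' y'.
  move=> m0; rewrite (carryless_form_sub n m y') (carryless_form_sub n m z'); case: ifP => // mn; apply: IH.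
  by rewrite ltn_subrL muln_gt0 m0 (ltnW N_gt1) (leq_trans _ mn) // muln_gt0 m0 ltnW.
(* The expansion of d_n (z y) is subtracted with m' and m exchanged, so that each difference
   compares the form at a pair with the form at the exchanged pair. Only m' = m = 0 escapes the
   induction. *)
have : \sum_(m' < n.+1) \sum_(m < n.+1)
    (carryless_form n (m' + m) (X (d (m' * N)%N) y) (X (d (m * N)%N) z) -
     carryless_form n (m' + m) (X (d (m * N)%N) z) (X (d (m' * N)%N) y)) = 0.
  under eq_bigr => m' _ do rewrite sumrB.
  rewrite sumrB -X_d_mul mulrC X_d_mul exchange_big /=.
  by under eq_bigr => m' _ do under eq_bigr => m _ do rewrite addnC; rewrite subrr.
rewrite (bigD1 ord0) //= (bigD1 ord0) //= big1 => [|m m0]; last first.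
  by rewrite h ?subrr // add0n lt0n -[0%N]/(val (@ord0 n)) val_eqE.
rewrite big1 => [|m m0]; last first.
  rewrite big1 // => m' _; rewrite h ?subrr // addn_gt0 lt0n.
  by rewrite -[0%N]/(val (@ord0 n)) val_eqE m0.
by rewrite !(qh_d0 P) !hact1 !addr0 => /subr0_eq.
Qed.

(** The swapped tensor is represented by the swapped form, so [rep2_inj] turns the symmetry of the
    form into that of the tensor. *)
Lemma carryless_sym n m : tswap (carryless n m) = carryless n m.
Proof.
have [x [e h]] := rep2_carryless n m; apply: (rep2_inj (f := fun y z => carryless_form n m z y)).
- exists (fun a b => x b a); split=> [|y z].
  + rewrite e (big_morph _ tswapD (morph_add0 tswapD)) exchange_big.
    apply: eq_bigr => a _; rewrite (big_morph _ tswapD (morph_add0 tswapD)).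
    apply: eq_bigr => b _.
    rewrite -(tprodZl _ (p (s ^+ a) : rmod i)) -(tprodZr _ _ (p (s ^+ a) : rmod i)).
    exact: tswapE.
  + rewrite h exchange_big; apply: eq_bigr => a _; apply: eq_bigr => b _.
    by rewrite [X (s ^+ b) z * _]mulrC.
- exact: rep2_carryless.
- by move=> y z; rewrite carryless_form_sym.
Qed.

(** The coproduct of H pushed into the tensor square. The coproduct of calH will be its R-linear
    extension, once this is known to be compatible with the ideal. *)
Definition hdelta (h : H) : AA := tlift (fun a b => rtprod i (p a) (p b)) (hcomul h).

Lemma bal_hdelta : balanced (fun a b : H => rtprod i (p a) (p b)).
Proof.
split=> [a a' b|a b b'|r a b].
- by rewrite hprojD; apply: tprodDl.
- by rewrite hprojD; apply: tprodDr.
- rewrite !hprojZ.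
  by rewrite (tprodZl (j r) (p a : rmod i)) (tprodZr (j r) _ (p b : rmod i)).
Qed.

Lemma hdelta_D : {morph hdelta : g h / g + h}.
Proof. by move=> g h; rewrite /hdelta linearD tlift_add //; apply: bal_hdelta. Qed.

Lemma hdelta_Z r h : hdelta (r *: h) = j r *: hdelta h.
Proof.
rewrite /hdelta linearZ /=; have [l ->] := tensP (hcomul h).
rewrite {1}/tsum scaler_sumr.
rewrite (big_morph _ (tlift_add bal_hdelta) (tlift0 bal_hdelta)).
rewrite tlift_tsum; last exact: bal_hdelta.
rewrite scaler_sumr; apply: eq_bigr => x _.
rewrite -tprodZl (tliftE _ _ bal_hdelta) hprojZ.
exact: (tprodZl (j r) (p x.1 : rmod i)).
Qed.

Lemma tswapZ r (z : AA) : tswap (r *: z) = r *: tswap z.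
Proof. by apply: tliftZ; [exact: bal_tswap | move=> a b; rewrite tprodZr]. Qed.

(** Parallel to [X_d_mul], but here the d_(mN) stay as right factors instead of being evaluated on
    R. *)
Lemma hdelta_d n : hdelta (d n) =
  \sum_(m' < n.+1) \sum_(m < n.+1)
    tmul (p (d (m' * N)%N)) (p (d (m * N)%N)) (carryless n (m' + m)).
Proof.
rewrite /hdelta (qh_comul_d P).
rewrite (big_morph _ (tlift_add bal_hdelta) (tlift0 bal_hdelta)).
under eq_bigr => l _ do rewrite (tliftE _ _ bal_hdelta).
rewrite (sum_antidiag_divmod _ (fun l' l => rtprod i (p (s ^+ l * d l')) (p (d l))) (ltnW N_gt1)).
apply: eq_bigr => m' _; apply: eq_bigr => m _.
rewrite (big_morph _ (tmulD _ _) (morph_add0 (tmulD _ _))); apply: eq_bigr => b' _.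
rewrite (big_morph _ (tmulD _ _) (morph_add0 (tmulD _ _))); apply: eq_bigr => b _.
case: ifP => // _; last by rewrite (morph_add0 (tmulD _ _)).
rewrite tmulE -!hprojM !(d_split N_gt1 q_prim P) // mulrA.
by rewrite exprD [(m * N)%N]mulnC exprM (qh_order P) expr1n mulr1.
Qed.

(** Left multiplication does not respect the balancing in general. For the grouplike s it does,
    because a scalar r leaves either leg as the same scalar [X s r]. *)
Lemma bal_smul : balanced (fun a b : rmod i => rtprod i (p s * (a : A)) (p s * (b : A))).
Proof.
split=> [a a' b|a b b'|r a b].
- by rewrite mulrDr; apply: tprodDl.
- by rewrite mulrDr; apply: tprodDr.
- have e (x : A) : r *: (x : rmod i) = i r * x :> A by [].
  rewrite !e !mulrA !hproj_s -!mulrA.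
  by rewrite (tprodZl (X s r) (p s * (a : A) : rmod i)) (tprodZr (X s r) _ (p s * (b : A) : rmod i)).
Qed.

Definition smul (z : AA) : AA :=
  tlift (fun a b : rmod i => rtprod i (p s * (a : A)) (p s * (b : A))) z.
Lemma smulD : {morph smul : z w / z + w}.
Proof. exact: tlift_add bal_smul. Qed.
Lemma smulE a b : smul (rtprod i a b) = rtprod i (p s * a) (p s * b).
Proof. exact: tliftE bal_smul. Qed.

Lemma tswap_smul z : tswap (smul z) = smul (tswap z).
Proof.
move: z; apply: tens_ext => [z w|z w|a b].
- by rewrite smulD tswapD.
- by rewrite tswapD smulD.
- by rewrite smulE !tswapE smulE.
Qed.

Lemma hdelta_s h : hdelta (s * h) = smul (hdelta h).
Proof.
have [l e] := tensP (hcomul h).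
have es : hcomul s = tsum [:: (s, s)] by rewrite (qh_comul_s P) /tsum big_seq1.
rewrite /hdelta (hcomulM es e) e !tlift_tsum; try exact: bal_hdelta.
rewrite (big_morph _ smulD (morph_add0 smulD)) big_allpairs_dep big_seq1.
by apply: eq_bigr => x _; rewrite smulE -!hprojM.
Qed.

Lemma hdelta_sym h : tswap (hdelta h) = hdelta h.
Proof.
have hd n : tswap (hdelta (d n)) = hdelta (d n).
  rewrite hdelta_d (big_morph _ tswapD (morph_add0 tswapD)) [RHS]exchange_big.
  apply: eq_bigr => m' _; rewrite (big_morph _ tswapD (morph_add0 tswapD)).
  by apply: eq_bigr => m _; rewrite tswap_tmul carryless_sym addnC.
have hsd a n : tswap (hdelta (s ^+ a * d n)) = hdelta (s ^+ a * d n).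
  elim: a => [|a IH]; first by rewrite mul1r.
  by rewrite exprS -mulrA hdelta_s tswap_smul IH.
have [n [x ->]] := qh_span P h.
rewrite (big_morph _ hdelta_D (morph_add0 hdelta_D)) (big_morph _ tswapD (morph_add0 tswapD)).
apply: eq_bigr => a _.
rewrite (big_morph _ hdelta_D (morph_add0 hdelta_D)) (big_morph _ tswapD (morph_add0 tswapD)).
by apply: eq_bigr => b _; rewrite hdelta_Z tswapZ hsd.
Qed.
End Cocommutative.

(** * The bialgebra structure *)

Lemma morph_tlift (R : comPzRingType) (M N : lmodType R) (Y Z : zmodType)
    (F : Y -> Z) (f : M -> N -> Y) u : {morph F : x y / x + y} ->
  F (tlift f u) = tlift (fun m n => F (f m n)) u.
Proof. by move=> FD; rewrite /tlift (big_morph _ FD (morph_add0 FD)). Qed.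

Section Bialgebra.
Variables (k : fieldType) (q : k) (N : nat).
Hypotheses (N_gt1 : (1 < N)%N) (q_prim : N.-primitive_root q).
Variables (R : comNzRingType) (j : {rmorphism k -> R}).
Variables (H : hopfAlgebra k) (X : moduleAlgebra j H).
Variables (s : H) (d : nat -> H) (P : qdiff_hopf q N s d).
Variables (c : R) (Xc : forall x, X (d 1%N) x = c * (X s x - x)).
Variables (t t' : R) (tt' : t * t' = 1) (Xt : X s t = j q * t).

Local Notation A := (calH X c s (d 1%N)).
Local Notation i := (calH_incl X c s (d 1%N)).
Local Notation p := (hproj X c s (d 1%N)).
Local Notation AA := (tens (rmod i) (rmod i)).
Local Notation DA := (hdelta X s d c).

Lemma hact_semilinear : @semilinear_ops _ _ _ _ X c s (d 1%N) (GRing.regular R) X.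
Proof.
split=> [g h v|h v w|a h v|v|g h v|h x v|v].
- exact: (hactDl X).
- exact: (hactDr X).
- exact: (hactZl X).
- exact: (hact1 X).
- exact: (hactM X).
- exact: (hact_mul X).
- exact: Xc.
Qed.

Definition actR (a : A) (x : R) : R := @cact _ _ _ _ X c s (d 1%N) (GRing.regular R) X a x.

Lemma actR_D x : {morph actR^~ x : a b / a + b}.
Proof. exact: (cactDl hact_semilinear). Qed.
Lemma actR_scale r a x : actR (i r * a) x = r * actR a x.
Proof.
by rewrite /actR (cactM hact_semilinear) (cact_incl hact_semilinear).
Qed.
Lemma actR_p h x : actR (p h) x = X h x.
Proof. exact: (cact_hproj hact_semilinear). Qed.

(** H itself is not cocommutative; the two legs may be exchanged only in expressions that depend on
    their images in calH. *)
Lemma cocomm_lift (Z : zmodType) (G : rmod i -> rmod i -> Z) h : balanced G ->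
  tlift (fun a b => G (p a) (p b)) (hcomul h) =
  tlift (fun a b => G (p b) (p a)) (hcomul h).
Proof.
move=> GB.
have := congr1 (tlift G) (hdelta_sym N_gt1 q_prim P Xc tt' Xt h).
rewrite /hdelta (morph_tlift _ _ (@tswapD _ _ _ _ _ _ _ _)).
rewrite !(morph_tlift _ _ (tlift_add GB)) => e.
rewrite -[LHS](eq_tlift (fun a b => tliftE _ _ GB)) -e.
by apply: eq_tlift => a b; rewrite tswapE (tliftE _ _ GB).
Qed.

(* The smash product gives the same formula with the two legs of the coproduct
   of h exchanged. *)
Lemma hproj_incl_swap h y :
  p h * i y = tlift (fun a b => i (X b y) * p a) (hcomul h).
Proof.
rewrite hproj_incl.
(* [actR] in place of [X] makes the expression a function on calH, where the legs can be
   exchanged. *)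
pose G (a b : rmod i) := i (actR b y) * a : A.
have GB : balanced G.
  split=> [a a' b|a b b'|r a b]; rewrite /G.
  - by rewrite mulrDr.
  - by rewrite actR_D rmorphD mulrDl.
  - rewrite -[r *: a]/(i r * (a : A)) -[r *: b]/(i r * (b : A)) actR_scale.
    by rewrite mulrA -rmorphM mulrC.
have := cocomm_lift h GB; rewrite /G.
under eq_tlift => a b do rewrite actR_p.
by move=> ->; apply: eq_tlift => a b; rewrite actR_p.
Qed.

Lemma tmul_comp (u v u' v' : A) (z : AA) : tmul u v (tmul u' v' z) = tmul (u' * u) (v' * v) z.
Proof.
move: z; apply: tens_ext => [z w|z w|a b].
- by rewrite !tmulD.
- by rewrite tmulD.
- by rewrite !tmulE !mulrA.
Qed.

Lemma tmul_hdelta y z h :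
  tmul y z (DA h) = tlift (fun a b => rtprod i (p a * y) (p b * z)) (hcomul h).
Proof.
rewrite /hdelta (morph_tlift _ _ (@tmulD _ _ _ _ _ _ _ _ _ _)).
by apply: eq_tlift => a b; rewrite tmulE.
Qed.

Lemma rtprodZl r (a b : A) : rtprod i (i r * a) b = r *: rtprod i a b.
Proof. exact: (tprodZl r (a : rmod i)). Qed.
Lemma rtprodZr r (a b : A) : rtprod i a (i r * b) = r *: rtprod i a b.
Proof. exact: (tprodZr r _ (b : rmod i)). Qed.
Lemma rtprodDl (a a' b : A) : rtprod i (a + a') b = rtprod i a b + rtprod i a' b.
Proof. exact: tprodDl. Qed.
Lemma rtprodDr (a b b' : A) : rtprod i a (b + b') = rtprod i a b + rtprod i a b'.
Proof. exact: tprodDr. Qed.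

Lemma bal_XAA y (a : H) : balanced (fun b e : H => X b y *: rtprod i (p a) (p e)).
Proof.
split=> [b b' e|b e e'|r b e].
- by rewrite hactDl scalerDl.
- by rewrite hprojD rtprodDr scalerDr.
- by rewrite hactZl hprojZ rtprodZr scalerA mulrC.
Qed.

Lemma bal_XAA' y (e : H) : balanced (fun a b : H => X b y *: rtprod i (p a) (p e)).
Proof.
split=> [a a' b|a b b'|r a b].
- by rewrite hprojD rtprodDl scalerDr.
- by rewrite hactDl scalerDl.
- by rewrite hactZl hprojZ rtprodZl scalerA mulrC.
Qed.

Lemma bal_XAA'' y (e : H) : balanced (fun a b : H => X a y *: rtprod i (p b) (p e)).
Proof.
split=> [a a' b|a b b'|r a b].
- by rewrite hactDl scalerDl.
- by rewrite hprojD rtprodDl scalerDr.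
- by rewrite hactZl hprojZ rtprodZl scalerA mulrC.
Qed.

Lemma rtprod_tlift_l (M N0 : lmodType k) (f : M -> N0 -> A) u (b : A) :
  rtprod i (tlift f u) b = tlift (fun m n => rtprod i (f m n) b) u.
Proof. exact: (morph_tlift (F := fun a => rtprod i a b) _ _ (fun a a' => rtprodDl a a' b)). Qed.
Lemma rtprod_tlift_r (M N0 : lmodType k) (f : M -> N0 -> A) u (a : A) :
  rtprod i a (tlift f u) = tlift (fun m n => rtprod i a (f m n)) u.
Proof. exact: (morph_tlift (F := fun b => rtprod i a b) _ _ (fun b b' => rtprodDr a b b')). Qed.

(** Both sides equal \sum (h_2 . y) h_1 (x) h_3: the left one by [hproj_incl_swap], the right one by
    [hproj_incl]. Cocommutativity enters through the former. *)
Lemma hdelta_takeuchi y h : tmul (i y) 1 (DA h) = tmul 1 (i y) (DA h).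
Proof.
rewrite !tmul_hdelta.
transitivity (tlift (fun a b => tlift (fun a1 a2 => X a2 y *: rtprod i (p a1) (p b))
   (hcomul a)) (hcomul h)).
  apply: eq_tlift => a b; rewrite mulr1 hproj_incl_swap rtprod_tlift_l.
  by apply: eq_tlift => a1 a2; rewrite rtprodZl.
rewrite -(coassoc_lift (F := fun a b e => X b y *: rtprod i (p a) (p e)) (@hcomulA _ H)).
- apply: eq_tlift => a b; rewrite mulr1 hproj_incl rtprod_tlift_r.
  by apply: eq_tlift => b1 b2; rewrite rtprodZr.
- exact: bal_XAA.
- exact: bal_XAA'.
Qed.

Lemma hdelta_incl y h :
  tmul (i y) 1 (DA h) = tlift (fun a b => X a y *: DA b) (hcomul h).
Proof.
rewrite tmul_hdelta.
transitivity (tlift (fun a b => tlift (fun a1 a2 => X a1 y *: rtprod i (p a2) (p b))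
   (hcomul a)) (hcomul h)).
  apply: eq_tlift => a b; rewrite mulr1 hproj_incl rtprod_tlift_l.
  by apply: eq_tlift => a1 a2; rewrite rtprodZl.
rewrite -(coassoc_lift (F := fun a b e => X a y *: rtprod i (p b) (p e)) (@hcomulA _ H)).
- apply: eq_tlift => a b; rewrite /hdelta.
  exact/esym/(morph_tlift (F := *:%R (X a y)) _ _ (scalerDr _)).
- move=> a; split=> [b b' e|b e e'|r b e].
  + by rewrite hprojD rtprodDl scalerDr.
  + by rewrite hprojD rtprodDr scalerDr.
  + by rewrite !hprojZ rtprodZl rtprodZr.
- exact: bal_XAA''.
Qed.

Lemma tmulZ (u v : A) r (z : AA) : tmul u v (r *: z) = r *: tmul u v z.
Proof.
apply: tliftZ; first exact: bal_tmul.
by move=> a b; rewrite -[r *: a]/(i r * (a : A)) -mulrA rtprodZl.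
Qed.

Lemma tmul11 (z : AA) : tmul 1 1 z = z.
Proof.
move: z; apply: tens_ext => [z w|z w|a b]; rewrite ?tmulD //.
by rewrite tmulE !mulr1.
Qed.

Lemma hdelta1 : DA 1 = rtprod i 1 1.
Proof.
by rewrite /hdelta hcomul1 (tliftE _ _ (bal_hdelta _ _ _ _)) hproj1.
Qed.

(** Left multiplication by the coproduct of h. Unlike for [tmul], the balancing rests on
    [hdelta_takeuchi]. *)
Definition hact_tens (h : H) (z : AA) : AA :=
  tlift (fun a b : rmod i => tmul (a : A) (b : A) (DA h)) z.

Lemma tmulDl (u u' v : A) (z : AA) : tmul (u + u') v z = tmul u v z + tmul u' v z.
Proof.
rewrite /tmul -tliftDf; apply: eq_tlift => a b.
by rewrite mulrDr rtprodDl.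
Qed.
Lemma tmulDr (u v v' : A) (z : AA) : tmul u (v + v') z = tmul u v z + tmul u v' z.
Proof.
rewrite /tmul -tliftDf; apply: eq_tlift => a b.
by rewrite mulrDr rtprodDr.
Qed.

Lemma bal_hact2 h : balanced (fun a b : rmod i => tmul (a : A) (b : A) (DA h)).
Proof.
split=> [a a' b|a b b'|r a b]; [exact: tmulDl|exact: tmulDr|].
have e (x : A) : r *: (x : rmod i) = i r * x :> A by [].
rewrite !e -[in LHS](mul1r (b : A)) -[in RHS](mul1r (a : A)) -!tmul_comp.
by rewrite hdelta_takeuchi.
Qed.

Lemma hact_tensE h (a b : A) : hact_tens h (rtprod i a b) = tmul a b (DA h).
Proof. exact: tliftE (bal_hact2 h). Qed.
Lemma hact_tensD h : {morph hact_tens h : z w / z + w}.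
Proof. exact: tlift_add (bal_hact2 h). Qed.
Lemma hact_tens_tmul h u v z : hact_tens h (tmul u v z) = tmul u v (hact_tens h z).
Proof.
move: z; apply: tens_ext => [z w|z w|a b].
- by rewrite tmulD hact_tensD.
- by rewrite hact_tensD tmulD.
- by rewrite tmulE !hact_tensE tmul_comp.
Qed.
Lemma hact_tens_hdelta g h : hact_tens g (DA h) = DA (g * h).
Proof.
have [l e] := tensP (hcomul h); have [l' e'] := tensP (hcomul g).
rewrite /hdelta (hcomulM e' e) e (tlift_tsum _ (bal_hdelta _ _ _ _)).
rewrite (tlift_tsum _ (bal_hdelta _ _ _ _)) (big_morph _ (hact_tensD g) (morph_add0 (hact_tensD g))).
rewrite big_allpairs_dep exchange_big; apply: eq_bigr => x _.
rewrite hact_tensE tmul_hdelta e' tlift_tsum.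
  by apply: eq_bigr => y _; rewrite !hprojM.
split=> [a a' b|a b b'|r a b].
- by rewrite hprojD mulrDl rtprodDl.
- by rewrite hprojD mulrDl rtprodDr.
- by rewrite !hprojZ -!mulrA rtprodZl rtprodZr.
Qed.

(** The coideal property of the relation: once d_1 is replaced by c (s - 1) in d_1 (x) 1 + s (x)
    d_1, the mixed terms s (x) 1 cancel. *)
Lemma hdelta_d1 : DA (d 1%N) = c *: (DA s - DA 1).
Proof.
have dE (l : seq (H * H)) : tlift (fun a b => rtprod i (p a) (p b)) (tsum l) =
    \sum_(x <- l) rtprod i (p x.1) (p x.2) by apply: tlift_tsum; apply: bal_hdelta.
have e : hcomul (d 1%N) = tsum [:: (d 1%N, 1); (s, d 1%N)].
  rewrite (qh_comul_d P) /tsum !big_cons big_nil !big_ord_recr big_ord0 /=.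
  by rewrite !(qh_d0 P) expr0 expr1 mul1r mulr1 add0r addr0.
have es : hcomul s = tsum [:: (s, s)] by rewrite (qh_comul_s P) /tsum big_seq1.
rewrite hdelta1 /hdelta e es !dE !big_cons !big_nil !addr0 /= hproj_d1 hproj1.
rewrite rtprodZl rtprodZr -scalerDr; congr (_ *: _).
rewrite rtprodDl rtprodDr.
have -> : rtprod i (- 1) 1 = - rtprod i 1 1 by apply: tprodNl.
have -> : rtprod i (p s) (- 1) = - rtprod i (p s) 1 by apply: tprodNr.
by rewrite [LHS]addrC addrA subrK.
Qed.

Lemma hact_tens_semilinear : semilinear_ops X c s (d 1%N) hact_tens.
Proof.
split=> [g h z|h z w|r h z|z|g h z|h x z|z].
- by rewrite /hact_tens -tliftDf; apply: eq_tlift => a b; rewrite hdelta_D tmulD.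
- exact: hact_tensD.
- rewrite /hact_tens (morph_tlift _ _ (scalerDr _)); apply: eq_tlift => a b.
  by rewrite hdelta_Z tmulZ.
- move: z; apply: tens_ext => [z w|//|a b]; first by rewrite hact_tensD.
  by rewrite hact_tensE hdelta1 tmulE !mul1r.
- move: z; apply: tens_ext => [z w|z w|a b]; rewrite ?hact_tensD //.
  by rewrite !hact_tensE hact_tens_tmul hact_tens_hdelta.
- move: z; apply: tens_ext => [z w|z w|a b].
  + by rewrite scalerDr hact_tensD.
  + by rewrite -tliftDf; apply: eq_tlift => g g'; rewrite hact_tensD scalerDr.
  + rewrite -rtprodZl hact_tensE -[b in LHS]mul1r -tmul_comp hdelta_incl.
    rewrite (morph_tlift _ _ (@tmulD _ _ _ _ _ _ _ _ _ _)); apply: eq_tlift => g g'.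
    by rewrite hact_tensE tmulZ.
- move: z; apply: tens_ext => [z w|z w|a b].
  + by rewrite hact_tensD.
  + by rewrite !hact_tensD opprD addrACA scalerDr.
  + rewrite !hact_tensE hdelta_d1 tmulZ tmulD (morph_addN (@tmulD _ _ _ _ _ _ _ _ _ _)).
    by rewrite hdelta1 tmulE !mul1r.
Qed.

(** * The coproduct and the counit of calH *)

Definition calH_comul (a : rmod i) : AA := cact hact_tens (a : A) (rtprod i 1 1).
Definition calH_counit (a : rmod i) : GRing.regular R := actR (a : A) 1.

Lemma calH_comul_linear : linear calH_comul.
Proof.
move=> r a b; rewrite /calH_comul (cactDl hact_tens_semilinear).
by rewrite -[r *: a]/(i r * (a : A)) (cactM hact_tens_semilinear) (cact_incl hact_tens_semilinear).
Qed.

Lemma calH_counit_linear : linear calH_counit.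
Proof.
move=> r a b; rewrite /calH_counit actR_D.
by rewrite -[r *: a]/(i r * (a : A)) actR_scale.
Qed.

HB.instance Definition _ := GRing.isLinear.Build R (rmod i) AA *:%R calH_comul calH_comul_linear.
HB.instance Definition _ := GRing.isLinear.Build R (rmod i) (GRing.regular R) *:%R calH_counit calH_counit_linear.

Definition calH_D : {linear rmod i -> AA} := calH_comul.
Definition calH_e : {linear rmod i -> GRing.regular R} := calH_counit.

Lemma calH_D_elt x h : calH_D (i x * p h) = x *: DA h.
Proof. by rewrite [LHS](cactE hact_tens_semilinear) hact_tensE tmul11. Qed.
Lemma calH_e_elt x h : calH_e (i x * p h) = x * j (hcounit h).
Proof. by rewrite [LHS](cactE hact_semilinear) hact_unit. Qed.

Lemma calH_D_mul (a b : A) : calH_D (a * b) = cact hact_tens a (calH_D b).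
Proof. exact: (cactM hact_tens_semilinear). Qed.

(** Acting on u (x) v is right multiplication of the coproduct by u (x) v; with [calH_D_mul] this
    makes the coproduct multiplicative. *)
Lemma cact2_tprod (a u v : A) : cact hact_tens a (rtprod i u v) = tmul u v (calH_D a).
Proof.
move: a; apply: calH_ext => [a b|a b|x h].
- by rewrite (cactDl hact_tens_semilinear).
- by rewrite linearD tmulD.
- by rewrite (cactE hact_tens_semilinear) calH_D_elt tmulZ hact_tensE.
Qed.

Lemma smash_rtprod_bal (x : R) : balanced (fun h1 h2 : H =>
  rtprod (smash_incl X) (smash_elt X x h1) (smash_elt X 1 h2)).
Proof.
have e y z h : y *: (smash_elt X z h : rmod (smash_incl X)) = smash_elt X (y * z) h.
  exact: smash_eltM1.
split=> [a a' b|a b b'|r a b].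
- by rewrite smash_eltDr; apply: tprodDl.
- by rewrite smash_eltDr; apply: tprodDr.
- by rewrite !smash_eltZ -!e tprodZl tprodZr.
Qed.

Lemma smash_comul_add : {morph @smash_comul _ _ _ _ X : u v / u + v}.
Proof.
have e y z h : y *: (smash_elt X z h : rmod (smash_incl X)) = smash_elt X (y * z) h.
  exact: smash_eltM1.
apply: tlift_add; split=> [y y' g|y g g'|r y g].
- rewrite -tliftDf; apply: eq_tlift => h1 h2.
  by rewrite smash_eltDl; apply: tprodDl.
- by rewrite linearD tlift_add //; apply: smash_rtprod_bal.
- have [l el] := tensP (hcomul g); rewrite linearZ /= el.
  have B := smash_rtprod_bal y.
  rewrite {2}/tsum scaler_sumr (big_morph _ (tlift_add B) (tlift0 B)).
  rewrite tlift_tsum; last exact: smash_rtprod_bal.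
  apply: eq_bigr => x _; rewrite -tprodZl (tliftE _ _ B).
  by rewrite -[r *: y]/(j r * (y : R)) smash_eltZ.
Qed.

Lemma calH_induced_D : calH_induced calH_D calH_e.
Proof.
move=> u; split; last first.
  move: u; apply: tens_ext => [u v|u v|x h].
  - by rewrite rmorphD linearD.
  - apply: tlift_add; split=> [y y' g|y g g'|r y g].
    + by rewrite mulrDl.
    + by rewrite linearD rmorphD mulrDr.
    + by rewrite linearZ /= rmorphM mulrCA mulrA.
  - by rewrite -[tprod x h]/(smash_elt X x h) calH_proj_elt calH_e_elt smash_counitE.
have tB : balanced (fun a b : rmod (smash_incl X) =>
    rtprod i (calH_proj X c s (d 1%N) a) (calH_proj X c s (d 1%N) b)).
  split=> [a a' b|a b b'|r a b].
  - by rewrite rmorphD rtprodDl.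
  - by rewrite rmorphD rtprodDr.
  - have e (x : smash X) : r *: (x : rmod (smash_incl X)) = smash_incl X r * x :> smash X by [].
    by rewrite !e !rmorphM rtprodZl rtprodZr.
move: u; apply: tens_ext => [u v|u v|x h].
- by rewrite rmorphD linearD.
- by rewrite smash_comul_add /tmap tlift_add.
rewrite -[tprod x h]/(smash_elt X x h) calH_proj_elt calH_D_elt smash_comulE /tmap.
rewrite (morph_tlift _ _ (tlift_add tB)) /hdelta (morph_tlift _ _ (scalerDr _)).
apply: eq_tlift => h1 h2; rewrite (tliftE _ _ tB) -rtprodZl -calH_proj_elt.
by [].
Qed.

Lemma calH_D_p h : calH_D (p h) = DA h.
Proof. by rewrite -[p h]mul1r -[1]/(i 1) calH_D_elt scale1r. Qed.
Lemma calH_e_p h : calH_e (p h) = j (hcounit h).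
Proof. by rewrite -[p h]mul1r -[1]/(i 1) calH_e_elt mul1r. Qed.

Lemma calH_linear_ext (Z : lmodType R) (F G : rmod i -> Z) : linear F -> linear G ->
  (forall h, F (p h) = G (p h)) -> forall a, F a = G a.
Proof.
move=> FL GL e a.
have add (K : rmod i -> Z) : linear K -> {morph K : u v / u + v}.
  by move=> KL u v; have := KL 1 u v; rewrite !scale1r.
have scl (K : rmod i -> Z) (KL : linear K) x (b : A) : K (i x * b) = x *: K b.
  by have := KL x b 0; rewrite !addr0 (morph_add0 (add K KL)) addr0.
by apply: (calH_ext (add F FL) (add G GL)) => x h; rewrite !scl // e.
Qed.

Lemma tswap_linear : linear (@tswap R (rmod i) (rmod i)).
Proof. by move=> r u v; rewrite tswapD tswapZ. Qed.

Lemma calH_cocomm : cocommutative calH_D.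
Proof.
apply: calH_linear_ext => [r u v|r u v|h].
- by rewrite linearP tswap_linear.
- by rewrite linearP.
- by rewrite calH_D_p (hdelta_sym N_gt1 q_prim P Xc tt' Xt).
Qed.

Lemma tmapZ (M N0 M' N' : lmodType R) (f : {linear M -> M'}) (g : {linear N0 -> N'}) r u :
  tmap f g (r *: u) = r *: tmap f g u.
Proof.
by apply: tliftZ; [exact: tmap_bal | move=> m n; rewrite linearZ tprodZl].
Qed.
Lemma tmapD (M N0 M' N' : lmodType R) (f : {linear M -> M'}) (g : {linear N0 -> N'}) :
  {morph tmap f g : u v / u + v}.
Proof. exact: tlift_add (tmap_bal f g). Qed.
Lemma tmapE (M N0 M' N' : lmodType R) (f : {linear M -> M'}) (g : {linear N0 -> N'}) m n :
  tmap f g (tprod m n) = tprod (f m) (g n).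
Proof. exact: tliftE (tmap_bal f g). Qed.
Lemma tassocD (M N0 Q : lmodType R) : {morph @tassoc R M N0 Q : u v / u + v}.
Proof. exact: tlift_add (@tassoc_bal R M N0 Q). Qed.
Lemma tassocE (M N0 Q : lmodType R) (m : M) (n : N0) (x : Q) :
  tassoc (tprod (tprod m n) x) = tprod m (tprod n x).
Proof. by rewrite /tassoc (tliftE _ _ (tassoc_bal _ _ _)) (tliftE _ _ (tassoc_bal1 _ _ _)). Qed.
Lemma tassocZ (M N0 Q : lmodType R) r (u : tens (tens M N0) Q) :
  tassoc (r *: u) = r *: tassoc u.
Proof.
move: u; apply: tens_ext => [u v|u v|w x].
- by rewrite scalerDr tassocD.
- by rewrite tassocD scalerDr.
move: w; apply: tens_ext => [u v|u v|m n].
- by rewrite tprodDl scalerDr tassocD.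
- by rewrite tprodDl tassocD scalerDr.
by rewrite -!tprodZl !tassocE tprodZl.
Qed.

Lemma calH_coassoc : coassociative calH_D.
Proof.
apply: calH_linear_ext => [r u v|r u v|h].
- by rewrite linearP (tmapD calH_D idfun) (tmapZ calH_D idfun) tassocD tassocZ.
- by rewrite linearP (tmapD idfun calH_D) (tmapZ idfun calH_D).
rewrite calH_D_p /hdelta.
rewrite (morph_tlift _ _ (tmapD idfun calH_D)) (morph_tlift _ _ (tmapD calH_D idfun)).
rewrite (morph_tlift _ _ (@tassocD _ _ _)).
pose F (a b x : H) : tens (rmod i) AA := tprod (p a : rmod i) (rtprod i (p b) (p x)).
transitivity (tlift (fun a b => tlift (fun a1 a2 => F a1 a2 b) (hcomul a)) (hcomul h)).
  apply: eq_tlift => a b; rewrite (tmapE calH_D idfun) calH_D_p.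
  rewrite (morph_tlift (F := fun z : AA => tassoc (tprod z (p b : rmod i)))).
    by apply: eq_tlift => a1 a2; rewrite tassocE.
  by move=> z w; rewrite tprodDl tassocD.
rewrite -(coassoc_lift (F := F) (@hcomulA _ H)).
- apply: eq_tlift => a b; rewrite (tmapE idfun calH_D) calH_D_p.
  by rewrite /hdelta (morph_tlift _ _ (tprodDr (p a : rmod i))).
- move=> a; rewrite /F; split=> [b b' x|b x x'|r b x].
  + by rewrite hprojD rtprodDl tprodDr.
  + by rewrite hprojD rtprodDr tprodDr.
  + by rewrite !hprojZ rtprodZl rtprodZr.
- move=> x; rewrite /F; split=> [a a' b|a b b'|r a b].
  + by rewrite hprojD; apply: tprodDl.
  + by rewrite hprojD rtprodDl tprodDr.
  + rewrite !hprojZ rtprodZl tprodZr.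
    exact: (tprodZl (j r) (p a : rmod i)).
Qed.

Lemma calH_counital : counital calH_D calH_e.
Proof.
have B1 : balanced (fun a b : rmod i => calH_e a *: b).
  split=> [a a' b|a b b'|r a b].
  - by rewrite linearD scalerDl.
  - by rewrite scalerDr.
  - by rewrite linearZ scalerA mulrC -scalerA.
have B2 : balanced (fun a b : rmod i => calH_e b *: a).
  split=> [a a' b|a b b'|r a b].
  - by rewrite scalerDr.
  - by rewrite linearD scalerDl.
  - have -> : calH_e (r *: b) = r * calH_e b by rewrite linearZ.
    by rewrite scalerA mulrC.
move=> a; split; move: a; apply: calH_linear_ext => //.
- move=> r a b; rewrite linearP (tlift_add B1) (tliftZ _ B1) // => u v.
  by rewrite linearZ scalerA.
- move=> h; rewrite calH_D_p /hdelta (morph_tlift _ _ (tlift_add B1)).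
  rewrite -[in RHS](hcounitP h).1 (morph_tlift _ _ (hprojD X c s (d 1%N))).
  by apply: eq_tlift => g g'; rewrite (tliftE _ _ B1) calH_e_p hprojZ.
- move=> r a b; rewrite linearP (tlift_add B2) (tliftZ _ B2) // => u v.
  by rewrite !scalerA mulrC.
- move=> h; rewrite calH_D_p /hdelta (morph_tlift _ _ (tlift_add B2)).
  rewrite -[in RHS](hcounitP h).2 (morph_tlift _ _ (hprojD X c s (d 1%N))).
  by apply: eq_tlift => g g'; rewrite (tliftE _ _ B2) calH_e_p hprojZ.
Qed.

Lemma calH_takeuchi (a : rmod i) : takeuchi (calH_D a).
Proof.
move=> l e x.
have h : tmul (i x) 1 (calH_D a) = tmul 1 (i x) (calH_D a).
  apply: (calH_linear_ext (F := fun a => tmul (i x) 1 (calH_D a))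
    (G := fun a => tmul 1 (i x) (calH_D a))) => [r u v|r u v|g].
  - by rewrite linearP tmulD tmulZ.
  - by rewrite linearP tmulD tmulZ.
  - by rewrite calH_D_p hdelta_takeuchi.
have tE (u v : A) : tmul u v (tsum (l : seq (rmod i * rmod i))) =
    \sum_(y <- l) rtprod i (y.1 * u) (y.2 * v).
  by apply: tlift_tsum; apply: bal_tmul.
move: h; rewrite e !tE /tsum !big_map /= => h.
under eq_bigr => y _ do rewrite -[y.2]mulr1.
by rewrite [LHS]h; apply: eq_bigr => y _; rewrite mulr1.
Qed.

Lemma calH_comulM (a b : A) (l l' : seq (A * A)) :
  calH_D a = tsum (l : seq (rmod i * rmod i)) ->
  calH_D b = tsum (l' : seq (rmod i * rmod i)) ->
  calH_D (a * b) = tsum (cwprod l l' : seq (rmod i * rmod i)).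
Proof.
move=> e e'; rewrite calH_D_mul e' {1}/tsum.
rewrite (big_morph _ (cactDr hact_tens_semilinear a) (morph_add0 (cactDr hact_tens_semilinear a))).
rewrite /tsum big_allpairs_dep [RHS]exchange_big /=; apply: eq_bigr => x _.
by rewrite cact2_tprod e [LHS](tlift_tsum _ (bal_tmul _ _)).
Qed.

(** Scalars of k commute with h because H acts on them through the counit. *)
Lemma calH_alg x (a : A) : i (j x) * a = a * i (j x).
Proof.
move: a; apply: calH_ext => [a b|a b|y h]; rewrite ?mulrDl ?mulrDr //.
rewrite mulrA -rmorphM mulrC rmorphM -!mulrA; congr (_ * _).
rewrite hproj_incl.
have B : balanced (fun a b : H => hcounit a *: b).
  split=> [a a' b|a b b'|r a b].
  - by rewrite linearD scalerDl.
  - by rewrite scalerDr.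
  - by rewrite linearZ /= scalerA mulrC -scalerA.
rewrite -[in LHS](hcounitP h).1 (morph_tlift _ _ (hprojD X c s (d 1%N))).
rewrite (morph_tlift _ _ (mulrDr (i (j x)))); apply: eq_tlift => a b.
rewrite hprojZ mulrA -rmorphM; congr (i _ * _).
by rewrite -[in RHS](mulr1 (j x)) hactZr hact_unit.
Qed.

End Bialgebra.

(** * Freeness *)

Section Freeness.
Variables (k : fieldType) (q : k) (N : nat).
Hypotheses (N_gt1 : (1 < N)%N) (q_prim : N.-primitive_root q).
Variables (R : comNzRingType) (j : {rmorphism k -> R}).
Variables (H : hopfAlgebra k) (X : moduleAlgebra j H).
Variables (s : H) (d : nat -> H) (P : qdiff_hopf q N s d).
Variables (c : R) (Xc : forall x, X (d 1%N) x = c * (X s x - x)).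
Variables (t t' : R) (tt' : t * t' = 1) (Xt : X s t = j q * t).

Local Notation A := (calH X c s (d 1%N)).
Local Notation i := (calH_incl X c s (d 1%N)).
Local Notation p := (hproj X c s (d 1%N)).
Local Notation AA := (tens (rmod i) (rmod i)).
Local Notation DA := (hdelta X s d c).

Section Functional.
Variables (m : nat) (l : {linear H -> GRing.regular k}).
Hypothesis lE : forall a b, l (s ^+ a * d b) = (b == m * N)%N%:R.
Hypothesis ld1 : forall g h, l (g * d 1%N * h) = 0.
Hypothesis ls : forall g h, l (g * (s - 1) * h) = 0.

(** The R-linear extension of the coordinate [l], to be pushed down to calH. *)
Definition smash_fun (u : smash X) : R := tlift (fun (x : rmod j) h => (x : R) * j (l h)) u.

Lemma smash_fun_bal : balanced (fun (x : rmod j) h => (x : R) * j (l h)).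
Proof.
split=> [y y' g|y g g'|r y g].
- by rewrite mulrDl.
- by rewrite linearD rmorphD mulrDr.
- by rewrite linearZ /= rmorphM mulrCA mulrA.
Qed.
Lemma smash_funD : {morph smash_fun : u v / u + v}.
Proof. exact: tlift_add smash_fun_bal. Qed.
Lemma smash_funE x h : smash_fun (smash_elt X x h) = x * j (l h).
Proof. exact: tliftE smash_fun_bal. Qed.

Local Notation e0 := (smash_elt X 1 (d 1%N) - smash_incl X c * (smash_elt X 1 s - 1)).

(** Moving y to the left of the relation produces the extra terms d_1(y) # g and c (s(y) - y) # g,
    which cancel by [Xc]. So every multiple of the relation is an R-combination of terms containing
    d_1 or s - 1 as a factor in H, and these are killed by [l]. *)
Lemma rel_mul_elt y g : e0 * smash_elt X y g =
  smash_elt X (X s y) (d 1%N * g) - smash_elt X (c * X s y) ((s - 1) * g).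
Proof.
have e1 : smash_elt X 1 (d 1%N) * smash_elt X y g =
    smash_elt X (X (d 1%N) y) g + smash_elt X (X s y) (d 1%N * g).
  rewrite [LHS]smash_mulE (qh_comul_d P) !big_ord_recr big_ord0 /= add0r.
  rewrite !(qh_d0 P) expr0 expr1 mul1r mulr1 (tlift_add (balX _ _ _ _)).
  by rewrite !(tliftE _ _ (balX _ _ _ _)) !mul1r.
have e2 : smash_elt X 1 s * smash_elt X y g = smash_elt X (X s y) (s * g).
  by rewrite [LHS]smash_mulE (qh_comul_s P) (tliftE _ _ (balX _ _ _ _)) mul1r.
have sN x h : smash_elt X x (- h) = - smash_elt X x h by apply: tprodNr.
have sN' x h : smash_elt X (- x) h = - smash_elt X x h by apply: (tprodNl (x : rmod j)).
rewrite mulrBl -mulrA mulrBl e1 e2 mul1r mulrBr !smash_eltM1 Xc.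
rewrite mulrBr mulrBl mul1r smash_eltDl smash_eltDr sN sN' !opprB.
by rewrite addrAC addrA subrK addrC.
Qed.

Lemma smash_fun_ideal u v : smash_fun (u * e0 * v) = 0.
Proof.
move: v; apply: (tens_ext (G := fun=> 0)) => [v w|v w|y g].
- by rewrite mulrDr smash_funD.
- by rewrite addr0.
rewrite -[tprod y g]/(smash_elt X y g) -mulrA rel_mul_elt.
move: u; apply: (tens_ext (G := fun=> 0)) => [v w|v w|x h].
- by rewrite mulrDl smash_funD.
- by rewrite addr0.
rewrite -[tprod x h]/(smash_elt X x h) mulrBr smash_funD (morph_addN smash_funD).
rewrite ![smash_elt X x h * _]smash_mulE !(morph_tlift _ _ smash_funD).
rewrite [X in X - _](eq_tlift (g := fun _ _ => 0)) => [|a b]; last first.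
  by rewrite smash_funE mulrA ld1 rmorph0 mulr0.
rewrite [X in _ - X](eq_tlift (g := fun _ _ => 0)) => [|a b]; last first.
  by rewrite smash_funE mulrA ls rmorph0 mulr0.
by rewrite subrr.
Qed.

Definition calH_fun (a : A) : R := smash_fun (repr a).

Lemma calH_fun_proj u : calH_fun (calH_proj X c s (d 1%N) u) = smash_fun u.
Proof. by apply: quot_repr; [exact: smash_funD | exact: smash_fun_ideal]. Qed.

Lemma calH_funE x h : calH_fun (i x * p h) = x * j (l h).
Proof. by rewrite -calH_proj_elt calH_fun_proj smash_funE. Qed.

Lemma calH_funD : {morph calH_fun : a b / a + b}.
Proof.
move=> a b; have [u ->] := quot_proj_surj a; have [w ->] := quot_proj_surj b.
by rewrite -[quot_proj _ u + _](rmorphD (calH_proj X c s (d 1%N))) !calH_fun_proj smash_funD.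
Qed.

Lemma calH_funZ x a : calH_fun (i x * a) = x * calH_fun a.
Proof.
move: a; apply: calH_ext => [a b|a b|y h].
- by rewrite mulrDr calH_funD.
- by rewrite calH_funD mulrDr.
- by rewrite mulrA -rmorphM !calH_funE mulrA.
Qed.

(* On the elements s ^ a * d (n * N), n <= m, the functionals a |-> calH_fun (a y)
   see only the level n = m, which gives linear independence by descent. *)
Lemma calH_fun_top a n y : (n <= m)%N ->
  calH_fun (p (s ^+ a * d (n * N)%N) * i y) = if n == m then X (s ^+ a) y else 0.
Proof.
move=> nm.
have E h : calH_fun (p h * i y) = tlift (fun g g' => X g y * j (l g')) (hcomul h).
  rewrite hproj_incl (morph_tlift _ _ calH_funD).
  by apply: eq_tlift => g g'; rewrite calH_funE.
rewrite E.
have N0 : (0 < N)%N := ltnW N_gt1.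
have B : balanced (fun g g' : H => X g y * j (l g')).
  split=> [g g' h|g h h'|r g h].
  - by rewrite hactDl mulrDl.
  - by rewrite linearD rmorphD mulrDr.
  - by rewrite hactZl linearZ /= rmorphM mulrCA mulrA.
have -> : hcomul (s ^+ a * d (n * N)%N) =
    \sum_(r < (n * N).+1) tprod (s ^+ a * (s ^+ r * d (n * N - r)%N)) (s ^+ a * d r).
  elim: a => [|a IH].
    by rewrite mul1r (qh_comul_d P); apply: eq_bigr => r _; rewrite !mul1r.
  have es : hcomul s = tsum [:: (s, s)] by rewrite (qh_comul_s P) /tsum big_seq1.
  have e : hcomul (s ^+ a * d (n * N)%N) =
      tsum [seq (s ^+ a * (s ^+ r * d (n * N - r)%N), s ^+ a * d r) | r : 'I_(n * N).+1 <- index_enum 'I_(n * N).+1].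
    by rewrite IH /tsum big_map.
  rewrite exprS -mulrA (hcomulM es e) /tsum big_allpairs_dep big_seq1 big_map.
  by apply: eq_bigr => r _; rewrite /= !mulrA.
rewrite (big_morph _ (tlift_add B) (tlift0 B)).
under eq_bigr => r _ do rewrite (tliftE _ _ B) lE.
(* For n = m only r = n * N survives; the left leg is then s ^+ a times a power of s ^+ N, that is,
   s ^+ a. For n < m every r <= n * N stays below m * N. *)
case: eqP nm => [-> _|ne nm].
  rewrite big_ord_recr /= eqxx big1 ?add0r => [|r _]; last first.
    by rewrite ltn_eqF // rmorph0 mulr0.
  rewrite rmorph1 mulr1 subnn (qh_d0 P) mulr1 mulnC exprM (qh_order P) expr1n.
  by rewrite mulr1.
rewrite big1 // => r _; rewrite ltn_eqF ?rmorph0 ?mulr0 //.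
apply: leq_ltn_trans (leq_ord r) _.
by rewrite ltn_pmul2r // ltn_neqAle nm andbT; apply/eqP.
Qed.
End Functional.

Definition calH_vec (a : 'I_N) (n : nat) : rmod i := p (s ^+ a * d (n * N)%N).

Lemma calH_vec_free n (x : 'I_N -> 'I_n -> R) :
  \sum_(a < N) \sum_(b < n) x a b *: calH_vec a b = 0 -> forall a b, x a b = 0.
Proof.
elim: n x => [|n IH] x e a b; first by case: b.
have [l [lE l1 l2]] := lambda_exists N_gt1 q_prim P n.
have FD := calH_funD l1 l2.
(* Multiply the relation by [i y] on the right and apply the functional of the top level: what
   remains is \sum_a x_a s^a(y) = 0 for all y, the hypothesis of [dedekind]. *)
have top a' : x a' ord_max = 0.
  move: a'; apply: (dedekind q_prim P tt' Xt) => y.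
  have := congr1 (fun z : A => calH_fun l (z * i y)) e.
  rewrite mul0r (morph_add0 FD) mulr_suml (big_morph _ FD (morph_add0 FD)) => e'.
  rewrite -[RHS]e'; apply: eq_bigr => a' _.
  rewrite mulr_suml (big_morph _ FD (morph_add0 FD)) big_ord_recr /=.
  have E (r : R) (z : rmod i) : r *: z = i r * z :> A by [].
  rewrite E -mulrA (calH_funZ l1 l2) (calH_fun_top lE l1 l2) // eqxx.
  rewrite big1 ?add0r // => r _.
  rewrite E -mulrA (calH_funZ l1 l2) (calH_fun_top lE l1 l2) ?(ltnW (ltn_ord r)) //.
  by rewrite ltn_eqF // mulr0.
case: (unliftP ord_max b) => [b' ->|->]; last exact: top.
have wl (r : 'I_n) : widen_ord (leqnSn n) r = lift ord_max r.
  by apply: val_inj; rewrite /= /bump leqNgt ltn_ord.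
apply: (IH (fun a r => x a (lift ord_max r))); rewrite -[RHS]e.
apply: eq_bigr => a' _; rewrite big_ord_recr /= top scale0r addr0.
by apply: eq_bigr => r _; rewrite -wl.
Qed.

Definition spanned (a : rmod i) := exists n (x : 'I_N -> 'I_n -> R),
  a = \sum_(b < N) \sum_(m < n) x b m *: calH_vec b m.

Lemma spannedD a a' : spanned a -> spanned a' -> spanned (a + a').
Proof.
pose ext n (x : 'I_N -> 'I_n -> R) b m := if insub m is Some m' then x b m' else 0.
have extE n (x : 'I_N -> 'I_n -> R) n' : (n <= n')%N ->
    \sum_(b < N) \sum_(m < n) x b m *: calH_vec b m =
    \sum_(b < N) \sum_(m < n') ext n x b m *: calH_vec b m.
  move=> nn; apply: eq_bigr => b _.
  rewrite (eq_bigr (fun m : 'I_n => ext n x b m *: calH_vec b m)) => [|m _]; last first.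
    by rewrite /ext valK.
  rewrite (big_ord_widen n' (fun m => ext n x b m *: calH_vec b m)) // big_mkcond.
  apply: eq_bigr => m _; case: ltnP => // nm.
  by rewrite /ext insubF ?scale0r // ltnNge nm.
move=> [n [x ->]] [n' [x' ->]].
exists (maxn n n'), (fun b m => ext n x b m + ext n' x' b m).
rewrite (extE n x (maxn n n')) ?leq_maxl // (extE n' x' (maxn n n')) ?leq_maxr //.
rewrite -big_split; apply: eq_bigr => b _; rewrite -big_split; apply: eq_bigr => m _.
by rewrite scalerDl.
Qed.

Lemma spannedZ r a : spanned a -> spanned (r *: a).
Proof.
move=> [n [x ->]]; exists n, (fun b m => r * x b m).
rewrite scaler_sumr; apply: eq_bigr => b _; rewrite scaler_sumr.
by apply: eq_bigr => m _; rewrite scalerA.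
Qed.

Lemma spanned_sum I (l : seq I) (f : I -> rmod i) :
  (forall x, spanned (f x)) -> spanned (\sum_(x <- l) f x).
Proof.
move=> h; elim: l => [|x l IH]; rewrite ?big_nil ?big_cons; last exact: spannedD.
exists 0%N, (fun _ _ => 0); rewrite big1 // => b _; exact: big_ord0.
Qed.

Lemma spanned_vec a n : spanned (p (s ^+ a * d (n * N)%N)).
Proof.
rewrite (sX_mod P); have aN := ltn_pmod a (ltnW N_gt1).
exists n.+1, (fun b m => ((b == Ordinal aN) && (m == ord_max))%:R).
by rewrite (sum_delta (fun (b : 'I_N) (m : 'I_n.+1) => calH_vec b m)).
Qed.

Lemma calH_spanned a : spanned a.
Proof.
have [l ->] := calH_sum a; apply: spanned_sum => -[r h] /=; apply: spannedZ.
have pD := hprojD X c s (d 1%N).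
have [n [x ->]] := qh_span P h.
rewrite (big_morph _ pD (morph_add0 pD)); apply: spanned_sum => a0.
rewrite (big_morph _ pD (morph_add0 pD)); apply: spanned_sum => b.
rewrite hprojZ; apply: spannedZ.
(* The remainder part of d_b is absorbed into powers of s, which leaves the factor d_(mN) untouched
   on the right. *)
rewrite (d_divn N_gt1 q_prim P b) mulrA hprojM.
have [y [-> _]] := rep_sXd N_gt1 q_prim P Xc a0 (ltn_pmod b (ltnW N_gt1)).
rewrite mulr_suml; apply: spanned_sum => e.
by rewrite -mulrA; apply: spannedZ; rewrite -hprojM; apply: spanned_vec.
Qed.

Lemma calH_basis : nat_basis calH_vec.
Proof. by split; [exact: calH_spanned | exact: calH_vec_free]. Qed.

Lemma calH_xR_bialgebra : xR_bialgebra j (calH_D N_gt1 q_prim P Xc tt' Xt) (calH_e Xc).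
Proof.
split.
- exact: calH_alg.
- exact: nat_basis_projective calH_basis.
- exact: calH_coassoc.
- exact: calH_counital.
- exact: calH_takeuchi.
- exact: (cact1 (hact_tens_semilinear N_gt1 q_prim P Xc tt' Xt)).
- exact: calH_comulM.
- exact: (cact1 (hact_semilinear Xc)).
(* The counit is a |-> a . 1, so both sides are a . (b . 1). *)
- move=> a b; have S := hact_semilinear Xc.
  have e1 (x y : A) : actR (x * y) 1 = actR x (actR y 1) by apply: (cactM S).
  have e2 y : actR (i y) 1 = y by rewrite [LHS](cact_incl S) [LHS]mulr1.
  by rewrite -[LHS]/(actR (a * b) 1) -[RHS]/(actR (a * i (actR b 1)) 1) !e1 e2.
Qed.
End Freeness.

(** * The symmetric tensor category of modules *)

Section Linear.
Variables (A : pzRingType) (M N : lmodType A).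

Definition mklin (f : M -> N) (fL : linear f) : {linear M -> N} :=
  HB.pack f (GRing.isLinear.Build A M N *:%R f fL).

Lemma mklinE f (fL : linear f) x : mklin fL x = f x.
Proof. by []. Qed.

Lemma can_linear (f : {linear M -> N}) (g : N -> M) :
  cancel f g -> cancel g f -> linear g.
Proof. by move=> fK gK r x y; apply: (can_inj fK); rewrite linearP !gK. Qed.
End Linear.

Section TensorCategory.
Variables (k : pzRingType) (R : comPzRingType) (A : pzRingType).
Variables (j : {rmorphism k -> R}) (i : {rmorphism R -> A}).
Variables (D : {linear rmod i -> tens (rmod i) (rmod i)}).
Variables (e : {linear rmod i -> GRing.regular R}).
Variables (B : xR_bialgebra j D e) (Dsym : cocommutative D).

Local Notation "M *t N" := (modtens B M N) (at level 40).
Local Notation "m *e n" := (modtens_elt B m n) (at level 40).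

(** [balanced] for the modules restricted along i, stated without casts to [restr i M]. *)
Definition mbal (M N : lmodType A) (Z : zmodType) (f : M -> N -> Z) : Prop :=
  [/\ forall m m' n, f (m + m') n = f m n + f m' n,
      forall m n n', f m (n + n') = f m n + f m n'
    & forall r m n, f (i r *: m) n = f m (i r *: n)].

Lemma mbal_balanced (M N : lmodType A) (Z : zmodType) (f : M -> N -> Z) :
  mbal f -> balanced (f : restr i M -> restr i N -> Z).
Proof. by case=> fDl fDr fZ; split. Qed.

Definition mlift (M N : lmodType A) (Z : zmodType) (f : M -> N -> Z) (u : M *t N) : Z :=
  tlift (f : restr i M -> restr i N -> Z) u.

Lemma mliftE (M N : lmodType A) (Z : zmodType) (f : M -> N -> Z) m n :
  mbal f -> mlift f (m *e n) = f m n.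
Proof. by move=> /mbal_balanced fB; apply: tliftE. Qed.
Lemma mliftD (M N : lmodType A) (Z : zmodType) (f : M -> N -> Z) :
  mbal f -> {morph mlift f : u v / u + v}.
Proof. by move=> /mbal_balanced fB; apply: tlift_add. Qed.

Lemma modtens_ext (M N : lmodType A) (Z : zmodType) (F G : M *t N -> Z) :
  {morph F : u v / u + v} -> {morph G : u v / u + v} ->
  (forall m n, F (m *e n) = G (m *e n)) -> forall u, F u = G u.
Proof. by move=> FD GD h u; apply: tens_ext u. Qed.

Lemma eltDl (M N : lmodType A) (m m' : M) (n : N) : (m + m') *e n = m *e n + m' *e n.
Proof. exact: tprodDl. Qed.
Lemma eltDr (M N : lmodType A) (m : M) (n n' : N) : m *e (n + n') = m *e n + m *e n'.
Proof. exact: tprodDr. Qed.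
Lemma eltZ (M N : lmodType A) r (m : M) (n : N) : (i r *: m) *e n = m *e (i r *: n).
Proof. by have [_ _ h] := tprod_bal (restr i M) (restr i N); apply: (h r m n). Qed.
Lemma elt_mbal (M N : lmodType A) : mbal (fun (m : M) (n : N) => m *e n).
Proof. by split; [exact: eltDl | exact: eltDr | exact: eltZ]. Qed.

Lemma modtens_scaleE (M N : lmodType A) (a : A) (m : M) (n : N) : a *: (m *e n) =
  tlift (fun a1 a2 : rmod i => ((a1 : A) *: m) *e ((a2 : A) *: n)) (D a).
Proof. exact: modtens_actE. Qed.

Lemma act_balanced (M N : lmodType A) (Z : zmodType) (f : M -> N -> Z) m n : mbal f ->
  balanced (fun a1 a2 : rmod i => f ((a1 : A) *: m) ((a2 : A) *: n)).
Proof.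
case=> fDl fDr fZ; split=> [a a' b|a b b'|r a b].
- by rewrite scalerDl fDl.
- by rewrite scalerDl fDr.
- have E (x : rmod i) : r *: x = i r * x :> A by [].
  by rewrite !E -!scalerA fZ.
Qed.

Lemma D_incl x : D (i x) = x *: rtprod i 1 1.
Proof.
rewrite -(xb_comul1 B) -linearZ.
by congr (D _); rewrite -[RHS]/(i x * 1) mulr1.
Qed.

(** Because of D (i r) = r (1 (x) 1), restricting the A-module M (x) N along i gives back the
    R-module structure of the tensor product. Iterated tensor products are thus balanced as
    expected. *)
Lemma elt_incl (M N : lmodType A) r (m : M) (n : N) : i r *: (m *e n) = (i r *: m) *e n.
Proof.
have hb := act_balanced m n (elt_mbal M N).
rewrite modtens_scaleE D_incl -tprodZl (tliftE _ _ hb).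
by rewrite -[r *: _]/(i r * 1 : A) mulr1 scale1r.
Qed.

Lemma modtens_linear (M N Q : lmodType A) (F : M *t N -> Q) :
  {morph F : u v / u + v} ->
  (forall a m n, F (a *: (m *e n)) = a *: F (m *e n)) -> linear F.
Proof.
move=> FD FZ a u v; rewrite FD; congr (_ + _).
move: u; apply: modtens_ext => [u w|u w|m n]; last exact: FZ.
- by rewrite scalerDr FD.
- by rewrite FD scalerDr.
Qed.

Lemma modtens_scale_lift (M N : lmodType A) (Z : zmodType) (f : M -> N -> Z) a m n :
  mbal f -> mlift f (a *: (m *e n)) =
  tlift (fun a1 a2 : rmod i => f ((a1 : A) *: m) ((a2 : A) *: n)) (D a).
Proof.
move=> fB; rewrite modtens_scaleE (morph_tlift _ _ (mliftD fB)).
by apply: eq_tlift => a1 a2; rewrite mliftE.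
Qed.

Lemma scale_tlift (M : lmodType A) (m : M) (f : rmod i -> rmod i -> A) u :
  tlift f u *: m = tlift (fun a1 a2 => f a1 a2 *: m) u.
Proof. exact: (morph_tlift _ _ (fun a b => scalerDl m a b)). Qed.

Section Tmor.
Variables (M M' N N' : lmodType A) (f : {linear M -> M'}) (g : {linear N -> N'}).
Definition tmor_fun : M *t N -> M' *t N' := mlift (fun m n => f m *e g n).
Lemma tmor_mbal : mbal (fun m n => f m *e g n).
Proof.
split=> [m m' n|m n n'|r m n].
- by rewrite linearD eltDl.
- by rewrite linearD eltDr.
- by rewrite !linearZ eltZ.
Qed.
Lemma tmor_linear : linear tmor_fun.
Proof.
apply: modtens_linear => [|a m n]; first exact: mliftD tmor_mbal.
rewrite /tmor_fun (modtens_scale_lift _ _ _ tmor_mbal) (mliftE _ _ tmor_mbal).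
by rewrite modtens_scaleE; apply: eq_tlift => a1 a2; rewrite !linearZ.
Qed.
Definition tmor_lin := mklin tmor_linear.
Lemma tmor_elt m n : tmor_lin (m *e n) = f m *e g n.
Proof. exact: mliftE tmor_mbal. Qed.
End Tmor.

Section Assoc.
Variables (M N Q : lmodType A).
Lemma assoc_mbal1 (x : Q) : mbal (fun (m : M) (n : N) => m *e (n *e x)).
Proof.
split=> [m m' n|m n n'|r m n].
- by rewrite eltDl.
- by rewrite eltDl eltDr.
- by rewrite eltZ elt_incl.
Qed.
Definition assoc1 (v : M *t N) (x : Q) : M *t (N *t Q) :=
  mlift (fun m n => m *e (n *e x)) v.
Lemma assoc_mbal : mbal assoc1.
Proof.
split=> [u v x|v x x'|r v x].
- exact: (mliftD (assoc_mbal1 x)).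
- by rewrite /assoc1 /mlift -tliftDf; apply: eq_tlift => m n; rewrite !eltDr.
- move: v; apply: modtens_ext => [u v|u v|m n].
  + by rewrite scalerDr; apply: (mliftD (assoc_mbal1 x)).
  + exact: (mliftD (assoc_mbal1 _)).
  + by rewrite elt_incl /assoc1 !(mliftE _ _ (assoc_mbal1 _)) eltZ elt_incl eltZ.
Qed.
Definition assoc_fun : (M *t N) *t Q -> M *t (N *t Q) := mlift assoc1.
Lemma assoc_fun_elt m n x : assoc_fun ((m *e n) *e x) = m *e (n *e x).
Proof. by rewrite /assoc_fun (mliftE _ _ assoc_mbal) /assoc1 (mliftE _ _ (assoc_mbal1 _)). Qed.

Lemma eltD_r (m : M) : {morph (fun w : N *t Q => m *e w) : u v / u + v}.
Proof. by move=> u v; apply: eltDr. Qed.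
(** Coassociativity is exactly what makes the associativity constraint A-linear. *)
Lemma assoc_linear : linear assoc_fun.
Proof.
have FD : {morph assoc_fun : u v / u + v} := mliftD assoc_mbal.
apply: modtens_linear => // a v x; move: v; apply: modtens_ext => [u v|u v|m n].
- by rewrite eltDl scalerDr FD.
- by rewrite eltDl FD scalerDr.
rewrite assoc_fun_elt /assoc_fun (modtens_scale_lift _ _ _ assoc_mbal) modtens_scaleE.
pose F (a1 a2 a3 : rmod i) : M *t (N *t Q) :=
  ((a1 : A) *: m) *e (((a2 : A) *: n) *e ((a3 : A) *: x)).
transitivity (tlift (fun a1 a2 => tlift (fun b1 b2 => F b1 b2 a2) (D a1)) (D a)).
  apply: eq_tlift => a1 a2; rewrite /assoc1.
  by rewrite (modtens_scale_lift _ _ _ (assoc_mbal1 _)).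
rewrite -(coassoc_lift (xb_coassoc B)).
- apply: eq_tlift => a1 a2; rewrite modtens_scaleE.
  by rewrite (morph_tlift _ _ (eltD_r _)).
- move=> a1; have [hl hr hz] := act_balanced n x (elt_mbal N Q).
  rewrite /F; split=> [b b' c|b c c'|r b c].
  + by rewrite hl eltDr.
  + by rewrite hr eltDr.
  + by rewrite hz.
- by move=> a3; apply: (act_balanced m n (assoc_mbal1 _)).
Qed.
Definition assoc_lin := mklin assoc_linear.
Lemma assoc_elt m n x : assoc_lin ((m *e n) *e x) = m *e (n *e x).
Proof. exact: assoc_fun_elt. Qed.

Lemma assocV_mbal1 (m : M) : mbal (fun (n : N) (x : Q) => (m *e n) *e x).
Proof.
split=> [n n' x|n x x'|r n x].
- by rewrite eltDr eltDl.
- by rewrite eltDr.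
- by rewrite -eltZ -elt_incl eltZ.
Qed.
Definition assocV1 (m : M) (w : N *t Q) : (M *t N) *t Q :=
  mlift (fun n x => (m *e n) *e x) w.
Lemma assocV_mbal : mbal assocV1.
Proof.
split=> [m m' w|m w w'|r m w].
- by rewrite /assocV1 /mlift -tliftDf; apply: eq_tlift => n x; rewrite !eltDl.
- exact: (mliftD (assocV_mbal1 m)).
- move: w; apply: modtens_ext => [u v|u v|n x].
  + exact: (mliftD (assocV_mbal1 _)).
  + by rewrite scalerDr; apply: (mliftD (assocV_mbal1 m)).
  + by rewrite elt_incl /assocV1 !(mliftE _ _ (assocV_mbal1 _)) eltZ.
Qed.
Definition assocV_fun : M *t (N *t Q) -> (M *t N) *t Q := mlift assocV1.
Lemma assocV_fun_elt m n x : assocV_fun (m *e (n *e x)) = (m *e n) *e x.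
Proof. by rewrite /assocV_fun (mliftE _ _ assocV_mbal) /assocV1 (mliftE _ _ (assocV_mbal1 _)). Qed.

Lemma modtens_ext3 (Z : zmodType) (F G : (M *t N) *t Q -> Z) :
  {morph F : u v / u + v} -> {morph G : u v / u + v} ->
  (forall m n x, F ((m *e n) *e x) = G ((m *e n) *e x)) -> forall u, F u = G u.
Proof.
move=> FD GD h; apply: modtens_ext => // v x; move: v; apply: modtens_ext => //.
- by move=> u v; rewrite eltDl FD.
- by move=> u v; rewrite eltDl GD.
Qed.
Lemma modtens_ext3' (Z : zmodType) (F G : M *t (N *t Q) -> Z) :
  {morph F : u v / u + v} -> {morph G : u v / u + v} ->
  (forall m n x, F (m *e (n *e x)) = G (m *e (n *e x))) -> forall u, F u = G u.
Proof.
move=> FD GD h; apply: modtens_ext => // m; apply: modtens_ext => //.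
- by move=> u v; rewrite eltDr FD.
- by move=> u v; rewrite eltDr GD.
Qed.

Lemma assoc_funK : cancel assoc_lin assocV_fun.
Proof.
have VD : {morph assocV_fun : u v / u + v} := mliftD assocV_mbal.
apply: modtens_ext3 => // [u v|m n x]; first by rewrite linearD VD.
by rewrite assoc_elt assocV_fun_elt.
Qed.
Lemma assocV_funK : cancel assocV_fun assoc_lin.
Proof.
have VD : {morph assocV_fun : u v / u + v} := mliftD assocV_mbal.
apply: modtens_ext3' => // [u v|m n x]; first by rewrite VD linearD.
by rewrite assocV_fun_elt assoc_elt.
Qed.
Definition assocV_lin := mklin (can_linear assoc_funK assocV_funK).
Lemma assocV_elt m n x : assocV_lin (m *e (n *e x)) = (m *e n) *e x.
Proof. exact: assocV_fun_elt. Qed.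
End Assoc.

(** The two forms come from i x (x) 1 = 1 (x) i x; the left and the right unit constraint use one
    each. *)
Lemma D_mul_incl (a : A) x :
  D (a * i x) = tlift (fun a1 a2 : rmod i => rtprod i ((a1 : A) * i x) a2) (D a) /\
  D (a * i x) = tlift (fun a1 a2 : rmod i => rtprod i a1 ((a2 : A) * i x)) (D a).
Proof.
have [l el] := tensP (D a).
have e1 : D (i x) = tsum [:: (i x : rmod i, 1 : rmod i)].
  by rewrite D_incl -tprodZl /tsum big_seq1 -[X in tprod X _]/(i x * 1 : A) mulr1.
have e2 : D (i x) = tsum [:: (1 : rmod i, i x : rmod i)].
  by rewrite D_incl -tprodZr /tsum big_seq1 -[X in tprod _ X]/(i x * 1 : A) mulr1.
have E (r : R) (y : rmod i) : r *: y = i r * y :> A by [].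
split.
- rewrite (xb_comulM B el e1) el tlift_tsum.
    rewrite /tsum big_allpairs_dep; apply: eq_bigr => y _.
    by rewrite big_seq1 mulr1.
  split=> [b b' c|b c c'|r b c].
  + by rewrite mulrDl; apply: tprodDl.
  + exact: tprodDr.
  + by rewrite E -mulrA (tprodZl r ((b : A) * i x : rmod i)) tprodZr.
- rewrite (xb_comulM B el e2) el tlift_tsum.
    rewrite /tsum big_allpairs_dep; apply: eq_bigr => y _.
    by rewrite big_seq1 mulr1.
  split=> [b b' c|b c c'|r b c].
  + exact: tprodDl.
  + by rewrite mulrDl; apply: tprodDr.
  + by rewrite E -mulrA (tprodZr r _ ((c : A) * i x : rmod i)) tprodZl.
Qed.

Lemma counit_bal1 : balanced (fun a b : rmod i => e a *: b).
Proof.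
split=> [a a' b|a b b'|r a b].
- by rewrite linearD scalerDl.
- by rewrite scalerDr.
- by rewrite linearZ scalerA mulrC -scalerA.
Qed.
Lemma counit_bal2 : balanced (fun a b : rmod i => e b *: a).
Proof.
split=> [a a' b|a b b'|r a b].
- by rewrite scalerDr.
- by rewrite linearD scalerDl.
- have -> : e (r *: b) = r * e b by rewrite linearZ.
  by rewrite scalerA mulrC.
Qed.

(** The counit axiom at a i(x). This is the A-linearity of the left unit constraint, since a acts on
    x in the unit object by e (a i(x)). *)
Lemma counit_l (a : A) x :
  tlift (fun a1 a2 : rmod i => i (e ((a1 : A) * i x)) * (a2 : A)) (D a) = a * i x.
Proof.
rewrite -[RHS](xb_counital B (a * i x)).1 (D_mul_incl a x).1.
rewrite (morph_tlift _ _ (tlift_add counit_bal1)).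
by apply: eq_tlift => a1 a2; rewrite (tliftE _ _ counit_bal1).
Qed.
Lemma counit_r (a : A) x :
  tlift (fun a1 a2 : rmod i => i (e ((a2 : A) * i x)) * (a1 : A)) (D a) = a * i x.
Proof.
rewrite -[RHS](xb_counital B (a * i x)).2 (D_mul_incl a x).2.
rewrite (morph_tlift _ _ (tlift_add counit_bal2)).
by apply: eq_tlift => a1 a2; rewrite (tliftE _ _ counit_bal2).
Qed.

Lemma modunit_scaleE (a : A) (x : modunit B) : a *: x = e (a * i (x : R)) :> R.
Proof. by []. Qed.

Lemma counit_incl r : e (i r) = r.
Proof.
have E (y : rmod i) : r *: y = i r * y :> A by [].
rewrite -[i r]mulr1; transitivity (r * e (1 : rmod i)); last by rewrite (xb_counit1 B) mulr1.
by rewrite -[LHS]/(e (r *: (1 : rmod i))) linearZ.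
Qed.

Lemma modunit_incl r (x : modunit B) : i r *: x = r * (x : R) :> R.
Proof. by rewrite modunit_scaleE -rmorphM counit_incl. Qed.

Section Unit.
Variable M : lmodType A.

Lemma lunit_mbal : mbal (fun (x : modunit B) (m : M) => i (x : R) *: m).
Proof.
split=> [x y m|x m m'|r x m].
- by rewrite rmorphD scalerDl.
- by rewrite scalerDr.
- by rewrite modunit_incl scalerA -rmorphM mulrC.
Qed.
Definition lunit_fun : modunit B *t M -> M := mlift (fun (x : modunit B) (m : M) => i (x : R) *: m).
Lemma lunit_linear : linear lunit_fun.
Proof.
apply: modtens_linear => [|a x m]; first exact: mliftD lunit_mbal.
rewrite /lunit_fun (modtens_scale_lift _ _ _ lunit_mbal) (mliftE _ _ lunit_mbal).
rewrite scalerA -counit_l scale_tlift; apply: eq_tlift => a1 a2.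
by rewrite modunit_scaleE scalerA.
Qed.
Definition lunit_lin := mklin lunit_linear.
Lemma lunit_elt (x : modunit B) m : lunit_lin (x *e m) = i (x : R) *: m.
Proof. exact: mliftE lunit_mbal. Qed.
Definition lunitV_fun (m : M) : modunit B *t M := (1 : modunit B) *e m.
Lemma incl_one (x : modunit B) : i (x : R) *: (1 : modunit B) = x.
Proof. by apply: etrans (modunit_incl _ _) _; apply: mulr1. Qed.
Lemma lunit_funK : cancel lunit_lin lunitV_fun.
Proof.
apply: modtens_ext => [u v|//|x m]; first by rewrite linearD /lunitV_fun eltDr.
by rewrite lunit_elt /lunitV_fun -eltZ incl_one.
Qed.
Lemma lunitV_funK : cancel lunitV_fun lunit_lin.
Proof. by move=> m; rewrite /lunitV_fun lunit_elt rmorph1 scale1r. Qed.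
Definition lunitV_lin := mklin (can_linear lunit_funK lunitV_funK).

Lemma runit_mbal : mbal (fun (m : M) (x : modunit B) => i (x : R) *: m).
Proof.
split=> [m m' x|m x y|r m x].
- by rewrite scalerDr.
- by rewrite rmorphD scalerDl.
- by rewrite modunit_incl scalerA -rmorphM mulrC.
Qed.
Definition runit_fun : M *t modunit B -> M := mlift (fun (m : M) (x : modunit B) => i (x : R) *: m).
Lemma runit_linear : linear runit_fun.
Proof.
apply: modtens_linear => [|a m x]; first exact: mliftD runit_mbal.
rewrite /runit_fun (modtens_scale_lift _ _ _ runit_mbal) (mliftE _ _ runit_mbal).
rewrite scalerA -counit_r scale_tlift; apply: eq_tlift => a1 a2.
by rewrite modunit_scaleE scalerA.
Qed.
Definition runit_lin := mklin runit_linear.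
Lemma runit_elt (x : modunit B) m : runit_lin (m *e x) = i (x : R) *: m.
Proof. exact: mliftE runit_mbal. Qed.
Definition runitV_fun (m : M) : M *t modunit B := m *e (1 : modunit B).
Lemma runit_funK : cancel runit_lin runitV_fun.
Proof.
apply: modtens_ext => [u v|//|m x]; first by rewrite linearD /runitV_fun eltDl.
by rewrite runit_elt /runitV_fun eltZ incl_one.
Qed.
Lemma runitV_funK : cancel runitV_fun runit_lin.
Proof. by move=> m; rewrite /runitV_fun runit_elt rmorph1 scale1r. Qed.
Definition runitV_lin := mklin (can_linear runit_funK runitV_funK).
End Unit.

Lemma cocomm_tlift (Z : zmodType) (G : rmod i -> rmod i -> Z) a : balanced G ->
  tlift G (D a) = tlift (fun a1 a2 => G a2 a1) (D a).
Proof.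
move=> GB; rewrite -{1}(Dsym a) /tswap (morph_tlift _ _ (tlift_add GB)).
by apply: eq_tlift => a1 a2; rewrite (tliftE _ _ GB).
Qed.

Section Braid.
Variables M N : lmodType A.
Lemma braid_mbal : mbal (fun (m : M) (n : N) => n *e m).
Proof.
split=> [m m' n|m n n'|r m n]; [exact: eltDr|exact: eltDl|exact/esym/eltZ].
Qed.
Definition braid_fun : M *t N -> N *t M := mlift (fun m n => n *e m).
(** The flip is A-linear because D is cocommutative. *)
Lemma braid_linear : linear braid_fun.
Proof.
apply: modtens_linear => [|a m n]; first exact: mliftD braid_mbal.
rewrite /braid_fun (modtens_scale_lift _ _ _ braid_mbal) (mliftE _ _ braid_mbal).
rewrite modtens_scaleE [RHS]cocomm_tlift //; exact: act_balanced (elt_mbal N M).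
Qed.
Definition braid_lin := mklin braid_linear.
Lemma braid_elt m n : braid_lin (m *e n) = n *e m.
Proof. exact: mliftE braid_mbal. Qed.
End Braid.

Definition mod_tensor_data : @tensor_data (modcat A) (modtens B) (modunit B) :=
  @TensorData (modcat A) (modtens B) (modunit B)
    (fun M M' N N' f g => tmor_lin f g) assoc_lin assocV_lin
    lunit_lin lunitV_lin runit_lin runitV_lin braid_lin.

Lemma mod_canonical : canonical_tensor_data mod_tensor_data.
Proof.
split=> *; [exact: tmor_elt | exact: assoc_elt | exact: lunit_elt | exact: runit_elt
  | exact: braid_elt].
Qed.

Lemma linear_compE (M N Q : lmodType A) (g : {linear N -> Q}) (f : {linear M -> N}) x :
  linear_comp g f x = g (f x).
Proof. by []. Qed.
Lemma linear_idE (M : lmodType A) (x : M) : linear_id M x = x.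
Proof. by []. Qed.

Lemma modtens_ext4 (M N Q Q' : lmodType A) (Z : zmodType) (F G : ((M *t N) *t Q) *t Q' -> Z) :
  {morph F : u v / u + v} -> {morph G : u v / u + v} ->
  (forall m n x y, F (((m *e n) *e x) *e y) = G (((m *e n) *e x) *e y)) -> forall u, F u = G u.
Proof.
move=> FD GD h; apply: modtens_ext => // v y; move: v; apply: modtens_ext3 => //.
- by move=> u v; rewrite eltDl FD.
- by move=> u v; rewrite eltDl GD.
Qed.

Local Notation mE := (linear_compE, linear_idE, tmor_elt, assoc_elt, assocV_elt, lunit_elt, runit_elt, braid_elt).

Lemma mod_symmetric : symmetric_tensor_category mod_tensor_data.
Proof.
split; rewrite /mod_tensor_data /=.
- move=> M N; apply: linear_eq; apply: modtens_ext => [u v|//|m n]; first by rewrite linearD.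
  by rewrite !mE.
- move=> M M' M'' N N' N'' f' f g' g; apply: linear_eq; apply: modtens_ext => [u v|u v|m n].
  + by rewrite linearD.
  + by rewrite linearD.
  + by rewrite !mE.
- move=> M M' N N' Q Q' f g h; apply: linear_eq; apply: modtens_ext3 => [u v|u v|m n x].
  + by rewrite linearD.
  + by rewrite linearD.
  + by rewrite !mE.
- move=> M M' f; apply: linear_eq; apply: modtens_ext => [u v|u v|m n].
  + by rewrite linearD.
  + by rewrite linearD.
  + by rewrite !mE linearZ.
- move=> M M' f; apply: linear_eq; apply: modtens_ext => [u v|u v|m n].
  + by rewrite linearD.
  + by rewrite linearD.
  + by rewrite !mE linearZ.
- move=> M M' N N' f g; apply: linear_eq; apply: modtens_ext => [u v|u v|m n].
  + by rewrite linearD.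
  + by rewrite linearD.
  + by rewrite !mE.
- by move=> M N Q; apply: linear_eq => u; apply: assoc_funK.
- by move=> M N Q; apply: linear_eq => u; apply: assocV_funK.
- by move=> M; apply: linear_eq => u; apply: lunit_funK.
- by move=> M; apply: linear_eq => u; apply: lunitV_funK.
- by move=> M; apply: linear_eq => u; apply: runit_funK.
- by move=> M; apply: linear_eq => u; apply: runitV_funK.
- move=> M N; apply: linear_eq; apply: modtens_ext => [u v|//|m n]; first by rewrite linearD.
  by rewrite !mE.
- move=> M N Q W; apply: linear_eq; apply: modtens_ext4 => [u v|u v|m n x y].
  + by rewrite linearD.
  + by rewrite linearD.
  + by rewrite !mE.
- move=> M N; apply: linear_eq; apply: modtens_ext3 => [u v|u v|m x n].
  + by rewrite linearD.
  + by rewrite linearD.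
  + by rewrite !mE eltZ.
- move=> M N Q; apply: linear_eq; apply: modtens_ext3 => [u v|u v|m n x].
  + by rewrite linearD.
  + by rewrite linearD.
  + by rewrite !mE.
Qed.
End TensorCategory.

(** * Duals *)

Section LinearDual.
Variables (R : comPzRingType) (V : lmodType R).

Definition ldual : Type := {linear V -> GRing.regular R}.
HB.instance Definition _ := gen_eqMixin ldual.
HB.instance Definition _ := gen_choiceMixin ldual.

Definition ldual_fun (f : ldual) : V -> R := (f : {linear V -> GRing.regular R}).

Lemma ldualP (f g : ldual) : (forall v, ldual_fun f v = ldual_fun g v) -> f = g.
Proof. exact: (@linear_eq R V (GRing.regular R) f g). Qed.

Lemma ldual_linear (f : ldual) : linear (ldual_fun f : V -> GRing.regular R).
Proof. exact: linearP. Qed.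
Lemma ldual_D (f : ldual) : {morph ldual_fun f : u v / u + v}.
Proof. exact: linearD. Qed.
Lemma ldual_Z (f : ldual) r v : ldual_fun f (r *: v) = r * ldual_fun f v.
Proof. by rewrite /ldual_fun linearZ. Qed.

Definition mkdual (f : V -> R) (fL : linear (f : V -> GRing.regular R)) : ldual := mklin fL.
Lemma mkdualE f fL v : ldual_fun (@mkdual f fL) v = f v.
Proof. by []. Qed.

Fact ldual_zero_linear : linear ((fun=> 0) : V -> GRing.regular R).
Proof. by move=> r u v; rewrite scaler0 addr0. Qed.
Fact ldual_add_linear (f g : ldual) :
  linear ((fun v => ldual_fun f v + ldual_fun g v) : V -> GRing.regular R).
Proof. by move=> r u v; rewrite !ldual_linear scalerDr addrACA. Qed.
Fact ldual_opp_linear (f : ldual) : linear ((fun v => - ldual_fun f v) : V -> GRing.regular R).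
Proof. by move=> r u v; rewrite ldual_linear opprD scalerN. Qed.
Fact ldual_scale_linear (x : R) (f : ldual) :
  linear ((fun v => x * ldual_fun f v) : V -> GRing.regular R).
Proof. by move=> r u v; rewrite ldual_linear mulrDr mulrCA. Qed.

Definition ldual_add f g := mkdual (ldual_add_linear f g).
Definition ldual_opp f := mkdual (ldual_opp_linear f).
Definition ldual_scale x f := mkdual (ldual_scale_linear x f).

Fact ldual_addA : associative ldual_add.
Proof. by move=> f g h; apply: ldualP => v; rewrite !mkdualE addrA. Qed.
Fact ldual_addC : commutative ldual_add.
Proof. by move=> f g; apply: ldualP => v; rewrite !mkdualE addrC. Qed.
Fact ldual_add0 : left_id (mkdual ldual_zero_linear) ldual_add.
Proof. by move=> f; apply: ldualP => v; rewrite !mkdualE add0r. Qed.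
Fact ldual_addN : left_inverse (mkdual ldual_zero_linear) ldual_opp ldual_add.
Proof. by move=> f; apply: ldualP => v; rewrite !mkdualE addNr. Qed.
HB.instance Definition _ :=
  GRing.isZmodule.Build ldual ldual_addA ldual_addC ldual_add0 ldual_addN.

Fact ldual_scaleA x y f : ldual_scale x (ldual_scale y f) = ldual_scale (x * y) f.
Proof. by apply: ldualP => v; rewrite !mkdualE mulrA. Qed.
Fact ldual_scale1 : left_id 1 ldual_scale.
Proof. by move=> f; apply: ldualP => v; rewrite !mkdualE mul1r. Qed.
Fact ldual_scaleDr : right_distributive ldual_scale +%R.
Proof. by move=> x f g; apply: ldualP => v; rewrite !mkdualE mulrDr. Qed.
Fact ldual_scaleDl f : {morph ldual_scale^~ f : x y / x + y}.
Proof. by move=> x y; apply: ldualP => v; rewrite !mkdualE mulrDl. Qed.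
HB.instance Definition _ := GRing.Zmodule_isLmodule.Build R ldual
  ldual_scaleA ldual_scale1 ldual_scaleDr ldual_scaleDl.

Lemma ldual_eval_D v : {morph ldual_fun^~ v : f g / f + g}.
Proof. by []. Qed.
End LinearDual.

(** Projectivity splits the surjection from R^n given by n generators; the coordinates of the
    splitting are the linear forms. *)
Lemma dual_basis (R : comPzRingType) (V : lmodType R) :
  finitely_generated V -> projective V ->
  exists n (v : 'I_n -> V) (f : 'I_n -> ldual V),
    forall u, u = \sum_(l < n) ldual_fun (f l) u *: v l.
Proof.
move=> [n [v vP]] projV; exists n, v.
pose g (x : 'rV[R]_n) := \sum_(l < n) x 0 l *: v l.
have gL : linear g.
  move=> r x y; rewrite /g scaler_sumr -big_split; apply: eq_bigr => l _.
  by rewrite !mxE scalerDl scalerA.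
have gS u : exists x, mklin gL x = u.
  have [c ->] := vP u; exists (\row_l c l).
  by rewrite mklinE /g; apply: eq_bigr => l _; rewrite mxE.
have [h hP] := projV _ _ (mklin gL) (linear_id V) gS.
have fL l : linear ((fun u => h u 0 l) : V -> GRing.regular R).
  by move=> r x y; rewrite linearP !mxE.
exists (fun l => mkdual (fL l)) => u.
by rewrite -{1}[u](hP u) mklinE.
Qed.

Section Dual.
Variables (k : fieldType) (q : k) (N : nat).
Hypotheses (N_gt1 : (1 < N)%N) (q_prim : N.-primitive_root q).
Variables (R : comNzRingType) (j : {rmorphism k -> R}).
Variables (H : hopfAlgebra k) (X : moduleAlgebra j H).
Variables (s : H) (d : nat -> H) (P : qdiff_hopf q N s d).
Variables (c : R) (Xc : forall x, X (d 1%N) x = c * (X s x - x)).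
Variables (t t' : R) (tt' : t * t' = 1) (Xt : X s t = j q * t).

Local Notation A := (calH X c s (d 1%N)).
Local Notation i := (calH_incl X c s (d 1%N)).
Local Notation p := (hproj X c s (d 1%N)).
Local Notation AA := (tens (rmod i) (rmod i)).
Local Notation DA := (hdelta X s d c).

Section Uniqueness.
Variables (M : lmodType A) (Z : zmodType) (F : H -> M -> Z).
Hypotheses (FDl : forall g h m, F (g + h) m = F g m + F h m)
  (FDr : forall h m n, F h (m + n) = F h m + F h n)
  (FZ : forall r h m, F (r *: h) m = F h (i (j r) *: m)).

(* h |-> F h is recovered by convolution with the antipode. *)
Lemma antipode_uniq : (forall h m, tlift (fun a b => F a (p b *: m)) (hcomul h) = 0) ->
  forall h m, F h m = 0.
Proof.
move=> F0 h m; rewrite -{1}(hcounitP h).2.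
rewrite (morph_tlift (F := F^~ m) _ _ (fun g g' => FDl g g' m)).
(* F h m = \sum F h_1 (h_2 S(h_3) m); grouping the first two legs gives the hypothesis, evaluated at
   S(h_3) m. *)
transitivity (tlift (fun a b => tlift (fun b1 b2 => F a (p b1 *: (p (hantipode b2) *: m)))
   (hcomul b)) (hcomul h)).
  apply: eq_tlift => a b; rewrite FZ.
  have -> : i (j (hcounit b)) = p (hcounit b *: 1) by rewrite hprojZ hproj1 mulr1.
  rewrite -(hantipodeP b).2 (morph_tlift _ _ (hprojD X c s (d 1%N))).
  rewrite (morph_tlift _ _ (fun x y : A => scalerDl m x y)) (morph_tlift _ _ (FDr a)).
  by apply: eq_tlift => b1 b2; rewrite hprojM scalerA.
rewrite (coassoc_lift (F := fun a b1 b2 => F a (p b1 *: (p (hantipode b2) *: m))) (@hcomulA _ H)).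
- by rewrite /tlift big1 // => x _; apply: F0.
- move=> a; split=> [b b' x|b x x'|r b x].
  + by rewrite hprojD scalerDl FDr.
  + by rewrite linearD hprojD scalerDl scalerDr FDr.
  + by rewrite linearZ /= !hprojZ calH_alg -!scalerA.
- move=> x; split=> [a a' b|a b b'|r a b].
  + by rewrite FDl.
  + by rewrite hprojD scalerDl FDr.
  + by rewrite FZ hprojZ -scalerA.
Qed.
End Uniqueness.

(** By [hproj_incl_swap] the right side is \sum (h_2 S(h_3) . x) h_1, which the antipode collapses
    to x h. *)
Lemma antipode_incl h x :
  i x * p h = tlift (fun a b => p a * i (X (hantipode b) x)) (hcomul h).
Proof.
transitivity (tlift (fun a b => tlift (fun b1 b2 => i (X (b1 * hantipode b2) x) * p a)
   (hcomul b)) (hcomul h)).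
  rewrite -{1}(hcounitP h).2 (morph_tlift _ _ (hprojD X c s (d 1%N))).
  rewrite (morph_tlift _ _ (mulrDr (i x))); apply: eq_tlift => a b.
  have XD : {morph (fun g => i (X g x) * p a) : g h / g + h}.
    by move=> g g'; rewrite hactDl rmorphD mulrDl.
  rewrite -(morph_tlift (F := fun g => i (X g x) * p a) _ _ XD).
  rewrite (hantipodeP b).2 hactZl hact1 hprojZ mulrA -rmorphM.
  by rewrite [x * _]mulrC.
rewrite (coassoc_lift (F := fun a b1 b2 => i (X (b1 * hantipode b2) x) * p a) (@hcomulA _ H)).
- apply: eq_tlift => a b; rewrite (hproj_incl_swap N_gt1 q_prim P Xc tt' Xt).
  by apply: eq_tlift => a1 a2; rewrite hactM.
- move=> a; split=> [b b' y|b y y'|r b y].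
  + by rewrite mulrDl hactDl rmorphD mulrDl.
  + by rewrite linearD mulrDr hactDl rmorphD mulrDl.
  + by rewrite linearZ /= -scalerAl -scalerAr.
- move=> y; split=> [a a' b|a b b'|r a b].
  + by rewrite hprojD mulrDr.
  + by rewrite mulrDl hactDl rmorphD mulrDl.
  + by rewrite hprojZ -scalerAl hactZl mulrA -rmorphM [X in i X * _]mulrC.
Qed.

Section DualModule.
Variable M : lmodType A.
Local Notation M' := (ldual (restr i M)).
Local Notation S := hantipode.

Definition eval_at (f : M') (m : M) : R := ldual_fun f (m : restr i M).

Lemma eval_at_D f : {morph eval_at f : m n / m + n}.
Proof. by move=> m n; apply: (ldual_D f (m : restr i M) (n : restr i M)). Qed.
Lemma eval_at_Z f x m : eval_at f (i x *: m) = x * eval_at f m.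
Proof. exact: (ldual_Z f x). Qed.

Definition contra_fun (h : H) (f : M') (m : M) : R :=
  tlift (fun a b => X a (eval_at f (p (S b) *: m))) (hcomul h).

Lemma contra_fun_bal f m : balanced (fun a b : H => X a (eval_at f (p (S b) *: m))).
Proof.
split=> [a a' b|a b b'|r a b].
- exact: hactDl.
- by rewrite linearD hprojD scalerDl eval_at_D hactDr.
- by rewrite linearZ /= hprojZ -scalerA eval_at_Z hactZl hactZr.
Qed.

Lemma contra_funDl f m : {morph (fun h => contra_fun h f m) : g h / g + h}.
Proof. by move=> g h; rewrite /contra_fun linearD tlift_add //; apply: contra_fun_bal. Qed.

Lemma contra_funZ r h f m : contra_fun (r *: h) f m = j r * contra_fun h f m.
Proof.
rewrite /contra_fun linearZ /=; have [l ->] := tensP (hcomul h).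
rewrite {1}/tsum scaler_sumr (big_morph _ (tlift_add (contra_fun_bal f m)) (tlift0 (contra_fun_bal f m))).
rewrite (tlift_tsum _ (contra_fun_bal f m)) mulr_sumr; apply: eq_bigr => x _.
by rewrite -tprodZl (tliftE _ _ (contra_fun_bal f m)) hactZl.
Qed.

Lemma contra_funDr h f : {morph contra_fun h f : m n / m + n}.
Proof.
move=> m n; rewrite /contra_fun -tliftDf; apply: eq_tlift => a b.
by rewrite scalerDr eval_at_D hactDr.
Qed.

Lemma contra_funZr r h f m : contra_fun h f (i (j r) *: m) = j r * contra_fun h f m.
Proof.
rewrite /contra_fun (morph_tlift _ _ (mulrDr (j r))); apply: eq_tlift => a b.
by rewrite scalerA -calH_alg -scalerA eval_at_Z hactZr.
Qed.

(** The inner product S(h_2) h_3 cancels. By [antipode_uniq] this identity determines [contra_fun],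
    and its R-linearity and multiplicativity are derived from it. *)
Lemma contra_fun_ev h f m : tlift (fun a b => contra_fun a f (p b *: m)) (hcomul h) = X h (eval_at f m).
Proof.
pose F (a b x : H) : R := X a (eval_at f (p (S b) *: (p x *: m))).
transitivity (tlift (fun a b => tlift (fun b1 b2 => F a b1 b2) (hcomul b)) (hcomul h)).
  rewrite (coassoc_lift (F := F) (@hcomulA _ H)) // /F.
  - move=> a; split=> [b b' y|b y y'|r b y].
    + by rewrite linearD hprojD scalerDl eval_at_D hactDr.
    + by rewrite hprojD scalerDl scalerDr eval_at_D hactDr.
    + rewrite linearZ /= !hprojZ -!scalerA eval_at_Z hactZr [in RHS]scalerA -calH_alg.
      by rewrite -[in RHS]scalerA eval_at_Z hactZr.
  - by move=> y; apply: contra_fun_bal.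
rewrite -[in RHS](hcounitP h).2.
rewrite (morph_tlift (F := fun g => X g (eval_at f m)) _ _ (fun g g' => hactDl X g g' _)).
apply: eq_tlift => a b; rewrite /F.
have FD : {morph (fun g => X a (eval_at f (p g *: m))) : g h / g + h}.
  by move=> g g'; rewrite hprojD scalerDl eval_at_D hactDr.
transitivity (X a (eval_at f (p (hcounit b *: 1) *: m))); last first.
  by rewrite hprojZ hproj1 mulr1 eval_at_Z hactZr hactZl.
rewrite -(hantipodeP b).1 (morph_tlift (F := fun g => X a (eval_at f (p g *: m))) _ _ FD).
by apply: eq_tlift => b1 b2; rewrite hprojM scalerA.
Qed.

Lemma hact_mulC h x y : X h (x * y) = tlift (fun a b => X a y * X b x) (hcomul h).
Proof. by rewrite mulrC hact_mul. Qed.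

(* Here the action on M has to factor through calH: x h = \sum h_1 (S(h_2) . x)
   fails in R # H. *)
Lemma contra_fun_incl h f x m : contra_fun h f (i x *: m) = x * contra_fun h f m.
Proof.
apply/subr0_eq; move: h m.
apply: antipode_uniq => [g h m|h m n|r h m|h m].
- by rewrite !contra_funDl mulrDr opprD addrACA.
- by rewrite scalerDr !contra_funDr mulrDr opprD addrACA.
- have -> : i x *: (i (j r) *: m) = i (j r) *: (i x *: m).
    by rewrite !scalerA calH_alg.
  by rewrite !contra_funZ !contra_funZr.
rewrite (eq_tlift (g := fun a b => contra_fun a f (i x *: (p b *: m)) + - (x * contra_fun a f (p b *: m)))) //.
rewrite tliftDf -[X in _ + X](morph_tlift (F := fun y => - (x * y))); last first.
  by move=> y z; rewrite mulrDr opprD.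
rewrite contra_fun_ev; apply/eqP; rewrite subr_eq0; apply/eqP.
(* After x h = \sum h_1 (S(h_2) . x) the left side is \sum h_1 . ((S(h_2) . x) f(m)). Commutativity
   of R turns this into \sum (h_1 . f(m)) (h_2 S(h_3) . x) = x (h . f(m)). *)
transitivity (tlift (fun a b => tlift (fun b1 b2 =>
    contra_fun a f (p b1 *: (i (X (S b2) x) *: m))) (hcomul b)) (hcomul h)).
  apply: eq_tlift => a b; rewrite [X in contra_fun a f X]scalerA antipode_incl.
  rewrite (morph_tlift _ _ (fun y z : A => scalerDl m y z)) (morph_tlift _ _ (contra_funDr a f)).
  by apply: eq_tlift => b1 b2; rewrite scalerA.
rewrite (coassoc_lift (F := fun a b1 b2 => contra_fun a f (p b1 *: (i (X (S b2) x) *: m))) (@hcomulA _ H)).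
- transitivity (tlift (fun a b => tlift (fun b1 b2 =>
      X a (eval_at f m) * X (b1 * S b2) x) (hcomul b)) (hcomul h)).
    rewrite (coassoc_lift (F := fun a b1 b2 => X a (eval_at f m) * X (b1 * S b2) x) (@hcomulA _ H)).
    + apply: eq_tlift => a b; rewrite contra_fun_ev eval_at_Z hact_mulC.
      by apply: eq_tlift => a1 a2; rewrite hactM.
    + move=> a; split=> [b b' y|b y y'|r b y].
      * by rewrite mulrDl hactDl mulrDr.
      * by rewrite linearD mulrDr hactDl mulrDr.
      * by rewrite linearZ /= -scalerAl -scalerAr.
    + move=> y; split=> [a a' b|a b b'|r a b].
      * by rewrite hactDl mulrDl.
      * by rewrite mulrDl hactDl mulrDr.
      * by rewrite hactZl -scalerAl hactZl mulrCA mulrA.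
  rewrite -[in RHS](hcounitP h).2.
  rewrite (morph_tlift (F := fun g => X g (eval_at f m)) _ _ (fun g g' => hactDl X g g' _)).
  rewrite (morph_tlift _ _ (mulrDr x)); apply: eq_tlift => a b.
  have FD : {morph (fun g => X a (eval_at f m) * X g x) : g h / g + h}.
    by move=> g g'; rewrite hactDl mulrDr.
  rewrite -(morph_tlift (F := fun g => X a (eval_at f m) * X g x) _ _ FD).
  rewrite (hantipodeP b).2 !hactZl hact1 mulrCA [RHS]mulrCA; congr (_ * _).
  exact: mulrC.
- move=> a; split=> [b b' y|b y y'|r b y].
  + by rewrite hprojD scalerDl contra_funDr.
  + by rewrite linearD hactDl rmorphD scalerDl scalerDr contra_funDr.
  + by rewrite linearZ hactZl hprojZ calH_alg (rmorphM i) -!scalerA.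
- move=> y; split=> [a a' b|a b b'|r a b].
  + by rewrite contra_funDl.
  + by rewrite hprojD scalerDl contra_funDr.
  + by rewrite contra_funZ hprojZ -scalerA contra_funZr.
Qed.

Lemma contra_fun_linear h f : linear (contra_fun h f : restr i M -> GRing.regular R).
Proof. by move=> r m n; rewrite contra_funDr -[r *: m]/(i r *: (m : M)) contra_fun_incl. Qed.

Definition contra (h : H) (f : M') : M' := mkdual (contra_fun_linear h f).

Lemma contraE h f m : eval_at (contra h f) m = contra_fun h f m.
Proof. by []. Qed.

Lemma eval_atP (f g : M') : (forall m, eval_at f m = eval_at g m) -> f = g.
Proof. exact: (@ldualP R (restr i M) f g). Qed.

(** The antimultiplicativity of the antipode is avoided: [antipode_uniq] is applied in g and in h,
    and after both convolutions the two sides become (g h) . f(m) and g . (h . f(m)). *)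
Lemma contra_M g h f : contra (g * h) f = contra g (contra h f).
Proof.
apply: eval_atP => m; rewrite !contraE; apply/subr0_eq; move: g h m.
pose Psi g h m := contra_fun (g * h) f m - contra_fun g (contra h f) m.
have PDg h : forall g g' m, Psi (g + g') h m = Psi g h m + Psi g' h m.
  by move=> g g' m; rewrite /Psi mulrDl !contra_funDl opprD addrACA.
have PDh g : forall h h' m, Psi g (h + h') m = Psi g h m + Psi g h' m.
  move=> h h' m; rewrite /Psi mulrDr contra_funDl [RHS]addrACA; congr (_ + _).
  rewrite -opprD; congr (- _); rewrite /contra_fun -tliftDf; apply: eq_tlift => a b.
  by rewrite !contraE contra_funDl hactDr.
have PDm g h : forall m n, Psi g h (m + n) = Psi g h m + Psi g h n.
  by move=> m n; rewrite /Psi !contra_funDr opprD addrACA.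
have PZg h : forall r g m, Psi (r *: g) h m = Psi g h (i (j r) *: m).
  by move=> r g m; rewrite /Psi -scalerAl !contra_funZ !contra_funZr.
have PZh g : forall r h m, Psi g (r *: h) m = Psi g h (i (j r) *: m).
  move=> r h m; rewrite /Psi -scalerAr !contra_funZ !contra_funZr; congr (_ - _).
  rewrite /contra_fun (morph_tlift _ _ (mulrDr (j r))); apply: eq_tlift => a b.
  by rewrite !contraE contra_funZ hactZr.
suff H2 h : forall g m, tlift (fun u v => Psi u h (p v *: m)) (hcomul g) = 0.
  move=> g h; move: g; apply: (antipode_uniq (F := fun g => Psi g h)) => //.
move=> g m; move: h m.
apply: (antipode_uniq (F := fun h m => tlift (fun u v => Psi u h (p v *: m)) (hcomul g))) => [h h' m|h m n|r h m|h m].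
- by rewrite -tliftDf; apply: eq_tlift => u v; rewrite PDh.
- by rewrite -tliftDf; apply: eq_tlift => u v; rewrite scalerDr PDm.
- apply: eq_tlift => u v; rewrite PZh; congr (Psi _ _ _).
  by rewrite !scalerA calH_alg.
have [lh eh] := tensP (hcomul h); have [lg eg] := tensP (hcomul g).
have e1 : X (g * h) (eval_at f m) = \sum_(y <- lh) \sum_(x <- lg)
    contra_fun (x.1 * y.1) f (p x.2 *: (p y.2 *: m)).
  rewrite -contra_fun_ev (hcomulM eg eh) tlift_tsum; last first.
    split=> [a a' b|a b b'|r a b].
    - exact: contra_funDl.
    - by rewrite hprojD scalerDl contra_funDr.
    - by rewrite contra_funZ hprojZ -scalerA contra_funZr.
  rewrite big_allpairs_dep exchange_big; apply: eq_bigr => y _; apply: eq_bigr => x _.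
  by rewrite /= hprojM scalerA.
have e2 : X g (X h (eval_at f m)) = \sum_(y <- lh) \sum_(x <- lg)
    contra_fun x.1 (contra y.1 f) (p x.2 *: (p y.2 *: m)).
  rewrite -[X h _]contra_fun_ev eh tlift_tsum; last first.
    split=> [a a' b|a b b'|r a b].
    - exact: contra_funDl.
    - by rewrite hprojD scalerDl contra_funDr.
    - by rewrite contra_funZ hprojZ -scalerA contra_funZr.
  rewrite (big_morph _ (hactDr X g) (morph_add0 (hactDr X g))); apply: eq_bigr => y _.
  rewrite -contraE -contra_fun_ev eg tlift_tsum //.
  split=> [a a' b|a b b'|r a b].
  - exact: contra_funDl.
  - by rewrite hprojD scalerDl contra_funDr.
  - by rewrite contra_funZ hprojZ -scalerA contra_funZr.
rewrite eh tlift_tsum; last first.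
  split=> [a a' b|a b b'|r a b].
  - by rewrite -tliftDf; apply: eq_tlift => u v; rewrite PDh.
  - by rewrite -tliftDf; apply: eq_tlift => u v; rewrite hprojD scalerDl scalerDr PDm.
  - apply: eq_tlift => u v; rewrite PZh; congr (Psi _ _ _).
    by rewrite hprojZ !scalerA mulrA [i (j r) * p v]calH_alg.
transitivity (X (g * h) (eval_at f m) - X g (X h (eval_at f m))); last by rewrite hactM subrr.
rewrite e1 e2 -sumrB; apply: eq_bigr => y _; rewrite -sumrB eg tlift_tsum //.
split=> [a a' b|a b b'|r a b].
- by rewrite PDg.
- by rewrite hprojD scalerDl PDm.
- by rewrite PZg hprojZ -scalerA.
Qed.

Lemma antipode1 : S (1 : H) = 1.
Proof.
have B : balanced (fun a b : H => S a * b).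
  split=> [a a' b|a b b'|r a b].
  - by rewrite linearD mulrDl.
  - by rewrite mulrDr.
  - by rewrite linearZ /= -scalerAl -scalerAr.
have := (hantipodeP (1 : H)).1.
by rewrite hcomul1 (tliftE _ _ B) mulr1 hcounit1 scale1r.
Qed.

Lemma contra_semilinear : semilinear_ops X c s (d 1%N) contra.
Proof.
split=> [g h f|h f g|r h f|f|g h f|h x f|f]; apply: eval_atP => m.
- exact: contra_funDl.
- change (contra_fun h (f + g) m = contra_fun h f m + contra_fun h g m).
  rewrite /contra_fun -tliftDf.
  by apply: eq_tlift => a b; rewrite -hactDr.
- exact: contra_funZ.
- rewrite contraE /contra_fun hcomul1 (tliftE _ _ (contra_fun_bal f m)) antipode1 hproj1 scale1r.
  exact: hact1.
- by rewrite contra_M.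
- rewrite (morph_tlift (F := fun f => eval_at f m) (Z := R) _ _ (ldual_eval_D (m : restr i M))).
  pose F (a b1 b2 : H) : R := X a x * X b1 (eval_at f (p (S b2) *: m)).
  transitivity (tlift (fun a b => tlift (fun a1 a2 => F a1 a2 b) (hcomul a)) (hcomul h)).
    by apply: eq_tlift => a b; rewrite -hact_mul.
  rewrite -(coassoc_lift (F := F) (@hcomulA _ H)) /F.
  + by apply: eq_tlift => a b; rewrite -(morph_tlift _ _ (mulrDr (X a x))).
  + move=> a; split=> [b b' y|b y y'|r b y].
    * by rewrite hactDl mulrDr.
    * by rewrite linearD hprojD scalerDl eval_at_D hactDr mulrDr.
    * by rewrite linearZ /= hprojZ -scalerA eval_at_Z hactZl hactZr.
  + move=> y; split=> [a a' b|a b b'|r a b].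
    * by rewrite hactDl mulrDl.
    * by rewrite hactDl mulrDr.
    * by rewrite !hactZl mulrCA mulrA.
- change (contra_fun (d 1%N) f m = c * (contra_fun s f m - eval_at f m)).
  have B : balanced (fun a b : H => contra_fun a f (p b *: m)).
    split=> [a a' b|a b b'|r a b].
    - exact: contra_funDl.
    - by rewrite hprojD scalerDl contra_funDr.
    - by rewrite contra_funZ hprojZ -scalerA contra_funZr.
  (* [contra_fun_ev] gives (s f)(s m) = s . f(m) at s and (d_1 f)(m) + (s f)(d_1 m) = d_1 . f(m) at
     d_1. Replacing d_1 by c (s - 1) on M and on R yields the relation. *)
  have es := contra_fun_ev s f m; rewrite (qh_comul_s P) (tliftE _ _ B) in es.
  have ed := contra_fun_ev (d 1%N) f m.
  rewrite (qh_comul_d P) !big_ord_recr big_ord0 /= add0r (tlift_add B) in ed.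
  rewrite !(tliftE _ _ B) !(qh_d0 P) expr0 expr1 mul1r mulr1 hproj1 scale1r in ed.
  rewrite hproj_d1 -scalerA contra_fun_incl scalerBl scale1r contra_funDr in ed.
  rewrite (morph_addN (contra_funDr s f)) es Xc in ed.
  by apply: (addIr (c * (X s (eval_at f m) - contra_fun s f m))); rewrite ed -mulrDr; congr (_ * _); rewrite [RHS]addrC addrA subrK.
Qed.

(* M' is already an R-module, so the A-module structure is put on a copy of it. *)
Definition dual_carrier : Type := M'.
HB.instance Definition _ := GRing.Zmodule.on dual_carrier.

Definition dual_act (a : A) (f : dual_carrier) : dual_carrier := cact contra a (f : M').

Fact dual_actM a b f : dual_act a (dual_act b f) = dual_act (a * b) f.
Proof. by rewrite /dual_act (cactM contra_semilinear). Qed.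
Fact dual_act1 : left_id 1 dual_act.
Proof. exact: (cact1 contra_semilinear). Qed.
Fact dual_actDr : right_distributive dual_act +%R.
Proof. exact: (cactDr contra_semilinear). Qed.
Fact dual_actDl f : {morph dual_act^~ f : a b / a + b}.
Proof. exact: (cactDl contra_semilinear). Qed.

Definition dual_mod : lmodType A := HB.pack dual_carrier
  (GRing.Zmodule_isLmodule.Build A dual_carrier dual_actM dual_act1 dual_actDr dual_actDl).

Lemma dual_mod_p h (f : dual_mod) : p h *: f = contra h f.
Proof. exact: (cact_hproj contra_semilinear). Qed.
Lemma dual_mod_incl x (f : dual_mod) : i x *: f = x *: (f : M').
Proof. exact: (cact_incl contra_semilinear). Qed.
End DualModule.

Local Notation B := (calH_xR_bialgebra N_gt1 q_prim P Xc tt' Xt).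
Local Notation "m *e n" := (modtens_elt B m n) (at level 40).

Lemma calH_linear (M M' : lmodType A) (F : M -> M') : {morph F : u v / u + v} ->
  (forall x u, F (i x *: u) = i x *: F u) -> (forall h u, F (p h *: u) = p h *: F u) ->
  linear F.
Proof.
move=> FD Fi Fp a u v; rewrite FD; congr (_ + _); move: a.
apply: calH_ext => [a b|a b|x h].
- by rewrite scalerDl FD.
- by rewrite scalerDl.
- by rewrite -!scalerA Fi Fp.
Qed.

Lemma hproj_scale_elt (M M' : lmodType A) h (m : M) (m' : M') :
  p h *: (m *e m') = tlift (fun a b => (p a *: m) *e (p b *: m')) (hcomul h).
Proof.
have hb := act_balanced m m' (elt_mbal B M M').
rewrite modtens_scaleE calH_D_p /hdelta (morph_tlift _ _ (tlift_add hb)).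
by apply: eq_tlift => a b; rewrite (tliftE _ _ hb).
Qed.

Lemma calH_unit_p h (x : modunit B) : p h *: x = X h (x : R) :> R.
Proof.
have S := hact_semilinear Xc.
transitivity (actR (p h * i (x : R)) 1) => //.
rewrite [LHS](cactM S) -[RHS](actR_p Xc); congr (actR _ _).
by rewrite [LHS](cact_incl S) [LHS]mulr1.
Qed.

(** * Evaluation and coevaluation *)

Section DualObject.
Variables (M : lmodType A) (n : nat) (v : 'I_n -> M) (phi : 'I_n -> dual_mod M).
Hypothesis vphi : forall m, m = \sum_(l < n) i (eval_at (phi l) m) *: v l.
Local Notation Y := (dual_mod M).

Definition pairing (f : Y) (m : M) : modunit B := eval_at f m.

Lemma pairing_mbal : mbal i pairing.
Proof.
split=> [f g m|f m m'|r f m].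
- by [].
- exact: eval_at_D.
- rewrite /pairing dual_mod_incl.
  by rewrite -[LHS]/(r * eval_at f m : R) eval_at_Z.
Qed.

Lemma pairing_linear : linear (mlift (B := B) pairing).
Proof.
have FD := mliftD (B := B) pairing_mbal.
apply: calH_linear => [//|x u|h u]; move: u; apply: modtens_ext => [u u'|u u'|f m].
- by rewrite scalerDr FD.
- by rewrite FD scalerDr.
- rewrite elt_incl !(mliftE B _ _ pairing_mbal) /pairing dual_mod_incl.
  by rewrite [RHS]modunit_incl.
- by rewrite scalerDr FD.
- by rewrite FD scalerDr.
- rewrite hproj_scale_elt (morph_tlift _ _ FD) (mliftE B _ _ pairing_mbal).
  rewrite [RHS]calH_unit_p -[RHS]contra_fun_ev; apply: eq_tlift => a b.
  by rewrite (mliftE B _ _ pairing_mbal) /pairing dual_mod_p.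
Qed.

Definition dual_ev : {linear modtens B Y M -> modunit B} := mklin pairing_linear.
Lemma dual_evE f m : dual_ev (f *e m) = eval_at f m.
Proof. exact: (mliftE B f m pairing_mbal). Qed.

Lemma apply_mbal m' : mbal i (fun (m : M) (f : Y) => i (eval_at f m') *: m).
Proof.
split=> [m1 m2 f|m f g|r m f].
- by rewrite scalerDr.
- by rewrite -[eval_at (f + g) m']/(eval_at f m' + eval_at g m') rmorphD scalerDl.
- rewrite dual_mod_incl -[eval_at (r *: _) m']/(r * eval_at f m').
  by rewrite scalerA -rmorphM mulrC.
Qed.

(** The endomorphism of M attached to z, evaluated at m'; a pure tensor m (x) f gives m' |-> f(m')
    m. *)
Definition tapply (m' : M) (z : modtens B M Y) : M :=
  mlift (fun (m : M) (f : Y) => i (eval_at f m') *: m) z.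

Lemma tapplyE m' m f : tapply m' (m *e f) = i (eval_at f m') *: m.
Proof. exact: (mliftE B m f (apply_mbal m')). Qed.
Lemma tapplyD m' : {morph tapply m' : z z' / z + z'}.
Proof. exact: (mliftD (B := B) (apply_mbal m')). Qed.
Lemma tapplyDl m1 m2 z : tapply (m1 + m2) z = tapply m1 z + tapply m2 z.
Proof.
rewrite /tapply /mlift -tliftDf; apply: eq_tlift => m f.
by rewrite eval_at_D rmorphD scalerDl.
Qed.
Lemma tapplyZl x m' z : tapply (i x *: m') z = i x *: tapply m' z.
Proof.
rewrite /tapply /mlift (morph_tlift _ _ (scalerDr (i x))); apply: eq_tlift => m f.
by rewrite eval_at_Z rmorphM scalerA.
Qed.
Lemma tapplyZ x m' z : tapply m' (i x *: z) = i x *: tapply m' z.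
Proof.
move: z; apply: modtens_ext => [z z'|z z'|m f].
- by rewrite scalerDr tapplyD.
- by rewrite tapplyD scalerDr.
- by rewrite elt_incl !tapplyE !scalerA -!rmorphM mulrC.
Qed.

Lemma dual_expand (f : Y) : f = \sum_(l < n) i (eval_at f (v l)) *: phi l.
Proof.
apply: (@eval_atP M f) => m.
rewrite [RHS](big_morph (fun f : Y => eval_at f m) (op1 := +%R) (id1 := 0)) //.
rewrite {1}[m]vphi (big_morph _ (eval_at_D f) (morph_add0 (eval_at_D f))).
apply: eq_bigr => l _; rewrite eval_at_Z dual_mod_incl.
by rewrite -[RHS]/(eval_at f (v l) * eval_at (phi l) m) mulrC.
Qed.

(* So M (x) M' embeds into the endomorphisms of M. *)
Lemma tapply_inv (z : modtens B M Y) : z = \sum_(l < n) tapply (v l) z *e phi l.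
Proof.
move: z; apply: modtens_ext => [//|z z'|m f].
- by rewrite -big_split; apply: eq_bigr => l _; rewrite tapplyD eltDl.
rewrite {1}[f]dual_expand.
rewrite (big_morph (fun f : Y => m *e f) (fun f g : Y => eltDr B m f g)
  (morph_add0 (fun f g : Y => eltDr B m f g))).
by apply: eq_bigr => l _; rewrite tapplyE eltZ.
Qed.

Definition coev_elt : modtens B M Y := \sum_(l < n) v l *e phi l.

(** [coev_elt] corresponds to the identity of M, and after convolution the claim is \sum (h_1
    coev)(h_2 m) = h m. The left side is the sum over l of (h_2 phi_l)(h_3 m) h_1 v_l. By
    [contra_fun_ev] the coefficient becomes h_2 . phi_l(m), and [hproj_incl_swap] gathers the terms
    into h (phi_l(m) v_l). *)
Lemma coev_invariant h : p h *: coev_elt = i (j (hcounit h)) *: coev_elt.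
Proof.
suff e m' : tapply m' (p h *: coev_elt) = tapply m' (i (j (hcounit h)) *: coev_elt).
  by rewrite [LHS]tapply_inv [RHS]tapply_inv; apply: eq_bigr => l _; rewrite e.
have -> : tapply m' (i (j (hcounit h)) *: coev_elt) = i (j (hcounit h)) *: m'.
  rewrite tapplyZ /coev_elt (big_morph _ (tapplyD m') (morph_add0 (tapplyD m'))).
  by rewrite {2}[m']vphi; congr (_ *: _); apply: eq_bigr => l _; rewrite tapplyE.
apply/subr0_eq; move: h m'.
apply: antipode_uniq => [g h m|h m m'|r h m|h m].
- rewrite hprojD scalerDl tapplyD linearD !rmorphD scalerDl.
  by rewrite opprD addrACA.
- by rewrite tapplyDl scalerDr opprD addrACA.
- have -> : hcounit (r *: h) = r * hcounit h by rewrite linearZ.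
  rewrite hprojZ -scalerA tapplyZ tapplyZl; congr (_ - _).
  by rewrite scalerA -!rmorphM mulrC.
rewrite (eq_tlift (g := fun a b => tapply (p b *: m) (p a *: coev_elt) +
  - (i (j (hcounit a)) *: (p b *: m)))) // tliftDf.
have e2 : tlift (fun a b => - (i (j (hcounit a)) *: (p b *: m))) (hcomul h) = - (p h *: m).
  rewrite -{2}(hcounitP h).1 (morph_tlift _ _ (hprojD X c s (d 1%N))).
  rewrite (morph_tlift _ _ (fun x y : A => scalerDl m x y)) (morph_tlift _ _ (@opprD _)).
  by apply: eq_tlift => a b; rewrite hprojZ scalerA.
have e1 : tlift (fun a b => tapply (p b *: m) (p a *: coev_elt)) (hcomul h) = p h *: m.
  pose F l (a b1 b2 : H) : M := i (contra_fun b1 (phi l) (p b2 *: m)) *: (p a *: v l).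
  transitivity (\sum_(l < n) tlift (fun a b => tlift (fun a1 a2 => F l a1 a2 b) (hcomul a)) (hcomul h)).
    rewrite /tlift [RHS]exchange_big; apply: eq_bigr => x _ /=.
    rewrite /coev_elt scaler_sumr (big_morph _ (tapplyD _) (morph_add0 (tapplyD _))).
    apply: eq_bigr => l _; rewrite hproj_scale_elt (morph_tlift _ _ (tapplyD _)).
    by apply: eq_bigr => y _; rewrite tapplyE dual_mod_p.
  rewrite [X in _ = _ *: X]vphi scaler_sumr; apply: eq_bigr => l _.
  rewrite -(coassoc_lift (F := F l) (@hcomulA _ H)) /F.
  - transitivity (tlift (fun a b => i (X b (eval_at (phi l) m)) *: (p a *: v l)) (hcomul h)).
      apply: eq_tlift => a b; rewrite -contra_fun_ev (morph_tlift _ _ (raddfD i)).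
      by rewrite (morph_tlift _ _ (fun x y : A => scalerDl _ x y)).
    rewrite [RHS]scalerA (hproj_incl_swap N_gt1 q_prim P Xc tt' Xt).
    rewrite (morph_tlift _ _ (fun x y : A => scalerDl (v l) x y)).
    by apply: eq_tlift => a b; rewrite scalerA.
  - move=> a; split=> [b b' y|b y y'|r b y].
    + by rewrite contra_funDl rmorphD scalerDl.
    + by rewrite hprojD scalerDl contra_funDr rmorphD scalerDl.
    + by rewrite contra_funZ hprojZ -scalerA contra_funZr.
  - move=> y; split=> [a a' b|a b b'|r a b].
    + by rewrite hprojD scalerDl scalerDr.
    + by rewrite contra_funDl rmorphD scalerDl.
    + by rewrite contra_funZ hprojZ -scalerA !scalerA -rmorphM mulrC.
by rewrite e1 e2 subrr.
Qed.

Lemma coev_linear : linear (fun x : modunit B => i (x : R) *: coev_elt).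
Proof.
apply: calH_linear => [x y|r x|h x].
- by rewrite rmorphD scalerDl.
- by rewrite modunit_incl scalerA -rmorphM.
- rewrite calH_unit_p scalerA hproj_incl (morph_tlift _ _ (fun x y : A => scalerDl _ x y)).
  rewrite -[in LHS](hcounitP h).2.
  rewrite (morph_tlift (F := fun g => X g (x : R)) _ _ (fun g g' => hactDl X g g' _)).
  rewrite (morph_tlift _ _ (raddfD i)) (morph_tlift _ _ (fun x y : A => scalerDl _ x y)).
  apply: eq_tlift => a b; rewrite hactZl -scalerA coev_invariant scalerA -rmorphM.
  by rewrite mulrC.
Qed.

Definition dual_coev : {linear modunit B -> modtens B M Y} := mklin coev_linear.

Lemma dual_coev1 : dual_coev (1 : R) = coev_elt.
Proof. exact: etrans (congr1 (fun a : A => a *: coev_elt) (rmorph1 i)) (scale1r _). Qed.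

Lemma dual_zigzag_l m : runit_lin B M (tmor_lin B (linear_id M) dual_ev
  (assoc_lin B M Y M (tmor_lin B dual_coev (linear_id M) (lunitV_lin B M m)))) = m.
Proof.
rewrite (_ : lunitV_lin B M m = (1 : modunit B) *e m) // tmor_elt dual_coev1 linear_idE.
rewrite (big_morph (fun z : modtens B M Y => z *e m) (fun z z' => eltDl B z z' m)
  (morph_add0 (fun z z' => eltDl B z z' m))).
rewrite (linear_sum (assoc_lin B M Y M)) (linear_sum (tmor_lin B (linear_id M) dual_ev)).
rewrite (linear_sum (runit_lin B M)) [RHS]vphi; apply: eq_bigr => l _.
by rewrite assoc_elt tmor_elt dual_evE runit_elt.
Qed.

Lemma dual_zigzag_r (f : Y) : lunit_lin B Y (tmor_lin B dual_ev (linear_id Y)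
  (assocV_lin B Y M Y (tmor_lin B (linear_id Y) dual_coev (runitV_lin B Y f)))) = f.
Proof.
rewrite (_ : runitV_lin B Y f = f *e (1 : modunit B)) // tmor_elt dual_coev1 linear_idE.
rewrite (big_morph (fun z : modtens B M Y => f *e z) (eltDr B f)
  (morph_add0 (eltDr B f))).
rewrite (linear_sum (assocV_lin B Y M Y)) (linear_sum (tmor_lin B dual_ev (linear_id Y))).
rewrite (linear_sum (lunit_lin B Y)) [RHS]dual_expand; apply: eq_bigr => l _.
by rewrite assocV_elt tmor_elt dual_evE lunit_elt.
Qed.
End DualObject.

Lemma calH_has_dual (M : lmodType A) :
  finitely_generated (restr i M) -> projective (restr i M) ->
  has_dual (mod_tensor_data B (calH_cocomm N_gt1 q_prim P Xc tt' Xt)) M.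
Proof.
move=> fgM projM; have [n [v [phi vphi]]] := dual_basis fgM projM.
pose v' : 'I_n -> M := v; pose phi' : 'I_n -> dual_mod M := phi.
have vphi' (m : M) : m = \sum_(l < n) i (eval_at (phi' l) m) *: v' l by apply: vphi.
exists (dual_mod M), (dual_ev M), (dual_coev vphi').
split; apply: linear_eq => x.
- exact: dual_zigzag_l.
- exact: dual_zigzag_r.
Qed.
End Dual.

(** * Specialization to iterative q-difference operators *)

Lemma kq_gen_prim (C : fieldType) (q : C) N :
  N.-primitive_root q -> N.-primitive_root (kq_gen q).
Proof. by rewrite -(fmorph_primitive_root (val : kq q -> C)). Qed.

Theorem theorem3p15 (C : fieldType) (q : C) (N : nat)
  (N_gt1 : (1 < N)%N) (q_root : N.-primitive_root q)
  (R : comNzRingType) (iota : {rmorphism {fraction {poly C}} -> R})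
  (sq : {rmorphism R -> R}) (sq_bij : bijective sq)
  (sq_ext : extends_dilation q iota sq)
  (dR : nat -> R -> R) (dR_iter : iterative_qdiff q iota sq dR)
  (H : hopfAlgebra (kq q)) (s : H) (d : nat -> H)
  (H_pres : qdiff_hopf (kq_gen q) N s d)
  (X : moduleAlgebra (kq_incl q iota) H)
  (X_s : forall x, X s x = sq x) (X_d : forall n x, X (d n) x = dR n x) :
  let A := calH X (qdiff_coef q iota) s (d 1%N) in
  let i : {rmorphism R -> A} := calH_incl X (qdiff_coef q iota) s (d 1%N) in
  exists (D : {linear rmod i -> tens (rmod i) (rmod i)})
         (e : {linear rmod i -> GRing.regular R}),
  [/\ calH_induced D e, cocommutative D &
  exists (B : xR_bialgebra (kq_incl q iota) D e)
         (T : @tensor_data (modcat A) (modtens B) (modunit B)),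
  [/\ canonical_tensor_data T, symmetric_tensor_category T &
  forall M : lmodType A,
    finitely_generated (restr i M) -> projective (restr i M) -> has_dual T M]].
Proof.
have Xc x : X (d 1%N) x = qdiff_coef q iota * (X s x - x).
  by rewrite X_d X_s (iq_1 dR_iter).
(* The variable of C(t) is a unit of R and an eigenvector of [sq] with eigenvalue q; these are the
   data on which [dedekind] rests. *)
have tt' : iota (tofrac 'X) * iota (tofrac 'X)^-1 = 1.
  by rewrite -rmorphM mulfV ?rmorph1 // tofrac_eq0 polyX_eq0.
have Xt : X s (iota (tofrac 'X)) = kq_incl q iota (kq_gen q) * iota (tofrac 'X).
  (* The dilation formula for the fraction 'X / 1. *)
  have := sq_ext 'X 1 (oner_neq0 _).
  rewrite tofrac1 divr1 -[1 \Po _]/((1%:P : {poly C}) \Po _) comp_polyC comp_polyX.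
  by rewrite tofrac1 divr1 -mul_polyC tofracM rmorphM X_s.
have q_prim := kq_gen_prim q_root.
pose B := calH_xR_bialgebra N_gt1 q_prim H_pres Xc tt' Xt.
move=> A i; exists (calH_D N_gt1 q_prim H_pres Xc tt' Xt), (calH_e Xc).
split; [exact: calH_induced_D | exact: calH_cocomm |].
exists B, (mod_tensor_data B (calH_cocomm N_gt1 q_prim H_pres Xc tt' Xt)).
split; [exact: mod_canonical | exact: mod_symmetric | exact: calH_has_dual].
Qed.
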